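(* Assume that $V$ is self-adjoint with $|V(x)|\lesssim\langle x\rangle^{-\beta}$ for some $\beta>2$. If $\phi\in\ker(T)$ (as an operator on $L^2$), then $\phi=Uv\psi$ for some distributional solution $\psi$ of $H\psi=0$ with $\psi\in L^p(\mathbb R^2)$ for all $2<p\le\infty$.
   Context: Functions are $\mathbb C^2$-valued on $\mathbb R^2$ and $L^p$ means $L^p(\mathbb R^2;\mathbb C^2)$. $D_0=-i\alpha\cdot\nabla=-i(\alpha_1\partial_1+\alpha_2\partial_2)$ with $\alpha_1=\begin{pmatrix}0&1\\1&0\end{pmatrix}$, $\alpha_2=\begin{pmatrix}0&-i\\ i&0\end{pmatrix}$; $V:\mathbb R^2\to\mathbb C^{2\times2}$ is Hermitian matrix valued; $H=D_0+V$. $\langle x\rangle=(1+|x|^2)^{1/2}$, and $|V(x)|\lesssim\langle x\rangle^{-\beta}$ means every entry satisfies this bound with some constant. Diagonalize $V=B^*\,\mathrm{diag}(\zeta_1,\zeta_2)B$ pointwise with $B(x)$ unitary, $\zeta_j(x)\in\mathbb R$; put $\eta_j=|\zeta_j|^{1/2}$, $v=\mathrm{diag}(\eta_1,\eta_2)B$, $U=\mathrm{diag}(\mathrm{sign}\,\zeta_1,\mathrm{sign}\,\zeta_2)$ (with $\mathrm{sign}\,0:=1$), so $V=v^*Uv$. $\mathcal G_{0,0}$ is the integral operator with kernel $\frac{i\alpha\cdot(x-y)}{2\pi|x-y|^2}$, and $T=U+v\mathcal G_{0,0}v^*$. *)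

(* Defs.v *)
From HB Require Import structures.
From mathcomp Require Import all_boot all_order all_algebra.
From mathcomp Require Import sesquilinear spectral.
From mathcomp Require Import complex.
From mathcomp Require Import all_classical all_reals all_analysis.

Set Implicit Arguments.
Unset Strict Implicit.
Unset Printing Implicit Defensive.

Import Order.TTheory GRing.Theory Num.Theory.
Import numFieldNormedType.Exports.

Local Open Scope classical_set_scope.
Local Open Scope ring_scope.
Local Open Scope complex_scope.
Local Open Scope sesquilinear_scope.

(* R^2 with the product of the Borel sigma-algebras that lebesgue_measure lives
   on; as a type it is convertible to R * R, whose topology and normed module
   structure are used for continuity, derivatives and compactness. *)
Notation plane R := (measurableTypeR R * measurableTypeR R)%type.

Definition mu2 (R : realType) : {measure set (plane R) -> \bar R} :=
  (@lebesgue_measure R \x @lebesgue_measure R)%E.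

Definition coor (R : realType) (k : 'I_2) (x : R * R) : R :=
  if k == ord0 then x.1 else x.2.

Definition basis_vec (R : realType) (k : 'I_2) : R * R :=
  if k == ord0 then (1, 0) else (0, 1).

Definition sqnorm (R : realType) (x : R * R) : R := x.1 ^+ 2 + x.2 ^+ 2.

Definition japanese (R : realType) (x : R * R) : R := Num.sqrt (1 + sqnorm x).

(* Covers both C^2-valued functions (n = 1) and matrix-valued ones (n = 2). *)
Definition mx_measurable (R : realType) (m n : nat)
    (A : plane R -> 'M[R[i]]_(m, n)) : Prop :=
  forall i j, measurable_fun (setT : set (plane R)) (fun x => complex.Re (A x i j)) /\
              measurable_fun (setT : set (plane R)) (fun x => complex.Im (A x i j)).

Definition vec_norm (R : realType) (n : nat) (w : 'cV[R[i]]_n) : R :=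
  Num.sqrt (\sum_j Normc.normc (w j 0) ^+ 2).

Definition in_Lp (R : realType) (p : \bar R) (f : plane R -> 'cV[R[i]]_2) : Prop :=
  mx_measurable f /\ (fun x => vec_norm (f x)) \in Lfun (mu2 R) p.

Definition Cintegral (R : realType) (f : plane R -> R[i]) : R[i] :=
  (\int[mu2 R]_x complex.Re (f x)) +i* (\int[mu2 R]_x complex.Im (f x)).

Definition alpha1 (R : realType) : 'M[R[i]]_2 :=
  \matrix_(i, j) if i == j then 0 else 1.

Definition alpha2 (R : realType) : 'M[R[i]]_2 :=
  \matrix_(i, j) if i == j then 0 else if i == ord0 then - 'i else 'i.

Definition alpha (R : realType) (k : 'I_2) : 'M[R[i]]_2 :=
  if k == ord0 then alpha1 R else alpha2 R.

Definition partial (R : realType) (k : 'I_2) (f : R * R -> R) : R * R -> R :=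
  fun x => 'D_(basis_vec R k) f x.

(* C^infinity: partial derivatives of all orders, in any order of
   differentiation, exist and are continuous. *)
Definition smooth (R : realType) (f : R * R -> R) : Prop :=
  forall s : seq 'I_2, let g := foldr (@partial R) f s in
    continuous g /\ forall k x, derivable g x (basis_vec R k).

Definition test_function (R : realType) (chi : plane R -> R[i]) : Prop :=
  [/\ smooth (fun x => complex.Re (chi x)),
      smooth (fun x => complex.Im (chi x)) &
      compact (closure [set x | chi x != 0])].

Definition Cpartial (R : realType) (k : 'I_2) (chi : plane R -> R[i]) :
    plane R -> R[i] :=
  fun x => partial k (fun y => complex.Re (chi y)) x
           +i* partial k (fun y => complex.Im (chi y)) x.

Definition vec_locally_integrable (R : realType)
    (f : plane R -> 'cV[R[i]]_2) : Prop :=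
  mx_measurable f /\
  forall K : set (R * R), compact K ->
    (\int[mu2 R]_(x in K) (vec_norm (f x))%:E < +oo)%E.

(* The i-th components of the distributions f and D_0 f, evaluated at chi; the
   second formula combines -i with the sign in
   <d_k f, chi> = - <f, d_k chi>. *)
Definition dist (R : realType) (f : plane R -> 'cV[R[i]]_2)
    (chi : plane R -> R[i]) (i : 'I_2) : R[i] :=
  Cintegral (fun x => f x i 0 * chi x).

Definition D0_dist (R : realType) (f : plane R -> 'cV[R[i]]_2)
    (chi : plane R -> R[i]) (i : 'I_2) : R[i] :=
  'i * \sum_(k < 2) Cintegral (fun x => (alpha R k *m f x) i 0 * Cpartial k chi x).

Definition H_dist (R : realType) (V : plane R -> 'M[R[i]]_2)
    (f : plane R -> 'cV[R[i]]_2) (chi : plane R -> R[i]) (i : 'I_2) : R[i] :=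
  D0_dist f chi i + dist (fun x => V x *m f x) chi i.

Definition H_distributional_solution (R : realType) (V : plane R -> 'M[R[i]]_2)
    (psi : plane R -> 'cV[R[i]]_2) : Prop :=
  [/\ vec_locally_integrable psi,
      vec_locally_integrable (fun x => V x *m psi x) &
      forall chi, test_function chi -> forall i, H_dist V psi chi i = 0].

(* Num.sg is not used because Num.sg 0 = 0. *)
Definition sign1 (R : realType) (t : R) : R := if 0 <= t then 1 else -1.

Definition diagC (R : realType) (d : 'I_2 -> R) : 'M[R[i]]_2 :=
  diag_mx (\row_j (d j)%:C).

Definition diagonalizes (R : realType) (V B : plane R -> 'M[R[i]]_2)
    (zeta : 'I_2 -> plane R -> R) : Prop :=
  forall x, B x \is unitarymx /\
    V x = (B x)^t* *m diagC (fun j => zeta j x) *m B x.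

Definition vmx (R : realType) (B : plane R -> 'M[R[i]]_2)
    (zeta : 'I_2 -> plane R -> R) (x : R * R) : 'M[R[i]]_2 :=
  diagC (fun j => Num.sqrt `|zeta j x|) *m B x.

Definition Umx (R : realType) (zeta : 'I_2 -> plane R -> R) (x : R * R) :
    'M[R[i]]_2 :=
  diagC (fun j => sign1 (zeta j x)).

Definition G00_kernel (R : realType) (x y : R * R) : 'M[R[i]]_2 :=
  ('i / (2 * pi * sqnorm (x - y))%:C) *:
    \sum_(k < 2) (coor k (x - y))%:C *: alpha R k.

Definition G00 (R : realType) (f : plane R -> 'cV[R[i]]_2) (x : R * R) :
    'cV[R[i]]_2 :=
  \col_i Cintegral (fun y => (G00_kernel x y *m f y) i 0).

Definition T_op (R : realType) (B : plane R -> 'M[R[i]]_2)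
    (zeta : 'I_2 -> plane R -> R) (phi : plane R -> 'cV[R[i]]_2) (x : R * R) :
    'cV[R[i]]_2 :=
  Umx zeta x *m phi x
  + vmx B zeta x *m G00 (fun y => (vmx B zeta y)^t* *m phi y) x.

(* Elements of L^2 are represented by functions, so equality in L^2 is
   equality almost everywhere. *)
Definition ker_T (R : realType) (B : plane R -> 'M[R[i]]_2)
    (zeta : 'I_2 -> plane R -> R) (phi : plane R -> 'cV[R[i]]_2) : Prop :=
  in_Lp 2%:E phi /\ {ae mu2 R, forall x, T_op B zeta phi x = 0}.

(* Main.v *)
From HB Require Import structures.
Require Import Defs.
From mathcomp Require Import all_boot all_order all_algebra.
From mathcomp Require Import sesquilinear spectral.
From mathcomp Require Import complex.
From mathcomp Require Import all_classical all_reals all_analysis.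
From mathcomp Require Import measurable_realfun.
From mathcomp Require Import ring lra.

Import Order.TTheory GRing.Theory Num.Theory.
Import numFieldNormedType.Exports.

Local Open Scope classical_set_scope.
Local Open Scope ring_scope.
Local Open Scope complex_scope.

Set Implicit Arguments.
Unset Strict Implicit.
Unset Printing Implicit Defensive.

(** Write v^* for the adjoint of v and put psi := - G f, where G is the operator
    with kernel i alpha.(x-y) / (2 pi |x-y|^2) and f := v^* phi.  The equation
    T phi = 0 says U phi = v psi almost everywhere; since U^2 = 1, this is
    phi = U v psi, and applying v^* gives f = v^* U v psi = V psi.  Hence
    psi = - G (V psi), and because G inverts D_0, psi solves D_0 psi = - V psi.
    Two points need an argument: the size of psi, and the weak form of D_0 G = 1.

    Size.  Let F be the l^1 norm of f, let I[F](x) be the integral of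
    F(y) / |x-y|, and let w(y) = <y>^(-beta/2).  Both F <= C w |phi| (as f = v^* phi)
    and F <= C w^2 I[F] (as f = V psi) hold.  Inserting the first in the second
    bounds I[F](x) by the double integral of
      w(y)^2 w(z) |phi(z)| / (|x-y| |y-z|),
    and the inequality between arithmetic and geometric means splits the integrand
    into terms in which only |phi|^2, the weight w^2 and the locally integrable power
    |.|^(-4/3) occur ([double_kernel_le]); so I[F] is bounded by Tonelli's theorem alone
    ([riesz_bounded]).  Then F <= C <y>^(-beta), and as beta > 2 the potential of
    such a weight is at most C / <x> ([riesz_decay]).  This gives |psi| <= C / <x>
    ([riesz_bootstrap], [l1norm_solution_decay]), a bounded function whose
    p-th power is integrable for every p > 2.

    Weak equation.  In real components D_0 G = 1 amounts to two identities for
    e_k(x) = (x-y)_k / |x-y|^2 and every test function chi: the integral of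
    e_1 d_1 chi + e_2 d_2 chi is - 2 pi chi(y), and that of e_2 d_1 chi - e_1 d_2 chi
    is 0.  They follow by integration by parts after replacing |x-y|^2 by
    |x-y|^2 + e, for which e_k is the gradient of (1/2) log (|x-y|^2 + e), whose
    Laplacian is an approximate identity of mass 2 pi ([integral_log_laplacian],
    [green_divergence_limit], [green_curl_limit]).  Integrating against the density
    V psi, which is bounded and integrable, and exchanging the integrals gives
    D_0 psi = - V psi in the sense of distributions ([D0_dist_G00]). *)

(** * Measurability and Tonelli's theorem on the plane *)

Section PlaneMeasurability.
Context {R : realType}.

(** An open set is the union of the countably many rational rectangles that it
    contains.  This is the link between the topology of R x R, in which continuity is
    stated, and the product of the two Borel sigma-algebras. *)
Lemma open_measurable_plane (A : set (R * R)) :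
  open A -> measurable (A : set (plane R)).
Proof.
move=> oA.
pose box (q : (rat * rat) * (rat * rat)) : set (plane R) :=
  `]ratr q.1.1, ratr q.1.2[ `*` `]ratr q.2.1, ratr q.2.2[.
have -> : A = \bigcup_(q in [set q | box q `<=` A]) box q.
  rewrite eqEsubset; split=> [[x1 x2] Ax|x [q Aq]]; last exact: Aq.
  have /nbhs_ballP[e /= e0 eA] : nbhs (x1, x2) A by exact: open_nbhs_nbhs.
  have H (x : R) : exists q : rat * rat, ratr q.1 < x < ratr q.2 /\
      forall y : R, ratr q.1 < y < ratr q.2 -> ball x e y.
    have [|p] := @rat_in_itvoo R (x - e) x; first by lra.
    have [|q] := @rat_in_itvoo R x (x + e); first by lra.
    rewrite !in_itv/= => /andP[q1 q2] /andP[p1 p2].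
    exists (p, q); split=> [|y /= /andP[y1 y2]]; first by rewrite p2 q1.
    by rewrite /ball/= ltr_norml; lra.
  have [p [px pB]] := H x1; have [q [qx qB]] := H x2.
  exists (p, q); last by split; rewrite /= in_itv.
  move=> [y1 y2] [/=]; rewrite !in_itv /= => y1p y2q.
  by apply: eA; split; [exact: pB|exact: qB].
rewrite bigcup_mkcond; apply: countable_bigcupT_measurable => [|q].
  by exact: countableP.
case: ifPn => // _.
by apply: measurableX; exact: measurable_itv.
Qed.

Lemma continuous_measurable_plane (f : R * R -> R) :
  continuous f -> measurable_fun (setT : set (plane R)) f.
Proof.
move=> cf; apply: (measurability _ (RGenOInfty.measurableE R)).
move=> /= _ [_ [a ->]] <-; rewrite setTI.
apply: (@open_measurable_plane).
by apply: open_comp => // x _; exact: cf.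
Qed.

End PlaneMeasurability.

Section Reflection.
Context {R : realType}.
Local Notation leb := (@lebesgue_measure R).

Lemma measurable_reflection (a : R) :
  measurable_fun (setT : set (measurableTypeR R))
    (fun t => a - t : measurableTypeR R).
Proof. by apply: measurable_funB => //; exact: measurable_cst. Qed.

(** The push-forward of Lebesgue measure under t |-> a - t gives every interval its
    length, so it is Lebesgue measure.  Reflections are used rather than translations
    because y enters the kernels below through x - y. *)
Lemma integral_reflection (a : R) (f : R -> \bar R) :
  measurable_fun (setT : set (measurableTypeR R)) f -> (forall t, 0 <= f t)%E ->
  (\int[leb]_t f (a - t)%R = \int[leb]_t f t)%E.
Proof.
move=> mf f0.
pose phi : measurableTypeR R -> measurableTypeR R := fun t => a - t.
have mphi : measurable_fun setT phi by exact: measurable_reflection.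
pose m : {measure set (measurableTypeR R) -> \bar R} := measure_function_pushforward__canonical__measure_function_Measure leb mphi.
have mE A : measurable A -> leb A = m A.
  apply: lebesgue_measure_unique => _ [[u w]] _ <-.
  have -> : m `]u, w]%classic = leb `[a - w, a - u[%classic.
    congr (leb _); apply/seteqP; split=> t /=; rewrite /phi !in_itv/=; lra.
  rewrite !lebesgue_measure_itv /= !lte_fin.
  have -> : (a - w < a - u) = (u < w) by apply/idP/idP; lra.
  by case: ifP => // _; rewrite -!EFinB; congr EFin; ring.
rewrite [RHS](eq_measure_integral m); last by move=> A mA _; exact: mE.
rewrite ge0_integral_pushforward//.
Qed.

End Reflection.

Section PlaneTonelli.
Context {R : realType}.
Local Notation leb := (@lebesgue_measure R).

Lemma tonelli_plane (f : plane R -> \bar R) :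
  measurable_fun setT f -> (forall x, 0 <= f x)%E ->
  (\int[mu2 R]_x f x = \int[leb]_s \int[leb]_t f (s, t))%E.
Proof. by move=> mf f0; rewrite /mu2 fubini_tonelli1. Qed.

Lemma mu2_sigma_finite : sigma_finite (setT : set (plane R)) (mu2 R).
Proof.
have /sigma_finiteP[F [TF ndF Foo]] := sigma_finiteT leb.
exists (fun n => F n `*` F n).
  rewrite -setXTT TF predeqE => -[x y]; split.
    move=> [/= [n _ Fnx] [k _ Fky]]; exists (maxn n k) => //; split.
    - by move: x Fnx; exact/subsetPset/ndF/leq_maxl.
    - by move: y Fky; exact/subsetPset/ndF/leq_maxr.
  by move=> [n _ []/= ? ?]; split; exists n.
move=> k; have [? ?] := Foo k.
split; first exact: measurableX.
by rewrite [X in (X < _)%E](product_measure1E leb leb)// lte_mul_pinfty// ge0_fin_numE.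
Qed.

(** The measure [mu2] under a name that can carry the sigma-finiteness instance
    required by Fubini's theorem on the product of two planes. *)
Definition area : set (plane R) -> \bar R := mu2 R.
HB.instance Definition _ := Measure.copy area (mu2 R).
HB.instance Definition _ := Measure_isSigmaFinite.Build _ _ _ area mu2_sigma_finite.

Lemma measurable_reflection_plane (x : R * R) :
  measurable_fun (setT : set (plane R)) (fun y : plane R => x - y : plane R).
Proof.
apply: measurable_fun_pair.
  by apply: (measurableT_comp (measurable_reflection x.1)).
by apply: (measurableT_comp (measurable_reflection x.2)).
Qed.

Lemma integral_reflection_plane (x : R * R) (f : plane R -> \bar R) :
  measurable_fun setT f -> (forall z, 0 <= f z)%E ->
  (\int[mu2 R]_y f (x - y)%R = \int[mu2 R]_y f y)%E.
Proof.
move=> mf f0.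
have mxf : measurable_fun setT (fun y : plane R => f (x - y)).
  exact: (measurableT_comp mf (measurable_reflection_plane x)).
rewrite (tonelli_plane mf f0).
have -> := tonelli_plane mxf (fun y => f0 (x - y)).
rewrite -[RHS](@integral_reflection _ x.1 (fun s => \int[leb]_t f (s, t))%E).
- apply: eq_integral => s _ /=.
  rewrite -(@integral_reflection _ x.2 (fun t => f (x.1 - s, t))) //.
  by apply: measurableT_comp => //; exact: measurable_pair1.
- exact: (measurable_fun_fubini_tonelli_F (m2 := leb) f).
- by move=> t; apply: integral_ge0.
Qed.

End PlaneTonelli.

(** * One-dimensional integrals *)

Section OneDimIntegrals.
Context {R : realType}.
Local Notation leb := (@lebesgue_measure R).

(** The improper fundamental theorem of calculus for an integrand that is continuous
    on the whole line, which spares one-sided continuity conditions at 0. *)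
Lemma integral_half_line (f F : R -> R) (l : R) :
  (forall t, 0 <= f t) -> continuous f ->
  (forall t : R, 0 <= t -> is_derive t 1 F (f t)) ->
  F t @[t --> +oo] --> l ->
  (\int[leb]_(t in `[0%R, +oo[) (f t)%:E = (l - F 0)%R%:E)%E.
Proof.
move=> f0 cf dF Fl; rewrite EFinB.
have derF t : 0 <= t -> derivable F t 1 by move=> /dF[].
apply: ge0_continuous_FTC2y => //.
- exact: continuous_subspaceT.
- by move=> t /ltW; exact: derF.
- apply: cvg_at_right_filter.
  by apply: differentiable_continuous; apply/derivable1_diffP; exact: derF.
- by move=> t; rewrite in_itv/= andbT => /ltW /dF dft; rewrite derive1E derive_val.
Qed.

Lemma integral_even (f F : R -> R) (l : R) :
  (forall t, 0 <= f t) -> continuous f -> (forall t, f (- t) = f t) ->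
  (forall t : R, 0 <= t -> is_derive t 1 F (f t)) ->
  F t @[t --> +oo] --> l ->
  (\int[leb]_t (f t)%:E = (2 * (l - F 0))%R%:E)%E.
Proof.
move=> f0 cf ef dF Fl; rewrite ge0_symfun_integralT //.
  by rewrite -set_itvcy (integral_half_line f0 cf dF Fl) EFinM.
by move=> t /=; rewrite ef.
Qed.

Lemma integral_one_plus_abs_powR (a : R) : 1 < a ->
  (\int[leb]_t ((1 + `|t|) `^ (- a))%R%:E = (2 / (a - 1))%R%:E)%E.
Proof.
move=> a1.
pose F t : R := - (a - 1)^-1 * (1 + t) `^ (1 - a).
have pos (t : R) : 0 < 1 + `|t| by rewrite ltr_wpDr.
transitivity (2 * (0 - F 0))%:E; last first.
  by rewrite /F addr0 powR1; congr EFin; field; lra.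
apply: integral_even.
- by move=> t; exact: powR_ge0.
- move=> t.
  apply: (@continuous_comp _ _ _ (fun t : R => 1 + `|t|) (fun u => u `^ (- a))).
    by apply: cvgD; [exact: cvg_cst|exact: norm_continuous].
  apply: differentiable_continuous; apply/derivable1_diffP.
  by apply: derivable_powR; rewrite in_itv /= andbT.
- by move=> t; rewrite normrN.
- move=> t t0.
  have t1 : 0 < 1 + t by rewrite ltr_wpDr.
  have d1 : is_derive (1 + t) 1 (fun u : R => u `^ (1 - a)) ((1 - a) * (1 + t) `^ (- a)).
    have dp : derivable (fun u : R => u `^ (1 - a)) (1 + t) 1.
      by apply: derivable_powR; rewrite in_itv /= andbT.
    apply: DeriveDef => //; rewrite -derive1E powR_derive1 ?in_itv/= ?andbT//.
    by congr (_ * _ `^ _); ring.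
  have d2 : is_derive t 1 (fun u : R => 1 + u) 1.
    by have := is_deriveD (is_derive_cst (1 : R) t 1) (is_derive_id t 1); rewrite add0r.
  have d3 := @is_derive1_comp _ (fun u : R => u `^ (1 - a)) (fun u : R => 1 + u) t _ _ d1 d2.
  have d4 := is_deriveZ (- (a - 1)^-1) d3.
  rewrite ger0_norm //.
  by apply: is_derive_eq d4 _; rewrite /GRing.scale /=; field; lra.
- rewrite [X in _ --> X](_ : 0 = - (a - 1)^-1 * 0); last by rewrite mulr0.
  apply: cvgM; first exact: cvg_cst.
  apply/cvgrPdist_le => e e0; near=> t.
  have t0 : 0 <= t by near: t; exact: nbhs_pinfty_ge.
  rewrite sub0r normrN ger0_norm ?powR_ge0//.
  rewrite -(opprB a 1) powRN -[leRHS]invrK lef_pV2 ?posrE ?invr_gt0 ?powR_gt0 //; last first.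
    by rewrite ltr_wpDr.
  (* The value (1/e)^(1/(a-1)) is the threshold for t in the limit at infinity. *)
  have -> : e^-1 = (e^-1 `^ (a - 1)^-1) `^ (a - 1).
    by rewrite -powRrM mulVf ?powRr1 ?invr_ge0 ?ltW //; lra.
  apply: ge0_ler_powR; rewrite ?nnegrE ?powR_ge0 //; [lra|lra|].
  apply: (@le_trans _ _ t); last by rewrite lerDr.
  by near: t; exact: nbhs_pinfty_ge.
Unshelve. all: by end_near.
Qed.

(** The part of t^(-2/3) near 0; a product of two such functions dominates the
    planar singularity |z|^(-4/3). *)
Definition root_bump (t : R) : R := if 0 < t <= 1 then t `^ (- (2 / 3)) else 0.

Lemma root_bump_ge0 t : 0 <= root_bump t.
Proof. by rewrite /root_bump; case: ifP => // _; exact: powR_ge0. Qed.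

Lemma measurable_root_bump : measurable_fun (setT : set (measurableTypeR R)) root_bump.
Proof.
apply: measurable_fun_if => //.
- by apply: measurable_and; [exact: measurable_fun_ltr|exact: measurable_fun_ler].
- by apply: measurable_funTS; exact: measurable_powR.
Qed.

(** The primitive 3 t^(1/3) is differentiable only away from 0, so the integral over
    ]0, 1] is taken as the limit of those over [1/(n+1), 1]. *)
Lemma integral_root_bump_le : (\int[leb]_t (root_bump t)%:E <= 3%:E)%E.
Proof.
have -> : (\int[leb]_t (root_bump t)%:E =
    \int[leb]_(t in `]0%R, 1%R]) (t `^ (- (2 / 3)))%R%:E)%E.
  rewrite [RHS]integral_mkcond; apply: eq_integral => t _.
  rewrite /patch /root_bump; case: ifPn => [t01|t01].
    by rewrite ifT // inE /= in_itv.
  by rewrite ifF //; apply/negP; rewrite inE /= in_itv /= (negbTE t01).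
have -> : `]0%R, 1%R]%classic = \bigcup_n (`[(n.+1%:R : R)^-1, 1%R]%classic).
  apply/seteqP; split=> [t /=|t [n _] /=]; rewrite !in_itv /=.
    move=> /andP[t0 t1].
    have [n nt] : exists n : nat, t^-1 < n.+1%:R.
      by exists (Num.truncn t^-1); exact: truncnS_gt.
    exists n => //=; rewrite in_itv /= t1 andbT.
    by rewrite -[leRHS]invrK lef_pV2 ?posrE ?invr_gt0 ?ltr0n // ltW.
  by move=> /andP[nt ->]; rewrite andbT (lt_le_trans _ nt) ?invr_gt0 ?ltr0n.
have mf : measurable_fun (setT : set (measurableTypeR R)) (fun t : R => (t `^ (- (2 / 3)))%:E).
  apply/measurable_EFinP; exact: measurable_powR.
pose I n : set (measurableTypeR R) := `[(n.+1%:R : R)^-1, 1%R]%classic.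
pose g (t : measurableTypeR R) := (t `^ (- (2 / 3)))%:E : \bar R.
have cv : (\int[leb]_(t in I n) g t @[n --> \oo] --> \int[leb]_(t in \bigcup_n I n) g t)%E.
  apply: ge0_nondecreasing_set_cvg_integral.
  - move=> n m nm; rewrite subsetEset => t; rewrite /I /= !in_itv /= => /andP[nt ->].
    by rewrite andbT (le_trans _ nt) // lef_pV2 ?posrE ?ltr0n // ler_nat.
  - by move=> n; exact: measurable_itv.
  - by move=> n; apply: measurable_funTS.
  - by move=> n t _; rewrite lee_fin powR_ge0.
rewrite -(cvg_lim _ cv) //; apply: lime_le; first by apply/cvg_ex; eexists; exact: cv.
near=> n.
have n0 : (0 < n)%N by near: n; exact: nbhs_infty_gt.
have c0 : 0 < (n.+1%:R : R)^-1 by rewrite invr_gt0 ltr0n.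
have c1 : (n.+1%:R : R)^-1 < 1 by rewrite invf_lt1 ?ltr0n // ltr1n.
have d1 (t : R) : 0 < t -> is_derive t 1 (fun u : R => 3 * u `^ (3^-1)) (t `^ (- (2 / 3))).
  move=> t0; have tp : t \in `]0, +oo[ by rewrite in_itv /= t0.
  have dp : is_derive t 1 (fun u : R => u `^ (3^-1)) (3^-1 * t `^ (3^-1 - 1)).
    apply: DeriveDef; first exact: derivable_powR.
    by rewrite -derive1E powR_derive1.
  have dq := is_deriveZ 3 dp.
  apply: is_derive_eq dq _; rewrite /GRing.scale /= mulrA divff ?mul1r //.
  by congr (_ `^ _); lra.
have cF (t : R) : 0 < t -> {for t, continuous (fun u : R => 3 * u `^ (3^-1))}.
  by move=> /d1[dt _]; apply: differentiable_continuous; apply/derivable1_diffP.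
rewrite /g (@continuous_FTC2 _ _ (fun u : R => 3 * u `^ (3^-1))) //.
- by rewrite powR1 mulr1 lee_fin lerBlDr lerDl mulr_ge0 ?powR_ge0.
- apply: derivable_within_continuous => t; rewrite in_itv /= => /andP[ct _].
  by apply: derivable_powR; rewrite in_itv /= andbT (lt_le_trans c0 ct).
- split.
  + by move=> t; rewrite in_itv /= => /andP[ct _]; case: (d1 t (lt_trans c0 ct)).
  + by apply: cvg_at_right_filter; exact: cF.
  + by apply: cvg_at_left_filter; exact: cF.
- move=> t; rewrite in_itv /= => /andP[ct _].
  by have dt := d1 t (lt_trans c0 ct); rewrite derive1E derive_val.
Unshelve. all: by end_near.
Qed.

End OneDimIntegrals.

(** * Integrable weights on the plane *)

Section PlaneIntegrals.
Context {R : realType}.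
Local Notation leb := (@lebesgue_measure R).
Implicit Types z x y : R * R.

Lemma sqnorm_ge0 z : 0 <= sqnorm z.
Proof. by rewrite addr_ge0 ?sqr_ge0. Qed.

Lemma measurable_sqnorm : measurable_fun (setT : set (plane R)) (@sqnorm R).
Proof. by apply: measurable_funD; apply: measurable_funX. Qed.

(** This is |z|^(-1/3).  The Dirac kernel has size rho^3 = 1/|z|, and products of two
    kernels are traded for rho^4 = |z|^(-4/3), still locally integrable in the plane;
    with the cube root as the basic object all these powers are integral.  At z = 0 the
    value is 0, in accordance with the convention for division by zero in the kernel. *)
Definition rho z : R := sqnorm z `^ (- 6^-1).

Lemma rho_ge0 z : 0 <= rho z.
Proof. exact: powR_ge0. Qed.

Lemma measurable_rho : measurable_fun (setT : set (plane R)) rho.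
Proof. exact: (measurableT_comp (measurable_powR _) measurable_sqnorm). Qed.

Lemma rho_eq0 z : sqnorm z = 0 -> rho z = 0.
Proof. by rewrite /rho => ->; rewrite powR0 // oppr_eq0 invr_eq0 pnatr_eq0. Qed.

Lemma rho_exp6 z : rho z ^+ 6 = (sqnorm z)^-1.
Proof.
rewrite /rho -powR_mulrn ?powR_ge0// -powRrM mulNr mulVf ?pnatr_eq0//.
by rewrite powR_inv1 // sqnorm_ge0.
Qed.

Lemma rho_exp3 z : rho z ^+ 3 = (Num.sqrt (sqnorm z))^-1.
Proof.
rewrite -sqrtrV ?sqnorm_ge0 // -rho_exp6 (exprM _ 3 2) sqrtr_sqr.
by rewrite ger0_norm // exprn_ge0 // rho_ge0.
Qed.

Lemma rho_exp4 z : rho z ^+ 4 = sqnorm z `^ (- (2 / 3)).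
Proof. by rewrite /rho -powR_mulrn ?powR_ge0// -powRrM; congr (_ `^ _); lra. Qed.

Lemma japanese_ge1 z : 1 <= japanese z.
Proof. by rewrite -[leLHS]sqrtr1 ler_sqrt ?lerDl ?sqnorm_ge0 // addr_ge0 // sqnorm_ge0. Qed.

Lemma japanese_powR z (a : R) : japanese z `^ a = (1 + sqnorm z) `^ (a / 2).
Proof.
have z0 : 0 <= 1 + sqnorm z by rewrite addr_ge0 // sqnorm_ge0.
by rewrite /japanese -(powR12_sqrt z0) -powRrM mulrC.
Qed.

Lemma measurable_japanese_powR (a : R) :
  measurable_fun (setT : set (plane R)) (fun z => japanese z `^ a).
Proof.
under eq_fun do rewrite japanese_powR.
apply: (measurableT_comp (measurable_powR _)).
by apply: measurable_funD => //; exact: measurable_sqnorm.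
Qed.

Lemma integral_tensor (f g : R -> R) (a b : R) :
  measurable_fun (setT : set (measurableTypeR R)) f ->
  measurable_fun (setT : set (measurableTypeR R)) g ->
  (forall t, 0 <= f t) -> (forall t, 0 <= g t) ->
  (\int[leb]_t (f t)%:E <= a%:E)%E -> (\int[leb]_t (g t)%:E <= b%:E)%E ->
  (\int[mu2 R]_z (f z.1 * g z.2)%:E <= (a * b)%:E)%E.
Proof.
move=> mf mg f0 g0 fa gb.
rewrite tonelli_plane; last 2 first.
- apply/measurable_EFinP; apply: measurable_funM.
    exact: (measurableT_comp mf).
  exact: (measurableT_comp mg).
- by move=> z; rewrite lee_fin mulr_ge0.
have -> : (\int[leb]_s \int[leb]_t (f s * g t)%:E =
           \int[leb]_s ((f s)%:E * \int[leb]_t (g t)%:E))%E.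
  apply: eq_integral => s _; rewrite -ge0_integralZl //.
  - exact/measurable_EFinP.
  - by move=> t _; rewrite lee_fin.
  - by rewrite lee_fin.
have ig : (0 <= \int[leb]_t (g t)%:E)%E by apply: integral_ge0 => t _; rewrite lee_fin.
rewrite ge0_integralZr //; last 2 first.
- exact/measurable_EFinP.
- by move=> s _; rewrite lee_fin.
rewrite EFinM; apply: lee_pmul => //.
by apply: integral_ge0 => t _; rewrite lee_fin.
Qed.

(** (1 + |z_1|)(1 + |z_2|) <= 2 <z>^2, so the weight is dominated by a product of two
    functions of one variable decaying like |t|^(-g/2) with g/2 > 1. *)
Lemma integral_japanese_lty (g : R) : 2 < g ->
  (\int[mu2 R]_z (japanese z `^ (- g))%:E < +oo)%E.
Proof.
move=> g2.
pose f (t : R) := (1 + `|t|) `^ (- (g / 2)).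
have mf : measurable_fun (setT : set (measurableTypeR R)) f.
  apply: (measurableT_comp (measurable_powR _)).
  by apply: measurable_funD => //; exact: measurableT_comp.
have f0 t : 0 <= f t by exact: powR_ge0.
have fE : (\int[leb]_t (f t)%:E <= (2 / (g / 2 - 1))%:E)%E.
  by rewrite integral_one_plus_abs_powR //; lra.
have mff : measurable_fun (setT : set (plane R)) (fun z => f z.1 * f z.2).
  apply: measurable_funM; exact: (measurableT_comp mf).
have le z : japanese z `^ (- g) <= 2 `^ (g / 2) * (f z.1 * f z.2).
  have p1 (t : R) : 0 < 1 + `|t| by rewrite ltr_wpDr.
  rewrite japanese_powR /f -(powRM _ (ltW (p1 _)) (ltW (p1 _))) mulNr powRN.
  set u := (1 + `|z.1|) * (1 + `|z.2|).
  have u0 : 0 < u by rewrite mulr_gt0.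
  rewrite powRN ler_pdivlMr ?powR_gt0 // mulrC ler_pdivrMr ?powR_gt0 //; last first.
    by rewrite ltr_pwDl // sqnorm_ge0.
  have s0 := sqnorm_ge0 z; have s1 : 0 <= 1 + sqnorm z by rewrite addr_ge0.
  rewrite -powRM //; apply: ge0_ler_powR; [lra|by rewrite nnegrE ltW|by rewrite nnegrE mulr_ge0|].
  rewrite /u /sqnorm -(real_normK (num_real z.1)) -(real_normK (num_real z.2)).
  (* Twice the difference is (a-1)^2 + (b-1)^2 + (a-b)^2 + 2 (a^2 + b^2). *)
  have H (a b : R) : (1 + a) * (1 + b) <= 2 * (1 + (a ^+ 2 + b ^+ 2)).
    have := sqr_ge0 (a - 1); have := sqr_ge0 (b - 1); have := sqr_ge0 (a - b); nra.
  exact: H.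
apply: (@le_lt_trans _ _ (\int[mu2 R]_z ((2 `^ (g / 2))%:E * (f z.1 * f z.2)%:E)))%E.
  apply: ge0_le_integral => //.
  - by move=> z _; rewrite lee_fin powR_ge0.
  - by apply/measurable_EFinP; exact: measurable_japanese_powR.
  - by apply/measurable_EFinP; apply: measurable_funM.
  - by move=> z _; rewrite -EFinM lee_fin.
rewrite ge0_integralZl //; last 2 first.
- exact/measurable_EFinP.
- by move=> z _; rewrite lee_fin mulr_ge0.
apply: lte_mul_pinfty => //.
by apply: (le_lt_trans (integral_tensor mf mf f0 f0 fE fE)); rewrite ltry.
Qed.

(** The singularity of |z|^(-4/3), which dominates that of every power used below. *)
Definition near_kernel z : R := if sqnorm z <= 1 then rho z ^+ 4 else 0.

Lemma near_kernel_ge0 z : 0 <= near_kernel z.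
Proof. by rewrite /near_kernel; case: ifP => // _; rewrite exprn_ge0 ?rho_ge0. Qed.

Lemma measurable_near_kernel : measurable_fun (setT : set (plane R)) near_kernel.
Proof.
apply: measurable_fun_if => //.
- by apply: measurable_fun_ler => //; exact: measurable_sqnorm.
- by apply: measurable_funTS; apply: measurable_funX; exact: measurable_rho.
Qed.

Lemma ae_coordinates_neq0 : {ae mu2 R, forall z : plane R, z.1 != 0 /\ z.2 != 0}.
Proof.
pose Z : set (measurableTypeR R) := [set (0 : R)].
have m0 : measurable Z by exact: measurable_set1.
exists ((Z `*` setT) `|` (setT `*` Z) : set (plane R)); split.
- by apply: measurableU; exact: measurableX.
- apply/eqP; rewrite -measure_le0.
  rewrite (@le_trans _ _ (mu2 R (Z `*` setT) + mu2 R (setT `*` Z))%E) //.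
    by apply: measureU2; exact: measurableX.
  have E1 : mu2 R (Z `*` setT) = (leb Z * leb setT)%E.
    exact: product_measure1E.
  have E2 : mu2 R (setT `*` Z) = (leb setT * leb Z)%E.
    exact: product_measure1E.
  by rewrite E1 E2 /Z lebesgue_measure_set1 mul0e mule0 adde0.
- move=> [s t] /= st; apply: contrapT => H; apply: st.
  split; apply/eqP => /= E; apply: H; [left|right]; by rewrite /= E.
Qed.

(** Off the coordinate axes |z_1| |z_2| <= |z|^2 gives
    |z|^(-4/3) <= |z_1|^(-2/3) |z_2|^(-2/3), a product of two integrable functions; the
    axes form a null set. *)
Lemma integral_near_kernel_lty : (\int[mu2 R]_z (near_kernel z)%:E < +oo)%E.
Proof.
(* The even extension of root_bump, equal to |t|^(-2/3) for 0 < |t| <= 1. *)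
pose f (t : R) := root_bump t + root_bump (0 - t).
have mr : measurable_fun (setT : set (measurableTypeR R)) (fun t : R => root_bump (0 - t)).
  exact: (measurableT_comp measurable_root_bump (measurable_reflection 0)).
have mf : measurable_fun (setT : set (measurableTypeR R)) f.
  by apply: measurable_funD => //; exact: measurable_root_bump.
have f0 t : 0 <= f t by rewrite addr_ge0 ?root_bump_ge0.
have fE : (\int[leb]_t (f t)%:E <= 6%:E)%E.
  rewrite /f; under eq_integral do rewrite EFinD.
  rewrite ge0_integralD //; last 4 first.
  - by move=> t _; rewrite lee_fin root_bump_ge0.
  - by apply/measurable_EFinP; exact: measurable_root_bump.
  - by move=> t _; rewrite lee_fin root_bump_ge0.
  - exact/measurable_EFinP.
  have := @integral_reflection _ 0 (fun t : R => (root_bump t)%:E).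
  move=> ->; last 2 first.
  - by apply/measurable_EFinP; exact: measurable_root_bump.
  - by move=> t; rewrite lee_fin root_bump_ge0.
  have -> : 6%:E = (3%:E + 3%:E)%E :> \bar R by rewrite -EFinD; congr EFin; ring.
  by apply: leeD; exact: integral_root_bump_le.
have fabs (t : R) : t != 0 -> `|t| <= 1 -> f t = `|t| `^ (- (2 / 3)).
  move=> t0; rewrite /f /root_bump; case: (ltrgt0P t) t0 => // t0 _ t1.
    by rewrite t1 /= sub0r oppr_gt0 ltNge (ltW t0) /= addr0.
  by rewrite sub0r oppr_gt0 t0 t1 /= add0r.
apply: (@le_lt_trans _ _ (\int[mu2 R]_z (f z.1 * f z.2)%:E)%E); last first.
  by apply: (le_lt_trans (integral_tensor mf mf f0 f0 fE fE)); rewrite ltry.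
apply: ae_ge0_le_integral => //.
- by move=> z _; rewrite lee_fin near_kernel_ge0.
- by apply/measurable_EFinP; exact: measurable_near_kernel.
- by move=> z _; rewrite lee_fin mulr_ge0.
- by apply/measurable_EFinP; apply: measurable_funM; exact: (measurableT_comp mf).
apply: filterS ae_coordinates_neq0 => -[s t] /= [s0 t0] _.
rewrite lee_fin /near_kernel; case: ifPn => [st1|_]; last by rewrite mulr_ge0.
have sn : 0 < `|s| by rewrite normr_gt0.
have tn : 0 < `|t| by rewrite normr_gt0.
have E : sqnorm (s, t) = `|s| ^+ 2 + `|t| ^+ 2 by rewrite /sqnorm /= !real_normK ?num_real.
rewrite E in st1.
have s1 : `|s| <= 1 by nra.
have t1 : `|t| <= 1 by nra.
rewrite !fabs // rho_exp4 E -powRM // !powRN lef_pV2 ?posrE ?powR_gt0 ?mulr_gt0 //; last first.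
  by rewrite addr_gt0 // exprn_gt0.
apply: ge0_ler_powR; rewrite ?nnegrE ?mulr_ge0 ?addr_ge0 ?sqr_ge0 //; nra.
Qed.

End PlaneIntegrals.

(** * The Riesz potential of order one *)

Section IntegralScaling.
Context d (T : measurableType d) (R : realType) (mu : {measure set T -> \bar R}).

Lemma ge0_integralZl_EFin_mul (c : R) (f : T -> R) :
  0 <= c -> measurable_fun setT f -> (forall y, 0 <= f y) ->
  (\int[mu]_y (c * f y)%:E = c%:E * \int[mu]_y (f y)%:E)%E.
Proof.
move=> c0 mf f0; under eq_integral do rewrite EFinM.
rewrite ge0_integralZl //; first exact/measurable_EFinP.
by move=> y _; rewrite lee_fin.
Qed.

Lemma ge0_integralD_EFin (f g : T -> R) :
  measurable_fun setT f -> measurable_fun setT g ->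
  (forall y, 0 <= f y) -> (forall y, 0 <= g y) ->
  (\int[mu]_y (f y + g y)%:E = \int[mu]_y (f y)%:E + \int[mu]_y (g y)%:E)%E.
Proof.
move=> mf mg f0 g0; under eq_integral do rewrite EFinD.
by rewrite ge0_integralD // => *; rewrite ?lee_fin //; exact/measurable_EFinP.
Qed.

Lemma ge0_le_integral_EFin (f g : T -> R) :
  measurable_fun setT f -> measurable_fun setT g ->
  (forall y, 0 <= f y) -> (forall y, f y <= g y) ->
  (\int[mu]_y (f y)%:E <= \int[mu]_y (g y)%:E)%E.
Proof.
move=> mf mg f0 fg; apply: ge0_le_integral => //.
- by move=> y _; rewrite lee_fin.
- exact/measurable_EFinP.
- exact/measurable_EFinP.
- by move=> y _; rewrite lee_fin.
Qed.

End IntegralScaling.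

Section RieszPotential.
Context {R : realType}.
Local Notation mu := (mu2 R).
Implicit Types x y z : R * R.

Lemma measurable_sub_plane :
  measurable_fun (setT : set (plane R * plane R)) (fun p => p.1 - p.2 : plane R).
Proof.
apply: measurable_fun_pair.
  apply: measurable_funB => /=; first exact: (measurableT_comp measurable_fst).
  exact: (measurableT_comp measurable_fst).
apply: measurable_funB => /=; first exact: (measurableT_comp measurable_snd).
exact: (measurableT_comp measurable_snd).
Qed.

Lemma measurable_rho_sub (n : nat) :
  measurable_fun (setT : set (plane R * plane R)) (fun p => rho (p.1 - p.2) ^+ n).
Proof.
by apply: measurable_funX; exact: (measurableT_comp measurable_rho measurable_sub_plane).
Qed.

Lemma measurable_rho_subr (n : nat) x :
  measurable_fun (setT : set (plane R)) (fun y => rho (x - y) ^+ n).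
Proof.
by apply: measurable_funX; exact: (measurableT_comp measurable_rho (measurable_reflection_plane x)).
Qed.

Lemma rhoC x y : rho (x - y) = rho (y - x).
Proof. by rewrite /rho /sqnorm /= -(opprB x.1 y.1) -(opprB x.2 y.2) !sqrrN. Qed.

Lemma rho_le1 z : 1 <= sqnorm z -> rho z <= 1.
Proof.
move=> z1; rewrite /rho powRN invf_le1 ?powR_gt0 ?(lt_le_trans ltr01) //.
by rewrite -[leLHS](powRr0 (sqnorm z)); apply: ler_powR => //; rewrite invr_ge0.
Qed.

Lemma rho_ge1 z : 0 < sqnorm z <= 1 -> 1 <= rho z.
Proof.
by move=> z1; rewrite -[leLHS](powRr0 (sqnorm z)) /rho; apply: ger_powR.
Qed.

Lemma japanese_powR_le1 y (a : R) : a <= 0 -> japanese y `^ a <= 1.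
Proof.
by move=> a0; rewrite -[leRHS](powRr0 (japanese y)); apply: ler_powR => //; exact: japanese_ge1.
Qed.

Lemma integral_near_kernel_sub x :
  (\int[mu]_y (near_kernel (x - y))%:E = \int[mu]_y (near_kernel y)%:E)%E.
Proof.
apply: (integral_reflection_plane x (f := fun y => (near_kernel y)%:E)).
  by apply/measurable_EFinP; exact: measurable_near_kernel.
by move=> z; rewrite lee_fin near_kernel_ge0.
Qed.

Lemma integral_japanese_sub x (a : R) :
  (\int[mu]_y (japanese (x - y) `^ a)%:E = \int[mu]_y (japanese y `^ a)%:E)%E.
Proof.
apply: (integral_reflection_plane x (f := fun y => (japanese y `^ a)%:E)).
  by apply/measurable_EFinP; exact: measurable_japanese_powR.
by move=> z; rewrite lee_fin powR_ge0.
Qed.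

Lemma measurable_near_kernel_sub x :
  measurable_fun (setT : set (plane R)) (fun y => near_kernel (x - y)).
Proof. exact: (measurableT_comp measurable_near_kernel (measurable_reflection_plane x)). Qed.

Lemma measurable_japanese_sub x (a : R) :
  measurable_fun (setT : set (plane R)) (fun y => japanese (x - y) `^ a).
Proof. exact: (measurableT_comp (measurable_japanese_powR a) (measurable_reflection_plane x)). Qed.

(** For |x - y| <= 1 the weight is dropped, for |x - y| >= 1 the kernel is; both
    remaining integrals are independent of x by reflection. *)
Lemma integral_rho4_japanese (b : R) : 2 < b ->
  exists2 M : R, 0 <= M & forall x,
    (\int[mu]_y (rho (x - y) ^+ 4 * japanese y `^ (- b))%:E <= M%:E)%E.
Proof.
move=> b2.
set I := (\int[mu]_y (near_kernel y)%:E + \int[mu]_y (japanese y `^ (- b))%:E)%E.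
have I0 : (0 <= I)%E.
  by apply: adde_ge0; apply: integral_ge0 => y _; rewrite lee_fin ?near_kernel_ge0 ?powR_ge0.
have Ioo : I \is a fin_num.
  by rewrite ge0_fin_numE // lte_add_pinfty ?integral_near_kernel_lty ?integral_japanese_lty.
exists (fine I) => [|x]; first exact: fine_ge0.
rewrite fineK // /I -(integral_near_kernel_sub x) -ge0_integralD_EFin; last 4 first.
- exact: measurable_near_kernel_sub.
- exact: measurable_japanese_powR.
- by move=> y; exact: near_kernel_ge0.
- by move=> y; exact: powR_ge0.
apply: ge0_le_integral_EFin => [||y|y].
- by apply: measurable_funM; [exact: measurable_rho_subr|exact: measurable_japanese_powR].
- by apply: measurable_funD; [exact: measurable_near_kernel_sub|exact: measurable_japanese_powR].
- by rewrite mulr_ge0 ?exprn_ge0 ?rho_ge0 ?powR_ge0.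
have J0 : 0 <= japanese y `^ (- b) by exact: powR_ge0.
rewrite /near_kernel; case: ifPn => [_|].
  rewrite -[leLHS]addr0 lerD // ler_piMr ?exprn_ge0 ?rho_ge0 //.
  by apply: japanese_powR_le1; lra.
rewrite -ltNge add0r => /ltW /rho_le1 r1.
by rewrite ler_piMl // exprn_ile1 // rho_ge0.
Qed.

Lemma invr_mul_powR (b r : R) : 0 < r -> r^-1 * r `^ (1 - b) = r `^ (- b).
Proof.
move=> r0; rewrite -(powR_inv1 (ltW r0)) -powRD ?(gt_eqF r0) ?implybT //.
by congr (_ `^ _); ring.
Qed.

Lemma powR_anti (b r K : R) : 1 <= b -> 0 < r -> r <= K -> K `^ (1 - b) <= r `^ (1 - b).
Proof.
move=> b1 r0 rK; have K0 : 0 < K by exact: lt_le_trans rK.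
rewrite -(opprB b 1) !powRN lef_pV2 ?posrE ?powR_gt0 //.
by apply: ge0_ler_powR; rewrite ?nnegrE ?subr_ge0 // ltW.
Qed.

Lemma sqrt_powR_le_japanese (b : R) z : 0 <= b -> 1 <= sqnorm z ->
  Num.sqrt (sqnorm z) `^ (- b) <= 2 `^ (b / 2) * japanese z `^ (- b).
Proof.
move=> b0 z1; have z0 : 0 < sqnorm z by lra.
have -> : Num.sqrt (sqnorm z) `^ (- b) = (sqnorm z `^ (b / 2))^-1.
  by rewrite -(powR12_sqrt (ltW z0)) -powRrM -powRN; congr (_ `^ _); lra.
have -> : japanese z `^ (- b) = ((1 + sqnorm z) `^ (b / 2))^-1.
  by rewrite japanese_powR -powRN; congr (_ `^ _); lra.
have p0 : 0 < sqnorm z `^ (b / 2) by rewrite powR_gt0.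
have p1 : 0 < (1 + sqnorm z) `^ (b / 2) by rewrite powR_gt0; lra.
rewrite -div1r ler_pdivrMr // mulrAC ler_pdivlMr // mul1r -powRM; [|lra|lra].
by apply: ge0_ler_powR; rewrite ?nnegrE; lra.
Qed.

(** The weight <y>^(1-b) alone need not be integrable.  Where |x - y| >= <y> the kernel
    supplies the missing factor 1/<y>; where 1 <= |x - y| <= <y>, monotonicity turns the
    weight into |x - y|^(1-b) and the product into |x - y|^(-b); where |x - y| <= 1 only
    the singularity matters. *)
Lemma rho3_japanese_le (b : R) x y : 2 < b ->
  rho (x - y) ^+ 3 * japanese y `^ (1 - b) <=
  japanese y `^ (- b) + (near_kernel (x - y) + 2 `^ (b / 2) * japanese (x - y) `^ (- b)).
Proof.
move=> b2; set z := x - y; set K := japanese y.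
have K1 : 1 <= K by exact: japanese_ge1.
have K0 : 0 < K by exact: lt_le_trans K1.
have J0 : 0 <= K `^ (- b) by exact: powR_ge0.
have N0 : 0 <= near_kernel z by exact: near_kernel_ge0.
have J1 : 0 <= 2 `^ (b / 2) * japanese z `^ (- b) by rewrite mulr_ge0 ?powR_ge0.
have P0 : 0 <= K `^ (1 - b) by exact: powR_ge0.
have [z0|z0] := eqVneq (sqnorm z) 0.
  by rewrite (rho_eq0 z0) expr0n /= mul0r !addr_ge0.
have zp : 0 < sqnorm z by rewrite lt_neqAle eq_sym z0 sqnorm_ge0.
have [z1|z1] := leP (sqnorm z) 1.
  rewrite -[leLHS]add0r lerD // -[leLHS]addr0 lerD // /near_kernel z1.
  have r1 : 1 <= rho z by apply: rho_ge1; rewrite zp.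
  apply: (@le_trans _ _ (rho z ^+ 3)).
    rewrite ler_piMr ?exprn_ge0 ?rho_ge0 //; apply: japanese_powR_le1; lra.
  by apply: ler_weXn2l.
set r := Num.sqrt (sqnorm z).
have r0 : 0 < r by rewrite sqrtr_gt0.
rewrite rho_exp3 -/r.
have [Kr|rK] := leP K r.
  rewrite -[leLHS]addr0 lerD ?addr_ge0 //.
  rewrite -(invr_mul_powR b K0).
  by rewrite ler_wpM2r // lef_pV2.
apply: (@le_trans _ _ (2 `^ (b / 2) * japanese z `^ (- b))); last first.
  by rewrite addrA lerDr addr_ge0.
apply: (@le_trans _ _ (r^-1 * r `^ (1 - b))).
  apply: ler_wpM2l; first by rewrite invr_ge0 ltW.
  apply: powR_anti => //; last exact: ltW.
  by clear - b2; lra.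
rewrite (invr_mul_powR b r0).
by apply: sqrt_powR_le_japanese; [clear - b2; lra|exact: ltW].
Qed.

Lemma integral_rho3_japanese (b : R) : 2 < b ->
  exists2 M : R, 0 <= M & forall x,
    (\int[mu]_y (rho (x - y) ^+ 3 * japanese y `^ (1 - b))%:E <= M%:E)%E.
Proof.
move=> b2; pose c : R := 2 `^ (b / 2).
have c0 : 0 <= c by exact: powR_ge0.
set J := (\int[mu]_y (japanese y `^ (- b))%:E)%E.
set N := (\int[mu]_y (near_kernel y)%:E)%E.
have J0 : (0 <= J)%E by apply: integral_ge0 => y _; rewrite lee_fin powR_ge0.
have N0 : (0 <= N)%E by apply: integral_ge0 => y _; rewrite lee_fin near_kernel_ge0.
have Jf : J \is a fin_num by rewrite ge0_fin_numE // integral_japanese_lty.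
have Nf : N \is a fin_num by rewrite ge0_fin_numE // integral_near_kernel_lty.
exists (fine J + (fine N + c * fine J)) => [|x].
  by rewrite addr_ge0 ?addr_ge0 ?mulr_ge0 ?fine_ge0.
rewrite !EFinD EFinM !fineK // {2}/J /N -(integral_japanese_sub x) -(integral_near_kernel_sub x).
have mJ := measurable_japanese_powR (R := R) (- b).
have mJx := measurable_japanese_sub x (- b).
have mN := measurable_near_kernel_sub x.
have mcJ : measurable_fun (setT : set (plane R)) (fun y => c * japanese (x - y) `^ (- b)).
  exact: measurable_funM.
have cJ0 y : 0 <= c * japanese (x - y) `^ (- b) by rewrite mulr_ge0 ?powR_ge0.
rewrite -ge0_integralZl_EFin_mul //; last by move=> y; exact: powR_ge0.
rewrite -ge0_integralD_EFin //; last by move=> y; exact: near_kernel_ge0.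
rewrite /J -ge0_integralD_EFin //; last 3 first.
- by apply: measurable_funD.
- by move=> y; exact: powR_ge0.
- by move=> y; rewrite addr_ge0 ?near_kernel_ge0.
apply: ge0_le_integral_EFin => [||y|y].
- by apply: measurable_funM; [exact: measurable_rho_subr|exact: measurable_japanese_powR].
- by apply: measurable_funD => //; exact: measurable_funD.
- by rewrite mulr_ge0 ?exprn_ge0 ?rho_ge0 ?powR_ge0.
- exact: rho3_japanese_le.
Qed.

Lemma japanese_le_add x y : japanese x <= Num.sqrt (sqnorm (x - y)) + japanese y.
Proof.
set r := Num.sqrt _; have r0 : 0 <= r by exact: sqrtr_ge0.
have K0 : 0 <= japanese y by exact: sqrtr_ge0.
have r2 : r ^+ 2 = sqnorm (x - y) by rewrite sqr_sqrtr // sqnorm_ge0.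
have K2 : japanese y ^+ 2 = 1 + sqnorm y.
  by rewrite sqr_sqrtr // addr_ge0 // sqnorm_ge0.
have x2 : japanese x ^+ 2 = 1 + sqnorm x.
  by rewrite sqr_sqrtr // addr_ge0 // sqnorm_ge0.
rewrite -ler_sqr ?nnegrE ?addr_ge0 ?sqrtr_ge0 // x2 sqrrD r2 K2.
pose p := (x.1 - y.1) * y.1 + (x.2 - y.2) * y.2.
have p_le : p <= r * japanese y.
  apply: (le_trans (ler_norm _)); rewrite -ler_sqr ?nnegrE ?mulr_ge0 //.
  rewrite real_normK ?num_real // exprMn r2 K2 /p /sqnorm /=.
  have H (a b c d : R) : (a * c + b * d) ^+ 2 <= (a ^+ 2 + b ^+ 2) * (1 + (c ^+ 2 + d ^+ 2)).
    have := sqr_ge0 (a * d - b * c); have := sqr_ge0 a; have := sqr_ge0 b; nra.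
  exact: H.
have -> : 1 + sqnorm x = sqnorm (x - y) + p *+ 2 + (1 + sqnorm y).
  by rewrite /p /sqnorm /=; ring.
by rewrite lerD2r lerD2l lerMn2r.
Qed.

(** Multiply by <x> <= |x - y| + <y>: the first summand cancels the kernel, and the
    second one raises the weight to <y>^(1-b), for which a bound uniform in x is known. *)
Lemma riesz_decay (b : R) : 2 < b ->
  exists2 M : R, 0 <= M & forall x,
    (\int[mu]_y (rho (x - y) ^+ 3 * japanese y `^ (- b))%:E <= (M / japanese x)%:E)%E.
Proof.
move=> b2; have [M M0 MP] := integral_rho3_japanese b2.
set J := (\int[mu]_y (japanese y `^ (- b))%:E)%E.
have J0 : (0 <= J)%E by apply: integral_ge0 => y _; rewrite lee_fin powR_ge0.
have Jf : J \is a fin_num by rewrite ge0_fin_numE // integral_japanese_lty.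
exists (fine J + M) => [|x]; first by rewrite addr_ge0 // fine_ge0.
have x1 : 0 < japanese x by exact: (lt_le_trans ltr01 (japanese_ge1 x)).
rewrite EFinM lee_pdivlMr // EFinD fineK // muleC.
apply: (le_trans _ (leeD (lexx J) (MP x))).
have mJ a := measurable_japanese_powR (R := R) a.
have m3 a : measurable_fun (setT : set (plane R)) (fun y => rho (x - y) ^+ 3 * japanese y `^ a).
  by apply: measurable_funM; [exact: measurable_rho_subr|exact: mJ].
have p0 a y : 0 <= rho (x - y) ^+ 3 * japanese y `^ a.
  by rewrite mulr_ge0 ?exprn_ge0 ?rho_ge0 ?powR_ge0.
have j0 a y : 0 <= japanese y `^ a by exact: powR_ge0.
rewrite -ge0_integralZl_EFin_mul //; last exact: ltW.
rewrite /J -ge0_integralD_EFin //.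
apply: ge0_le_integral_EFin => [||y|y].
- exact: measurable_funM.
- exact: measurable_funD.
- by rewrite mulr_ge0 // ltW.
have y1 : 0 < japanese y by exact: (lt_le_trans ltr01 (japanese_ge1 y)).
apply: (le_trans (ler_wpM2r (p0 _ y) (japanese_le_add x y))).
rewrite mulrDl lerD //.
  rewrite mulrA -[leRHS]mul1r ler_wpM2r // rho_exp3.
  have [->|s0] := eqVneq (Num.sqrt (sqnorm (x - y))) 0; first by rewrite mul0r.
  by rewrite divff.
rewrite mulrCA ler_wpM2l ?exprn_ge0 ?rho_ge0 // -(invr_mul_powR b y1) mulrA.
by rewrite divff ?mul1r // gt_eqF.
Qed.

End RieszPotential.

Section RieszBoundedness.
Context {R : realType}.
Local Notation mu := (mu2 R).
Local Notation muXmu := (@area R \x @area R)%E.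
Implicit Types x y z : plane R.

Lemma integral_plane2 (f : plane R * plane R -> R) :
  measurable_fun setT f -> (forall p, 0 <= f p) ->
  (\int[mu]_y \int[mu]_z (f (y, z))%:E = \int[muXmu]_p (f p)%:E)%E.
Proof.
move=> mf f0; rewrite (@fubini_tonelli1 _ _ _ _ R (@area R) (@area R) (EFin \o f)) //.
exact/measurable_EFinP.
Qed.

Lemma integral_plane2_sym (f : plane R * plane R -> R) :
  measurable_fun setT f -> (forall p, 0 <= f p) ->
  (\int[mu]_z \int[mu]_y (f (y, z))%:E = \int[muXmu]_p (f p)%:E)%E.
Proof.
move=> mf f0; rewrite (@fubini_tonelli2 _ _ _ _ R (@area R) (@area R) (EFin \o f)) //.
exact/measurable_EFinP.
Qed.

Lemma measurable_partial_integral (f : plane R * plane R -> R) :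
  measurable_fun setT f -> (forall p, 0 <= f p) ->
  measurable_fun setT (fun y => \int[mu]_z (f (y, z))%:E)%E.
Proof.
move=> mf f0; apply: (measurable_fun_fubini_tonelli_F (m2 := @area R) (EFin \o f)).
  exact/measurable_EFinP.
by move=> p; rewrite lee_fin.
Qed.

(** The inner integral is bounded uniformly in the outer variable, so it can be
    replaced by its bound. *)
Lemma iterated_integral_le (a : plane R -> R) (k : plane R * plane R -> R) (A M : R) :
  measurable_fun setT a -> measurable_fun setT k ->
  (forall y, 0 <= a y) -> (forall p, 0 <= k p) -> 0 <= M ->
  (\int[mu]_y (a y)%:E <= A%:E)%E ->
  (forall y, \int[mu]_z (k (y, z))%:E <= M%:E)%E ->
  (\int[mu]_y \int[mu]_z (a y * k (y, z))%:E <= (M * A)%:E)%E.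
Proof.
move=> ma mk a0 k0 M0 aA kM.
have mky y : measurable_fun setT (fun z => k (y, z)).
  by apply: measurableT_comp => //; exact: measurable_pair1.
apply: (@le_trans _ _ (\int[mu]_y (M * a y)%:E)%E).
  apply: ge0_le_integral => //.
  - by move=> y _; apply: integral_ge0 => z _; rewrite lee_fin mulr_ge0.
  - apply: (measurable_partial_integral (f := fun p => a p.1 * k p)) => //=.
      by apply: measurable_funM => //; exact: (measurableT_comp ma).
    by move=> p; rewrite mulr_ge0.
  - by apply/measurable_EFinP; exact: measurable_funM.
  - move=> y _; rewrite ge0_integralZl_EFin_mul // EFinM muleC.
    by apply: lee_wpmul2r; rewrite ?lee_fin.
by rewrite ge0_integralZl_EFin_mul // EFinM lee_wpmul2l // lee_fin.
Qed.

(** The potential of F with kernel 1/|x - y|.  Its values are extended reals, so that it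
    is defined before any integrability of F is known. *)
Definition riesz (F : plane R -> R) x : \bar R := (\int[mu]_y (rho (x - y) ^+ 3 * F y)%:E)%E.

Lemma riesz_ge0 (F : plane R -> R) x : (forall y, 0 <= F y) -> (0 <= riesz F x)%E.
Proof.
by move=> F0; apply: integral_ge0 => y _; rewrite lee_fin mulr_ge0 ?exprn_ge0 ?rho_ge0.
Qed.

Lemma le_riesz (F G : plane R -> R) x : measurable_fun setT F -> measurable_fun setT G ->
  (forall y, 0 <= F y) -> (forall y, 0 <= G y) ->
  {ae mu, forall y, F y <= G y} -> (riesz F x <= riesz G x)%E.
Proof.
move=> mF mG F0 G0 FG; apply: ae_ge0_le_integral => //.
- by move=> y _; rewrite lee_fin mulr_ge0 ?exprn_ge0 ?rho_ge0.
- by apply/measurable_EFinP; apply: measurable_funM => //; exact: measurable_rho_subr.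
- by move=> y _; rewrite lee_fin mulr_ge0 ?exprn_ge0 ?rho_ge0.
- by apply/measurable_EFinP; apply: measurable_funM => //; exact: measurable_rho_subr.
- by apply: filterS FG => y Fy _; rewrite lee_fin ler_wpM2l // exprn_ge0 ?rho_ge0.
Qed.

(** With u = |x-y|^(-1/3), v = |y-z|^(-1/3), j = w(y)^2 the left-hand side is the
    integrand of the iterated potential.  Splitting u^3 v^3 w g as (u v g)(u^2 v^2 w) gives
    u^2 v^2 g^2 + u^4 v^4 w^2, and then u^2 v^2 <= u^4 + v^4.  In each of the three
    resulting terms one variable can be integrated out first, with a bound uniform in the
    other ones. *)
Lemma double_kernel_le (u v w g j : R) : 0 <= j ->
  u ^+ 3 * j * (v ^+ 3 * (w * g)) <=
  u ^+ 4 * j * g ^+ 2 + (g ^+ 2 * (v ^+ 4 * j) + u ^+ 4 * j * (v ^+ 4 * w ^+ 2)).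
Proof.
have amgm (a c : R) : a * c <= a ^+ 2 + c ^+ 2.
  have := sqr_ge0 (a - c); have := sqr_ge0 a; have := sqr_ge0 c; nra.
move=> j0.
have h1 := ler_wpM2r j0 (amgm (u * v * g) (u ^+ 2 * v ^+ 2 * w)).
have h2 := ler_wpM2r j0 (ler_wpM2r (sqr_ge0 g) (amgm (u ^+ 2) (v ^+ 2))).
lra.
Qed.

Local Ltac nonneg := repeat first
  [done | apply: exprn_ge0 | exact: rho_ge0 | exact: powR_ge0 | exact: sqr_ge0
  | apply: mulr_ge0 | apply: addr_ge0].

(** The first bound on F, in terms of g, is inserted under the integral in the second
    one.  This gives a double integral of the kind treated in [double_kernel_le]; in each of
    the three terms found there, g^2 or the weight is integrated against a kernel whose
    integral is bounded uniformly. *)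
Lemma riesz_bounded (b C1 C2 : R) (F g : plane R -> R) : 2 < b -> 0 <= C1 -> 0 <= C2 ->
  measurable_fun setT F -> measurable_fun setT g ->
  (forall y, 0 <= F y) -> (forall y, 0 <= g y) ->
  (\int[mu]_y (g y ^+ 2)%:E < +oo)%E ->
  (forall y, F y <= C1 * (japanese y `^ (- (b / 2)) * g y)) ->
  {ae mu, forall y, ((F y)%:E <= (C2 * japanese y `^ (- b))%:E * riesz F y)%E} ->
  exists2 M : R, 0 <= M & forall x, (riesz F x <= M%:E)%E.
Proof.
move=> b2 C10 C20 mF mg F0 g0 g2oo Fg Friesz.
have [M M0 MP] := integral_rho4_japanese b2.
pose w y := japanese y `^ (- (b / 2)); pose J y := japanese y `^ (- b).
have w2 y : w y ^+ 2 = J y.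
  by rewrite /w -powR_mulrn ?powR_ge0 // -powRrM; congr (_ `^ _); lra.
have w0 y : 0 <= w y by exact: powR_ge0.
have J0 y : 0 <= J y by exact: powR_ge0.
have mw : measurable_fun (setT : set (plane R)) w by exact: measurable_japanese_powR.
have mJ : measurable_fun (setT : set (plane R)) J by exact: measurable_japanese_powR.
have r0 n (z : plane R) : 0 <= rho z ^+ n by rewrite exprn_ge0 ?rho_ge0.
have mg2 : measurable_fun setT (fun y => g y ^+ 2) by exact: measurable_funX.
pose Gq := fine (\int[mu]_y (g y ^+ 2)%:E)%E.
have GqE : (\int[mu]_y (g y ^+ 2)%:E = Gq%:E)%E.
  by rewrite fineK // ge0_fin_numE //; apply: integral_ge0 => y _; rewrite lee_fin sqr_ge0.
have Gq0 : 0 <= Gq by apply: fine_ge0; apply: integral_ge0 => y _; rewrite lee_fin sqr_ge0.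
pose C := C1 * C2.
have C0 : 0 <= C by exact: mulr_ge0.
have C3 : 0 <= Gq * M + (M * Gq + M * M) by nonneg.
exists (C * (Gq * M + (M * Gq + M * M))) => [|x]; first exact: mulr_ge0.
(* In a pair p, the first component is the intermediate point y and the second the
   innermost variable z. *)
pose k1 (p : plane R * plane R) := rho (x - p.1) ^+ 4 * J p.1 * g p.2 ^+ 2.
pose k2 (p : plane R * plane R) := g p.2 ^+ 2 * (rho (p.2 - p.1) ^+ 4 * J p.1).
pose k3 (p : plane R * plane R) := rho (x - p.1) ^+ 4 * J p.1 * (rho (p.1 - p.2) ^+ 4 * J p.2).
pose k (p : plane R * plane R) :=
  rho (x - p.1) ^+ 3 * J p.1 * (rho (p.1 - p.2) ^+ 3 * (w p.2 * g p.2)).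
have m1 (f : plane R -> R) : measurable_fun setT f ->
    measurable_fun setT (fun p : plane R * plane R => f p.1).
  by move=> mf; exact: (measurableT_comp mf).
have m2 (f : plane R -> R) : measurable_fun setT f ->
    measurable_fun setT (fun p : plane R * plane R => f p.2).
  by move=> mf; exact: (measurableT_comp mf).
have mr n := measurable_rho_subr n x.
have mrs n : measurable_fun (setT : set (plane R * plane R)) (fun p => rho (p.2 - p.1) ^+ n).
  by under eq_fun do rewrite rhoC; exact: measurable_rho_sub.
have mrJ : measurable_fun (setT : set (plane R * plane R)) (fun p => rho (x - p.1) ^+ 4 * J p.1).
  by apply: (m1 (fun y => rho (x - y) ^+ 4 * J y)); exact: measurable_funM.
have mk1 : measurable_fun setT k1.
  by apply: measurable_funM => //; exact: (m2 (fun y => g y ^+ 2)).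
have mk2 : measurable_fun setT k2.
  apply: measurable_funM; first exact: (m2 (fun y => g y ^+ 2)).
  by apply: measurable_funM; [exact: mrs|exact: m1].
have mr4J : measurable_fun (setT : set (plane R * plane R))
    (fun p => rho (p.1 - p.2) ^+ 4 * J p.2).
  exact: (measurable_funM (measurable_rho_sub 4) (m2 _ mJ)).
have mk3 : measurable_fun setT k3 by exact: (measurable_funM mrJ mr4J).
have mk : measurable_fun setT k.
  apply: measurable_funM.
    by apply: (m1 (fun y => rho (x - y) ^+ 3 * J y)); exact: measurable_funM.
  apply: measurable_funM; first exact: measurable_rho_sub.
  by apply: (m2 (fun y => w y * g y)); exact: measurable_funM.
have s0 y : 0 <= g y ^+ 2 by exact: sqr_ge0.
have k0 p : 0 <= k p.
  exact: (mulr_ge0 (mulr_ge0 (r0 3 _) (J0 _)) (mulr_ge0 (r0 3 _) (mulr_ge0 (w0 _) (g0 _)))).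
have k10 p : 0 <= k1 p by exact: (mulr_ge0 (mulr_ge0 (r0 4 _) (J0 _)) (s0 _)).
have k20 p : 0 <= k2 p by exact: (mulr_ge0 (s0 _) (mulr_ge0 (r0 4 _) (J0 _))).
have k30 p : 0 <= k3 p.
  exact: (mulr_ge0 (mulr_ge0 (r0 4 _) (J0 _)) (mulr_ge0 (r0 4 _) (J0 _))).
have kle p : k p <= k1 p + (k2 p + k3 p).
  have := double_kernel_le (rho (x - p.1)) (rho (p.1 - p.2)) (w p.2) (g p.2) (J0 p.1).
  by rewrite (w2 p.2) {2}(rhoC p.1 p.2).
have mx4J : measurable_fun (setT : set (plane R)) (fun y => rho (x - y) ^+ 4 * J y).
  exact: (measurable_funM (mr 4) mJ).
have x4J0 y : 0 <= rho (x - y) ^+ 4 * J y by exact: (mulr_ge0 (r0 4 _) (J0 _)).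
have r4J0 (p : plane R * plane R) : 0 <= rho (p.1 - p.2) ^+ 4 * J p.2.
  exact: (mulr_ge0 (r0 4 _) (J0 _)).
have I1 : (\int[muXmu]_p (k1 p)%:E <= (Gq * M)%:E)%E.
  rewrite -(integral_plane2 mk1 k10).
  apply: (iterated_integral_le mx4J (m2 _ mg2) x4J0 (fun p => s0 p.2) Gq0 (MP x)) => y.
  by rewrite GqE.
have I2 : (\int[muXmu]_p (k2 p)%:E <= (M * Gq)%:E)%E.
  (* Here y is integrated first: in this term both factors that involve y belong to the
     kernel between y and z. *)
  rewrite -(integral_plane2_sym mk2 k20).
  apply: (iterated_integral_le mg2 mr4J s0 r4J0 M0 _ MP).
  by rewrite GqE.
have I3 : (\int[muXmu]_p (k3 p)%:E <= (M * M)%:E)%E.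
  rewrite -(integral_plane2 mk3 k30).
  exact: (iterated_integral_le mx4J mr4J x4J0 r4J0 M0 (MP x) MP).
have Ik : (\int[muXmu]_p (k p)%:E <= (Gq * M + (M * Gq + M * M))%:E)%E.
  have mk23 : measurable_fun setT (fun p => k2 p + k3 p) by exact: measurable_funD mk2 mk3.
  have k230 p : 0 <= k2 p + k3 p by exact: addr_ge0.
  apply: (le_trans (ge0_le_integral_EFin muXmu mk (measurable_funD mk1 mk23) k0 kle)).
  rewrite (ge0_integralD_EFin muXmu mk1 mk23 k10 k230) EFinD; apply: (leeD I1).
  rewrite (ge0_integralD_EFin muXmu mk2 mk3 k20 k30) EFinD; exact: (leeD I2 I3).
rewrite EFinM; apply: (@le_trans _ _ (C%:E * \int[muXmu]_p (k p)%:E)%E); last first.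
  by apply: lee_wpmul2l => //; rewrite lee_fin.
rewrite -ge0_integralZl_EFin_mul // -integral_plane2 //; last 2 first.
- exact: measurable_funM.
- by move=> p; nonneg.
apply: ae_ge0_le_integral => //.
- by move=> y _; rewrite lee_fin mulr_ge0.
- by apply/measurable_EFinP; exact: measurable_funM.
- by move=> y _; apply: integral_ge0 => z _; rewrite lee_fin mulr_ge0.
- apply: (measurable_partial_integral (f := fun p => C * k p)).
  + exact: measurable_funM.
  + by move=> p; nonneg.
apply: filterS Friesz => y Fy _.
have mwg : measurable_fun (setT : set (plane R)) (fun z => w z * g z) by exact: measurable_funM.
have wg0 z : 0 <= w z * g z by exact: mulr_ge0.
have mrwg : measurable_fun (setT : set (plane R)) (fun z => rho (y - z) ^+ 3 * (w z * g z)).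
  exact: (measurable_funM (measurable_rho_subr 3 y) mwg).
have rwg0 z : 0 <= rho (y - z) ^+ 3 * (w z * g z) by exact: (mulr_ge0 (r0 3 _) (wg0 z)).
have step : (riesz F y <= C1%:E * \int[mu]_z (rho (y - z) ^+ 3 * (w z * g z))%:E)%E.
  rewrite -(ge0_integralZl_EFin_mul _ C10 mrwg rwg0).
  apply: ge0_le_integral_EFin => [||z|z].
  - exact: (measurable_funM (measurable_rho_subr 3 y) mF).
  - exact: (measurable_funM (measurable_cst C1) mrwg).
  - exact: (mulr_ge0 (r0 3 _) (F0 z)).
  - by rewrite mulrCA; apply: ler_wpM2l.
have xJ0 : 0 <= rho (x - y) ^+ 3 * J y by exact: (mulr_ge0 (r0 3 _) (J0 y)).
have -> : (\int[mu]_z (C * k (y, z))%:E =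
  (C * (rho (x - y) ^+ 3 * J y))%:E * \int[mu]_z (rho (y - z) ^+ 3 * (w z * g z))%:E)%E.
  rewrite -(ge0_integralZl_EFin_mul _ (mulr_ge0 C0 xJ0) mrwg rwg0).
  by apply: eq_integral => z _; rewrite /k /= !mulrA.
(* The constant of the second bound goes with the outer weight, that of the first with the
   inner integral. *)
have -> : C * (rho (x - y) ^+ 3 * J y) = rho (x - y) ^+ 3 * (C2 * J y) * C1.
  by rewrite /C; ring.
rewrite [X in (_ <= X * _)%E]EFinM -muleA [X in (X <= _)%E]EFinM.
have CJ0 : 0 <= C2 * J y by exact: mulr_ge0.
rewrite (EFinM (rho (x - y) ^+ 3)) -muleA.
apply: lee_wpmul2l; first by rewrite lee_fin; exact: r0.
apply: (le_trans Fy); apply: lee_wpmul2l => //; by rewrite lee_fin.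
Qed.

End RieszBoundedness.

(** * Functions with compact support *)

Section CompactSupport.
Context {R : realType}.
Local Notation leb := (@lebesgue_measure R).
Local Notation mu := (mu2 R).

(** Squares instead of discs, so that the slices in Tonelli's theorem are intervals. *)
Definition off_box (A : R) (h : R * R -> R) : Prop :=
  forall x, (A < `|x.1|) || (A < `|x.2|) -> h x = 0.

Definition box (A : R) : set (plane R) := `[- A, A] `*` `[- A, A].

Lemma in_box A x : box A x <-> `|x.1| <= A /\ `|x.2| <= A.
Proof. by rewrite /box /= !in_itv /= !ler_norml. Qed.

Lemma measurable_box A : measurable (box A).
Proof. by apply: measurableX; exact: measurable_itv. Qed.

Lemma mu2_box_lty A : (mu (box A) < +oo)%E.
Proof.
pose I : set (measurableTypeR R) := `[- A, A]%classic.
have -> : mu (box A) = (leb I * leb I)%E by apply: product_measure1E; exact: measurable_itv.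
rewrite !lebesgue_measure_itv /=.
by case: ifP => // _; rewrite ?mule0 // -EFinD -EFinM ltry.
Qed.

Lemma off_boxM A (h k : R * R -> R) : off_box A h -> off_box A (fun x => k x * h x).
Proof. by move=> hA x /hA ->; rewrite mulr0. Qed.

Lemma off_boxD A (h k : R * R -> R) : off_box A h -> off_box A k ->
  off_box A (fun x => h x + k x).
Proof. by move=> hA kA x xA; rewrite hA ?kA ?addr0. Qed.

Lemma continuous_off_box_bounded A (h : R * R -> R) : continuous h -> off_box A h ->
  exists2 M : R, 0 <= M & forall x, `|h x| <= M.
Proof.
move=> ch hA; have [A0|A0] := ltP A 0.
  exists 0 => // x; rewrite hA ?normr0 //.
  by rewrite (lt_le_trans A0).
have cb : compact (box A : set (R * R)).
  by apply: compact_setX; exact: segment_compact.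
have [||c _ cM] := @compact_EVT_max _ R (fun x => `|h x|) _ _ cb.
- exists (0, 0); apply/in_box => /=; by rewrite normr0.
- apply: continuous_subspaceT => x.
  by apply: (@continuous_comp _ _ _ h (@Num.norm R R)); [exact: ch|exact: norm_continuous].
exists `|h c| => // x.
have [xA|xA] := boolP ((A < `|x.1|) || (A < `|x.2|)); first by rewrite hA // normr0.
apply: cM; rewrite inE; apply/in_box.
by move: xA; rewrite negb_or -!leNgt => /andP[].
Qed.

Lemma bounded_off_box_integrable (A M : R) (h : plane R -> R) :
  measurable_fun setT h -> off_box A h -> (forall x, `|h x| <= M) ->
  mu.-integrable setT (EFin \o h).
Proof.
move=> mh hA hM; apply/integrableP; split; first exact/measurable_EFinP.
apply: (@le_lt_trans _ _ (\int[mu]_x (M * \1_(box A) x)%:E)%E).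
  apply: ge0_le_integral_EFin => //=.
  - exact: measurableT_comp.
  - apply: measurable_funM => //; exact: measurable_indic (measurable_box A).
  - move=> x; rewrite indicE.
    have [xA|] := boolP (x \in box A); first by rewrite mulr1.
    rewrite notin_setE => xA; rewrite mulr0 hA ?normr0 //.
    apply: contrapT => /negP; rewrite negb_or -!leNgt => /andP[x1 x2].
    by apply: xA; apply/in_box.
have M0 : 0 <= M by exact: le_trans (hM (0, 0)).
rewrite ge0_integralZl_EFin_mul //; last exact: measurable_indic (measurable_box A).
rewrite integral_indic ?setIT //; last exact: measurable_box.
by rewrite lte_mul_pinfty // ?lee_fin ?mu2_box_lty.
Qed.

Lemma continuous_off_box_integrable A (h : R * R -> R) :
  continuous h -> off_box A h -> mu.-integrable setT (EFin \o h).
Proof.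
move=> ch hA; have [M M0 hM] := continuous_off_box_bounded ch hA.
by apply: (bounded_off_box_integrable _ hA hM); exact: continuous_measurable_plane.
Qed.

Lemma integral_derive_eq0 (A : R) (f f' : R -> R) :
  (forall s : R, is_derive s 1 f (f' s)) -> continuous f' ->
  (forall s, A < `|s| -> f s = 0) -> (forall s, A < `|s| -> f' s = 0) ->
  (\int[leb]_s (f' s)%:E = 0)%E.
Proof.
(* f is only assumed to vanish beyond A, so the end points are moved outwards. *)
move=> df cf' fA f'A; pose B := `|A| + 1.
have AB : A < B by rewrite /B; have := ler_norm A; lra.
have B0 : 0 < B by rewrite /B; have := normr_ge0 A; lra.
have -> : (\int[leb]_s (f' s)%:E = \int[leb]_(s in `[(- B)%R, B]) (f' s)%:E)%E.
  rewrite [RHS]integral_mkcond; apply: eq_integral => s _; rewrite /patch.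
  case: ifPn => //; rewrite notin_setE /= in_itv /= => /negP; rewrite -ler_norml -ltNge => sB.
  by rewrite f'A // (lt_trans AB).
have cf s : {for s, continuous f}.
  by have [d _] := df s; apply: differentiable_continuous; apply/derivable1_diffP.
rewrite (@continuous_FTC2 _ _ f) //.
- by rewrite !fA ?subee // ?normrN gtr0_norm.
- by lra.
- exact: continuous_subspaceT.
- split; first by move=> s _; case: (df s).
    by apply: cvg_at_right_filter; exact: cf.
  by apply: cvg_at_left_filter; exact: cf.
- by move=> s _; have ds := df s; rewrite derive1E derive_val.
Qed.

Lemma continuous_pairr (h : R * R -> R) (s : R) : continuous h -> continuous (fun t => h (s, t)).
Proof.
move=> ch t; apply: (@continuous_comp _ _ _ (fun t : R => (s, t)) h); last exact: ch.
by apply: (@cvg_pair _ _ _ (nbhs t) (nbhs s) (nbhs t) _ _ _ (fun=> s) id);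
  [exact: cvg_cst|exact: cvg_id].
Qed.

Lemma continuous_pairl (h : R * R -> R) (t : R) : continuous h -> continuous (fun s => h (s, t)).
Proof.
move=> ch s; apply: (@continuous_comp _ _ _ (fun s : R => (s, t)) h); last exact: ch.
by apply: (@cvg_pair _ _ _ (nbhs s) (nbhs s) (nbhs t) _ _ _ id (fun=> t));
  [exact: cvg_id|exact: cvg_cst].
Qed.

Lemma integral_partial1_eq0 (A : R) (g g' : R * R -> R) :
  (forall s t : R, is_derive s 1 (fun s => g (s, t)) (g' (s, t))) ->
  continuous g' -> off_box A g -> off_box A g' -> (\int[mu]_x (g' x)%:E = 0)%E.
Proof.
move=> dg cg gA g'A; have ig := continuous_off_box_integrable cg g'A.
have -> : (\int[mu]_x (g' x)%:E = \int[leb]_t \int[leb]_s (g' (s, t))%:E)%E.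
  by rewrite (@integral21_prod_meas1 _ _ _ _ R leb leb (EFin \o g')).
rewrite integral0_eq // => t _.
apply: (@integral_derive_eq0 A (fun s => g (s, t))) => // [|s sA|s sA].
- exact: continuous_pairl.
- by apply: gA; rewrite /= sA.
- by apply: g'A; rewrite /= sA.
Qed.

Lemma integral_partial2_eq0 (A : R) (g g' : R * R -> R) :
  (forall s t : R, is_derive t 1 (fun t => g (s, t)) (g' (s, t))) ->
  continuous g' -> off_box A g -> off_box A g' -> (\int[mu]_x (g' x)%:E = 0)%E.
Proof.
move=> dg cg gA g'A; have ig := continuous_off_box_integrable cg g'A.
have -> : (\int[mu]_x (g' x)%:E = \int[leb]_s \int[leb]_t (g' (s, t))%:E)%E.
  by rewrite (@integral12_prod_meas1 _ _ _ _ R leb leb (EFin \o g')).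
rewrite integral0_eq // => s _.
apply: (@integral_derive_eq0 A (fun t => g (s, t))) => // [|t tA|t tA].
- exact: continuous_pairr.
- by apply: gA; rewrite /= tA orbT.
- by apply: g'A; rewrite /= tA orbT.
Qed.

(** What integration by parts uses of a test function; d1 and d2 are its derivatives
    along the coordinate lines, as functions of one variable. *)
Record C1_off_box (A : R) (chi d1 d2 : R * R -> R) : Prop := C1OffBox {
  C1_continuous : continuous chi;
  C1_continuous1 : continuous d1;
  C1_continuous2 : continuous d2;
  C1_is_derive1 : forall s t : R, is_derive s 1 (fun s => chi (s, t)) (d1 (s, t));
  C1_is_derive2 : forall s t : R, is_derive t 1 (fun t => chi (s, t)) (d2 (s, t));
  C1_off : off_box A chi;
  C1_off1 : off_box A d1;
  C1_off2 : off_box A d2 }.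

Lemma derive_basis1 (f : R * R -> R) s t :
  derivable f (s, t) (basis_vec R ord0) ->
  is_derive s 1 (fun s => f (s, t)) (partial ord0 f (s, t)).
Proof.
have E : (fun h : R => h^-1 *: (f (h *: basis_vec R ord0 + (s, t)) - f (s, t))) =
         (fun h : R => h^-1 *: (f (h *: 1 + s, t) - f (s, t))).
  apply/funext => h; congr (_ *: (f _ - _)).
  by rewrite /basis_vec /=; congr pair => /=; rewrite ?scaler0 ?add0r.
rewrite /derivable /partial /derive E => df; split => //.
Qed.

Lemma derive_basis2 (f : R * R -> R) s t :
  derivable f (s, t) (basis_vec R ord_max) ->
  is_derive t 1 (fun t => f (s, t)) (partial ord_max f (s, t)).
Proof.
have E : (fun h : R => h^-1 *: (f (h *: basis_vec R ord_max + (s, t)) - f (s, t))) =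
         (fun h : R => h^-1 *: (f (s, h *: 1 + t) - f (s, t))).
  apply/funext => h; congr (_ *: (f _ - _)).
  by rewrite /basis_vec /=; congr pair => /=; rewrite ?scaler0 ?add0r.
rewrite /derivable /partial /derive E => df; split => //.
Qed.

(** A directional derivative along a basis vector is the derivative along a coordinate
    line.  It vanishes off the box because the complement of the box is open, so that the
    function is locally zero there or zero along the whole line. *)
Lemma smooth_C1_off_box A (chi : R * R -> R) : smooth chi -> off_box A chi ->
  C1_off_box A chi (partial ord0 chi) (partial ord_max chi).
Proof.
move=> sm off.
have [c0 d0] := sm [::]; have [c1 _] := sm [:: ord0]; have [c2 _] := sm [:: ord_max].
have d1 s t := derive_basis1 (d0 ord0 (s, t)).
have d2 s t := derive_basis2 (d0 ord_max (s, t)).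
have far (s : R) : A < `|s| -> \forall u \near s, A < `|u|.
  move=> sA; near=> u; near: u.
  by apply: (@cvgr_gt R R (nbhs s) _ (@Num.norm R R) `|s|) => //; exact: norm_continuous.
split; [exact: c0|exact: c1|exact: c2|exact: d1|exact: d2|exact: off| |].
- move=> [s t] /= /orP[sA|tA].
    have z : is_derive s 1 (fun s => chi (s, t)) 0.
      apply: (near_eq_is_derive _ (is_derive_cst (0 : R) s 1)).
      by near=> u; rewrite off //= (near (far _ sA) u).
    by have := d1 s t => d; rewrite -(@derive_val _ _ _ _ _ _ _ d) (@derive_val _ _ _ _ _ _ _ z).
  have z : is_derive s 1 (fun s => chi (s, t)) 0.
    have -> : (fun s => chi (s, t)) = cst 0 by apply/funext => u; rewrite off //= tA orbT.
    exact: is_derive_cst.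
  by have := d1 s t => d; rewrite -(@derive_val _ _ _ _ _ _ _ d) (@derive_val _ _ _ _ _ _ _ z).
- move=> [s t] /= /orP[sA|tA].
    have z : is_derive t 1 (fun t => chi (s, t)) 0.
      have -> : (fun t => chi (s, t)) = cst 0 by apply/funext => u; rewrite off //= sA.
      exact: is_derive_cst.
    by have := d2 s t => d; rewrite -(@derive_val _ _ _ _ _ _ _ d) (@derive_val _ _ _ _ _ _ _ z).
  have z : is_derive t 1 (fun t => chi (s, t)) 0.
    apply: (near_eq_is_derive _ (is_derive_cst (0 : R) t 1)).
    by near=> u; rewrite off //= (near (far _ tA) u) ?orbT.
  by have := d2 s t => d; rewrite -(@derive_val _ _ _ _ _ _ _ d) (@derive_val _ _ _ _ _ _ _ z).
Unshelve. all: by end_near.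
Qed.

End CompactSupport.

(** * The regularised Green identities *)

Section RegularizedGreen.
Context {R : realType}.
Local Notation mu := (mu2 R).

Definition qreg (e : R) (y x : R * R) : R := sqnorm (x - y) + e.

Lemma qreg_gt0 e y x : 0 < e -> 0 < qreg e y x.
Proof. by move=> e0; rewrite /qreg ltr_wpDl // sqnorm_ge0. Qed.

Lemma continuous_fst_plane : continuous (fst : R * R -> R).
Proof. by move=> x; exact: cvg_fst. Qed.

Lemma continuous_snd_plane : continuous (snd : R * R -> R).
Proof. by move=> x; exact: cvg_snd. Qed.

Lemma continuous_sub1 (y : R * R) : continuous (fun x : R * R => x.1 - y.1).
Proof. by move=> x; apply: cvgB; [exact: continuous_fst_plane|exact: cvg_cst]. Qed.

Lemma continuous_sub2 (y : R * R) : continuous (fun x : R * R => x.2 - y.2).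
Proof. by move=> x; apply: cvgB; [exact: continuous_snd_plane|exact: cvg_cst]. Qed.

Lemma continuousM_plane (f g : R * R -> R) :
  continuous f -> continuous g -> continuous (fun x => f x * g x).
Proof. by move=> cf cg x; apply: cvgM; [exact: cf|exact: cg]. Qed.

Lemma continuousD_plane (f g : R * R -> R) :
  continuous f -> continuous g -> continuous (fun x => f x + g x).
Proof. by move=> cf cg x; apply: cvgD; [exact: cf|exact: cg]. Qed.

Lemma continuousB_plane (f g : R * R -> R) :
  continuous f -> continuous g -> continuous (fun x => f x - g x).
Proof. by move=> cf cg x; apply: cvgB; [exact: cf|exact: cg]. Qed.

Lemma continuousZ_plane (c : R) (f : R * R -> R) :
  continuous f -> continuous (fun x => c * f x).
Proof. by move=> cf; apply: continuousM_plane => // x; exact: cvg_cst. Qed.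

Lemma continuous_qreg e y : continuous (qreg e y).
Proof.
apply: (@continuousD_plane (fun x => sqnorm (x - y)) (fun=> e)); last by move=> x; exact: cvg_cst.
apply: continuousD_plane => x.
  by apply: (@continuous_comp _ _ _ (fun x : R * R => x.1 - y.1) (fun t : R => t ^+ 2));
    [exact: continuous_sub1|exact: exprn_continuous].
by apply: (@continuous_comp _ _ _ (fun x : R * R => x.2 - y.2) (fun t : R => t ^+ 2));
  [exact: continuous_sub2|exact: exprn_continuous].
Qed.

Lemma continuous_qregV e y : 0 < e -> continuous (fun x => (qreg e y x)^-1).
Proof.
by move=> e0 x; apply: cvgV; [rewrite gt_eqF // qreg_gt0|exact: continuous_qreg].
Qed.

(** With [u2], the gradient of (1/2) log (|x-y|^2 + e) in x.  For e > 0 it is smooth; for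
    e = 0 it is (x-y) / |x-y|^2, with the value 0 at x = y. *)
Definition u1 (e : R) (y x : R * R) : R := (x.1 - y.1) * (qreg e y x)^-1.
Definition u2 (e : R) (y x : R * R) : R := (x.2 - y.2) * (qreg e y x)^-1.
(** Together with [diag1] and [diag2], the Hessian of (1/2) log (|x-y|^2 + e). *)
Definition cross (e : R) (y x : R * R) : R :=
  - (2 * ((x.1 - y.1) * (x.2 - y.2)) * ((qreg e y x)^-1 * (qreg e y x)^-1)).
Definition diag1 (e : R) (y x : R * R) : R :=
  (qreg e y x)^-1 - 2 * ((x.1 - y.1) * (x.1 - y.1)) * ((qreg e y x)^-1 * (qreg e y x)^-1).
Definition diag2 (e : R) (y x : R * R) : R :=
  (qreg e y x)^-1 - 2 * ((x.2 - y.2) * (x.2 - y.2)) * ((qreg e y x)^-1 * (qreg e y x)^-1).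
(** The Laplacian of (1/2) log (|x-y|^2 + e). *)
Definition log_laplacian (e : R) (y x : R * R) : R := 2 * e * ((qreg e y x)^-1 * (qreg e y x)^-1).

Section Continuity.
Variables (e : R) (y : R * R).
Hypothesis e0 : 0 < e.

Lemma continuous_u1 : continuous (u1 e y).
Proof. by apply: continuousM_plane; [exact: continuous_sub1|exact: continuous_qregV]. Qed.

Lemma continuous_u2 : continuous (u2 e y).
Proof. by apply: continuousM_plane; [exact: continuous_sub2|exact: continuous_qregV]. Qed.

Lemma continuous_qregV2 : continuous (fun x => (qreg e y x)^-1 * (qreg e y x)^-1).
Proof. by apply: continuousM_plane; exact: continuous_qregV. Qed.

Lemma continuous_cross : continuous (cross e y).
Proof.
move=> x; apply: cvgN; move: x.
apply: continuousM_plane; last exact: continuous_qregV2.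
by apply: continuousZ_plane; apply: continuousM_plane; [exact: continuous_sub1|exact: continuous_sub2].
Qed.

Lemma continuous_diag1 : continuous (diag1 e y).
Proof.
apply: continuousB_plane; first exact: continuous_qregV.
apply: continuousM_plane; last exact: continuous_qregV2.
by apply: continuousZ_plane; apply: continuousM_plane; exact: continuous_sub1.
Qed.

Lemma continuous_diag2 : continuous (diag2 e y).
Proof.
apply: continuousB_plane; first exact: continuous_qregV.
apply: continuousM_plane; last exact: continuous_qregV2.
by apply: continuousZ_plane; apply: continuousM_plane; exact: continuous_sub2.
Qed.

Lemma continuous_log_laplacian : continuous (log_laplacian e y).
Proof. by apply: continuousZ_plane; exact: continuous_qregV2. Qed.

Lemma diag1D2 x : diag1 e y x + diag2 e y x = log_laplacian e y x.
Proof.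
rewrite /diag1 /diag2 /log_laplacian.
have q0 := qreg_gt0 y x e0; have : sqnorm (x - y) = qreg e y x - e by rewrite /qreg addrK.
rewrite {1}/sqnorm /=; move: (qreg e y x) q0 => q q0.
move: (x.1 - y.1) (x.2 - y.2) => a b ab.
have -> : e = q - (a ^+ 2 + b ^+ 2) by rewrite ab; ring.
by field; rewrite gt_eqF.
Qed.

End Continuity.

Lemma is_derive_mul (f g : R -> R) (s df dg : R) :
  is_derive s 1 f df -> is_derive s 1 g dg ->
  is_derive s 1 (fun s => f s * g s) (df * g s + f s * dg).
Proof.
move=> Df Dg; apply: is_derive_eq (is_deriveM Df Dg) _.
by rewrite /GRing.scale /= addrC mulrC.
Qed.

Lemma is_derive_sub_cst (s b : R) : is_derive s 1 (fun s : R => s - b) 1.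
Proof. by have := is_deriveB (is_derive_id s 1) (is_derive_cst b s 1); rewrite subr0. Qed.

Lemma is_derive_qregV (s b d : R) : 0 < d ->
  is_derive s 1 (fun s : R => ((s - b) ^+ 2 + d)^-1)
    (- (2 * (s - b)) * (((s - b) ^+ 2 + d)^-1 * ((s - b) ^+ 2 + d)^-1)).
Proof.
move=> d0; have q0 : (s - b) ^+ 2 + d != 0 by rewrite gt_eqF // ltr_wpDl // sqr_ge0.
have D1 := is_derive_mul (is_derive_sub_cst s b) (is_derive_sub_cst s b).
have D2 := is_deriveD D1 (is_derive_cst d s 1).
have D3 : is_derive s 1 (fun s : R => (s - b) ^+ 2 + d) (2 * (s - b)).
  by apply: is_derive_eq D2 _; ring.
apply: is_derive_eq (@is_deriveV _ (fun s : R => (s - b) ^+ 2 + d) s _ 1 q0 D3) _.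
by rewrite /GRing.scale /= -exprVn; ring.
Qed.

Section Derivatives.
Variables (e : R) (y : R * R) (s t : R).
Hypothesis e0 : 0 < e.

Let dV1 : is_derive s 1 (fun s => (qreg e y (s, t))^-1)
  (- (2 * (s - y.1)) * ((qreg e y (s, t))^-1 * (qreg e y (s, t))^-1)).
Proof.
have d0 : 0 < (t - y.2) ^+ 2 + e by rewrite ltr_wpDl // sqr_ge0.
have E u : qreg e y (u, t) = (u - y.1) ^+ 2 + ((t - y.2) ^+ 2 + e) by rewrite /qreg /sqnorm addrA.
by rewrite E; under eq_fun do rewrite E; exact: is_derive_qregV.
Qed.

Let dV2 : is_derive t 1 (fun t => (qreg e y (s, t))^-1)
  (- (2 * (t - y.2)) * ((qreg e y (s, t))^-1 * (qreg e y (s, t))^-1)).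
Proof.
have d0 : 0 < (s - y.1) ^+ 2 + e by rewrite ltr_wpDl // sqr_ge0.
have E u : qreg e y (s, u) = (u - y.2) ^+ 2 + ((s - y.1) ^+ 2 + e).
  by rewrite /qreg /sqnorm /=; ring.
by rewrite E; under eq_fun do rewrite E; exact: is_derive_qregV.
Qed.

Lemma is_derive1_u1 : is_derive s 1 (fun s => u1 e y (s, t)) (diag1 e y (s, t)).
Proof.
apply: is_derive_eq (is_derive_mul (is_derive_sub_cst s y.1) dV1) _.
by rewrite /diag1 /=; ring.
Qed.

Lemma is_derive2_u2 : is_derive t 1 (fun t => u2 e y (s, t)) (diag2 e y (s, t)).
Proof.
apply: is_derive_eq (is_derive_mul (is_derive_sub_cst t y.2) dV2) _.
by rewrite /diag2 /=; ring.
Qed.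

Lemma is_derive1_u2 : is_derive s 1 (fun s => u2 e y (s, t)) (cross e y (s, t)).
Proof.
apply: is_derive_eq (is_derive_mul (is_derive_cst (t - y.2) s 1) dV1) _.
by rewrite /cross /=; ring.
Qed.

Lemma is_derive2_u1 : is_derive t 1 (fun t => u1 e y (s, t)) (cross e y (s, t)).
Proof.
apply: is_derive_eq (is_derive_mul (is_derive_cst (s - y.1) t 1) dV2) _.
by rewrite /cross /=; ring.
Qed.

End Derivatives.

Section Green.
Variables (A : R) (chi d1 d2 : R * R -> R).
Hypothesis C1chi : C1_off_box A chi d1 d2.

Let cchi := C1_continuous C1chi.
Let cd1 := C1_continuous1 C1chi.
Let cd2 := C1_continuous2 C1chi.

Lemma integral_by_parts1 (u du : R * R -> R) : continuous u -> continuous du ->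
  (forall s t : R, is_derive s 1 (fun s => u (s, t)) (du (s, t))) ->
  \int[mu]_x (u x * d1 x) = - \int[mu]_x (du x * chi x).
Proof.
move=> cu cdu Du.
have iu : mu.-integrable setT (EFin \o (fun x => u x * d1 x)).
  apply: (@continuous_off_box_integrable _ A); first exact: continuousM_plane.
  exact: off_boxM (C1_off1 C1chi).
have idu : mu.-integrable setT (EFin \o (fun x => du x * chi x)).
  apply: (@continuous_off_box_integrable _ A); first exact: continuousM_plane.
  exact: off_boxM (C1_off C1chi).
apply/eqP; rewrite -subr_eq0 opprK -RintegralD //; apply/eqP.
rewrite /Rintegral [X in fine X](_ : _ = 0%E) //.
apply: (@integral_partial1_eq0 _ A (fun x => u x * chi x)).
- move=> s t; apply: is_derive_eq (is_derive_mul (Du s t) (C1_is_derive1 C1chi s t)) _.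
  by rewrite addrC.
- by apply: continuousD_plane; exact: continuousM_plane.
- exact: off_boxM (C1_off C1chi).
- by apply: off_boxD; apply: off_boxM; [exact: C1_off1 C1chi|exact: C1_off C1chi].
Qed.

Lemma integral_by_parts2 (u du : R * R -> R) : continuous u -> continuous du ->
  (forall s t : R, is_derive t 1 (fun t => u (s, t)) (du (s, t))) ->
  \int[mu]_x (u x * d2 x) = - \int[mu]_x (du x * chi x).
Proof.
move=> cu cdu Du.
have iu : mu.-integrable setT (EFin \o (fun x => u x * d2 x)).
  apply: (@continuous_off_box_integrable _ A); first exact: continuousM_plane.
  exact: off_boxM (C1_off2 C1chi).
have idu : mu.-integrable setT (EFin \o (fun x => du x * chi x)).
  apply: (@continuous_off_box_integrable _ A); first exact: continuousM_plane.
  exact: off_boxM (C1_off C1chi).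
apply/eqP; rewrite -subr_eq0 opprK -RintegralD //; apply/eqP.
rewrite /Rintegral [X in fine X](_ : _ = 0%E) //.
apply: (@integral_partial2_eq0 _ A (fun x => u x * chi x)).
- move=> s t; apply: is_derive_eq (is_derive_mul (Du s t) (C1_is_derive2 C1chi s t)) _.
  by rewrite addrC.
- by apply: continuousD_plane; exact: continuousM_plane.
- exact: off_boxM (C1_off C1chi).
- by apply: off_boxD; apply: off_boxM; [exact: C1_off2 C1chi|exact: C1_off C1chi].
Qed.

(** Integration by parts moves the derivatives to the gradient of the regularised
    logarithm, whose divergence is its Laplacian. *)
Lemma green_divergence (e : R) (y : R * R) : 0 < e ->
  \int[mu]_x (u1 e y x * d1 x) + \int[mu]_x (u2 e y x * d2 x) =
  - \int[mu]_x (log_laplacian e y x * chi x).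
Proof.
move=> e0.
have D1 (s t : R) : is_derive s 1 (fun s => u1 e y (s, t)) (diag1 e y (s, t)).
  exact: is_derive1_u1.
have D2 (s t : R) : is_derive t 1 (fun t => u2 e y (s, t)) (diag2 e y (s, t)).
  exact: is_derive2_u2.
rewrite (integral_by_parts1 (continuous_u1 (y := y) e0) (continuous_diag1 (y := y) e0) D1).
rewrite (integral_by_parts2 (continuous_u2 (y := y) e0) (continuous_diag2 (y := y) e0) D2).
rewrite -opprD -RintegralD //.
- by congr (- _); apply: eq_Rintegral => x _; rewrite -mulrDl diag1D2.
- apply: (@continuous_off_box_integrable _ A).
    by apply: continuousM_plane => //; exact: continuous_diag1.
  exact: off_boxM (C1_off C1chi).
- apply: (@continuous_off_box_integrable _ A).
    by apply: continuousM_plane => //; exact: continuous_diag2.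
  exact: off_boxM (C1_off C1chi).
Qed.

(** Both sides equal minus the integral of the mixed second derivative times chi. *)
Lemma green_curl (e : R) (y : R * R) : 0 < e ->
  \int[mu]_x (u2 e y x * d1 x) = \int[mu]_x (u1 e y x * d2 x).
Proof.
move=> e0.
have D1 (s t : R) : is_derive s 1 (fun s => u2 e y (s, t)) (cross e y (s, t)).
  exact: is_derive1_u2.
have D2 (s t : R) : is_derive t 1 (fun t => u1 e y (s, t)) (cross e y (s, t)).
  exact: is_derive2_u1.
rewrite (integral_by_parts1 (continuous_u2 (y := y) e0) (continuous_cross (y := y) e0) D1).
by rewrite (integral_by_parts2 (continuous_u1 (y := y) e0) (continuous_cross (y := y) e0) D2).
Qed.

End Green.

End RegularizedGreen.

(** * The total mass of the regularised Laplacian *)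

Section LogLaplacianMass.
Context {R : realType}.
Local Notation leb := (@lebesgue_measure R).
Local Notation mu := (mu2 R).

Section Angle.
Variable r : R.
Hypothesis r0 : 0 < r.

Let theta (t : R) : R := atan (r^-1 * t).

Let theta0 : theta 0 = 0.
Proof. by rewrite /theta mulr0 atan0. Qed.

Let cvg_theta : theta t @[t --> +oo] --> pi / 2.
Proof.
apply: (cvg_comp (fun t : R => r^-1 * t) atan); last exact: cvgy_atan.
by apply: gt0_cvgMry; [rewrite invr_gt0|exact: cvg_id].
Qed.

Let cos_theta_gt0 t : 0 < cos (theta t).
Proof. by apply: cos_gt0_pihalf; rewrite atan_gtNpi2 atan_ltpi2. Qed.

Let cos_theta2 t : cos (theta t) ^+ 2 = r ^+ 2 * (t ^+ 2 + r ^+ 2)^-1.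
Proof.
have q0 : t ^+ 2 + r ^+ 2 != 0 by rewrite gt_eqF // ltr_wpDl ?sqr_ge0 ?exprn_gt0.
have p0 : 0 < 1 + (r^-1 * t) ^+ 2 by rewrite ltr_wpDr ?sqr_ge0.
rewrite /theta cos_atan exprVn sqr_sqrtr; last exact: ltW.
have q0' : r ^+ 2 + t ^+ 2 != 0 by rewrite addrC.
have r1 : r != 0 by rewrite gt_eqF.
by field; rewrite r1 q0.
Qed.

Let cos_theta t : cos (theta t) = r * (Num.sqrt (t ^+ 2 + r ^+ 2))^-1.
Proof.
have q0 : 0 <= t ^+ 2 + r ^+ 2 by rewrite addr_ge0 ?sqr_ge0.
apply/eqP; rewrite -(@eqrXn2 _ 2) //; last 2 first.
- exact: ltW.
- by rewrite mulr_ge0 ?invr_ge0 ?sqrtr_ge0 // ltW.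
by rewrite cos_theta2 exprMn exprVn sqr_sqrtr.
Qed.

Let is_derive_theta (t : R) : is_derive t 1 theta (r * (t ^+ 2 + r ^+ 2)^-1).
Proof.
have D1 := @is_derive_mul _ _ _ t _ _ (is_derive_cst r^-1 t 1) (is_derive_id t 1).
have D2 := @is_derive1_comp _ atan (fun t : R => r^-1 * t) t _ _ (is_derive1_atan _) D1.
have q0 : t ^+ 2 + r ^+ 2 != 0 by rewrite gt_eqF // ltr_wpDl ?sqr_ge0 ?exprn_gt0.
have q0' : r ^+ 2 + t ^+ 2 != 0 by rewrite addrC.
have r1 : r != 0 by rewrite gt_eqF.
by apply: is_derive_eq D2 _; rewrite /cst /=; field; rewrite ?r1 ?q0 ?q0'.
Qed.

Let continuous_sqr : continuous (fun t : R => t ^+ 2 + r ^+ 2).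
Proof. by move=> t; apply: cvgD; [exact: exprn_continuous|exact: cvg_cst]. Qed.

Let sqr_gt0 (t : R) : 0 < t ^+ 2 + r ^+ 2.
Proof. by rewrite ltr_wpDl ?sqr_ge0 ?exprn_gt0. Qed.

(** The substitution t = r tan theta turns the integrand into cos^2 theta / r^3; the
    primitive below is written directly in terms of theta = arctan (t / r). *)
Lemma integral_inv_sqr2 :
  (\int[leb]_t ((t ^+ 2 + r ^+ 2) ^- 2)%:E = (pi / (2 * r ^+ 3))%R%:E)%E.
Proof.
pose F t := (2 * r ^+ 3)^-1 * (theta t + sin (theta t) * cos (theta t)).
transitivity (2 * ((2 * r ^+ 3)^-1 * (pi / 2 + 1 * 0) - F 0))%:E; last first.
  by rewrite /F theta0 sin0 mul0r !addr0 mulr0 addr0 mulr0 subr0; congr EFin; field; rewrite gt_eqF.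
apply: integral_even.
- by move=> t; rewrite invr_ge0 exprn_ge0 // ltW.
- move=> t; apply: cvgV; first by rewrite expf_neq0 // gt_eqF.
  by apply: (@continuous_comp _ _ _ (fun t : R => t ^+ 2 + r ^+ 2) (fun u : R => u ^+ 2));
    [exact: continuous_sqr|exact: exprn_continuous].
- by move=> t; rewrite sqrrN.
- move=> t _.
  have Ds := @is_derive1_comp _ sin theta t _ _ (is_derive_sin _) (is_derive_theta t).
  have Dc := @is_derive1_comp _ cos theta t _ _ (is_derive_cos _) (is_derive_theta t).
  have D := is_deriveZ (2 * r ^+ 3)^-1 (is_deriveD (is_derive_theta t) (is_derive_mul Ds Dc)).
  apply: is_derive_eq D _; rewrite /GRing.scale /=.
  set q := t ^+ 2 + r ^+ 2; have q0 : q != 0 by rewrite (gt_eqF (sqr_gt0 t)).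
  have r1 : r != 0 by rewrite gt_eqF.
  have c2 := cos_theta2 t; rewrite -/q in c2.
  have s2 : sin (theta t) ^+ 2 = 1 - r ^+ 2 * q^-1 by rewrite -c2 -(cos2Dsin2 (theta t)) addrC addKr.
  transitivity ((2 * r ^+ 3)^-1 * (r * q^-1 *
    (1 + cos (theta t) ^+ 2 - sin (theta t) ^+ 2))); first by ring.
  by rewrite c2 s2; field; rewrite r1 q0.
- apply: cvgM; first exact: cvg_cst.
  apply: cvgD => //; apply: cvgM.
    rewrite -(sin_pihalf R).
    by apply: (cvg_comp theta sin cvg_theta); exact: continuous_sin.
  rewrite -(cos_pihalf R).
  by apply: (cvg_comp theta cos cvg_theta); exact: continuous_cos.
Qed.

(** With t = r tan theta the integrand becomes cos theta / r^2. *)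
Lemma integral_inv_sqrt3 :
  (\int[leb]_t ((Num.sqrt (t ^+ 2 + r ^+ 2)) ^- 3)%:E = (2 / r ^+ 2)%R%:E)%E.
Proof.
pose F t := (r ^+ 2)^-1 * sin (theta t).
transitivity (2 * ((r ^+ 2)^-1 * 1 - F 0))%:E; last first.
  by rewrite /F theta0 sin0 mulr0 subr0 mulr1.
apply: integral_even.
- by move=> t; rewrite invr_ge0 exprn_ge0 // sqrtr_ge0.
- move=> t; apply: cvgV; first by rewrite expf_neq0 // gt_eqF // sqrtr_gt0.
  apply: (@continuous_comp _ _ _ (fun t : R => Num.sqrt (t ^+ 2 + r ^+ 2)) (fun u : R => u ^+ 3));
    last exact: exprn_continuous.
  by apply: (@continuous_comp _ _ _ (fun t : R => t ^+ 2 + r ^+ 2) Num.sqrt);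
    [exact: continuous_sqr|exact: sqrt_continuous].
- by move=> t; rewrite sqrrN.
- move=> t _.
  have Ds := @is_derive1_comp _ sin theta t _ _ (is_derive_sin _) (is_derive_theta t).
  apply: is_derive_eq (is_deriveZ (r ^+ 2)^-1 Ds) _; rewrite /GRing.scale /= cos_theta.
  have q2 : t ^+ 2 + r ^+ 2 = Num.sqrt (t ^+ 2 + r ^+ 2) ^+ 2 by rewrite sqr_sqrtr // ltW.
  rewrite [X in r * X^-1]q2.
  have : Num.sqrt (t ^+ 2 + r ^+ 2) != 0 by rewrite gt_eqF // sqrtr_gt0.
  have r1 : r != 0 by rewrite gt_eqF.
  by move: (Num.sqrt _) => c c0; field; rewrite r1 c0.
- apply: cvgM; first exact: cvg_cst.
  rewrite -(sin_pihalf R).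
  by apply: (cvg_comp theta sin cvg_theta); exact: continuous_sin.
Qed.

End Angle.

(** The mass is independent of y by reflection and is computed for y = 0 in Cartesian
    coordinates, where both iterated integrals have explicit primitives. *)
Lemma integral_log_laplacian (e : R) (y : R * R) : 0 < e ->
  (\int[mu]_x (log_laplacian e y x)%:E = (2 * pi)%R%:E)%E.
Proof.
move=> e0.
have p0 (z x : R * R) : 0 <= log_laplacian e z x.
  have q0 : 0 <= (qreg e z x)^-1 by rewrite invr_ge0 ltW // qreg_gt0.
  by rewrite /log_laplacian mulr_ge0 ?mulr_ge0 // ltW.
have mp : measurable_fun (setT : set (plane R)) (log_laplacian e 0).
  by apply: continuous_measurable_plane; exact: continuous_log_laplacian.
have -> : (\int[mu]_x (log_laplacian e y x)%:E = \int[mu]_x (log_laplacian e 0 x)%:E)%E.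
  rewrite -(@integral_reflection_plane _ y (fun x => (log_laplacian e 0 x)%:E)).
  - apply: eq_integral => x _; by rewrite /log_laplacian /qreg subr0 /sqnorm /= -(opprB y.1) -(opprB y.2) !sqrrN.
  - exact/measurable_EFinP.
  - by move=> z; rewrite lee_fin.
rewrite tonelli_plane; last 2 first.
- exact/measurable_EFinP.
- by move=> z; rewrite lee_fin.
pose r := Num.sqrt e; have r0 : 0 < r by rewrite sqrtr_gt0.
have r2 : r ^+ 2 = e by rewrite sqr_sqrtr // ltW.
have inner (s : R) : (\int[leb]_t (log_laplacian e 0 (s, t))%:E =
    (e * pi * (Num.sqrt (s ^+ 2 + r ^+ 2)) ^- 3)%:E)%E.
  pose d := Num.sqrt (s ^+ 2 + r ^+ 2).
  have q0 : 0 < s ^+ 2 + r ^+ 2 by rewrite ltr_wpDl ?sqr_ge0 ?exprn_gt0.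
  have d0 : 0 < d by rewrite sqrtr_gt0.
  have d2 : d ^+ 2 = s ^+ 2 + e by rewrite sqr_sqrtr ?r2 // -r2 ltW.
  have -> : (fun t => (log_laplacian e 0 (s, t))%:E) =
      (fun t => (2 * e * (t ^+ 2 + d ^+ 2) ^- 2)%:E).
    apply/funext => t; rewrite /log_laplacian /qreg /sqnorm /= !subr0 d2 -exprVn; congr EFin.
    by rewrite expr2; congr (_ * (_^-1 * _^-1)); ring.
  rewrite ge0_integralZl_EFin_mul.
  - rewrite (integral_inv_sqr2 d0) -EFinM -/d; congr EFin.
    by field; rewrite gt_eqF.
  - by rewrite mulr_ge0 // ltW.
  - apply: continuous_measurable_fun => t; apply: cvgV.
      by rewrite expf_neq0 // gt_eqF // ltr_wpDl ?sqr_ge0 ?exprn_gt0.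
    apply: (@continuous_comp _ _ _ (fun t : R => t ^+ 2 + d ^+ 2) (fun u : R => u ^+ 2));
      last exact: exprn_continuous.
    by apply: cvgD; [exact: exprn_continuous|exact: cvg_cst].
  - by move=> t; rewrite invr_ge0 exprn_ge0 // addr_ge0 ?sqr_ge0.
under eq_integral do rewrite inner.
rewrite ge0_integralZl_EFin_mul.
- rewrite (integral_inv_sqrt3 r0) r2 -EFinM; congr EFin.
  by field; rewrite gt_eqF.
- by rewrite mulr_ge0 ?pi_ge0 // ltW.
- apply: continuous_measurable_fun => t; apply: cvgV.
    by rewrite expf_neq0 // gt_eqF // sqrtr_gt0 ltr_wpDl ?sqr_ge0 ?exprn_gt0.
  apply: (@continuous_comp _ _ _ (fun t : R => Num.sqrt (t ^+ 2 + r ^+ 2)) (fun u : R => u ^+ 3));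
    last exact: exprn_continuous.
  apply: (@continuous_comp _ _ _ (fun t : R => t ^+ 2 + r ^+ 2) Num.sqrt); last exact: sqrt_continuous.
  by apply: cvgD; [exact: exprn_continuous|exact: cvg_cst].
- by move=> t; rewrite invr_ge0 exprn_ge0 // sqrtr_ge0.
Qed.

End LogLaplacianMass.

(** * The limit of the Green identities *)

Section GreenLimit.
Context {R : realType}.
Local Notation mu := (mu2 R).
Local Notation eps := (@harmonic R).

Let eps_gt0 n : 0 < eps n.
Proof. by rewrite /harmonic /= invr_gt0 ltr0n. Qed.

Lemma rho3_le_near z : rho z ^+ 3 <= near_kernel z + 1 :> R.
Proof.
have [z0|z0] := eqVneq (sqnorm z) 0.
  by rewrite (rho_eq0 z0) expr0n /= addr_ge0 ?near_kernel_ge0.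
have zp : 0 < sqnorm z by rewrite lt_neqAle eq_sym z0 sqnorm_ge0.
rewrite /near_kernel; case: ifPn => [z1|].
  have r1 : 1 <= rho z by apply: rho_ge1; rewrite zp.
  by rewrite ler_wpDr // ler_weXn2l.
by rewrite -ltNge add0r => /ltW /rho_le1 r1; rewrite exprn_ile1 // rho_ge0.
Qed.

(** A bounded density controls the singularity of 1/|x-y| near y, an integrable one
    controls the rest. *)
Lemma rho3_integrable (M : R) (y : R * R) (h : plane R -> R) :
  (forall x, `|h x| <= M) -> mu.-integrable setT (EFin \o h) ->
  mu.-integrable setT (EFin \o (fun x => rho (y - x) ^+ 3 * h x)).
Proof.
move=> hM ih; have mh : measurable_fun setT h by apply/measurable_EFinP; case/integrableP: ih.
have M0 : 0 <= M by exact: le_trans (hM (0, 0)).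
apply/integrableP; split.
  by apply/measurable_EFinP; apply: measurable_funM => //; exact: measurable_rho_subr.
apply: (@le_lt_trans _ _ (\int[mu]_x (M * near_kernel (y - x) + `|h x|)%:E)%E).
  apply: ge0_le_integral_EFin => /=.
  - apply: measurableT_comp => //.
    by apply: measurable_funM => //; exact: measurable_rho_subr.
  - apply: measurable_funD; last exact: measurableT_comp.
    by apply: measurable_funM => //; exact: measurable_near_kernel_sub.
  - by move=> x.
  - move=> x; rewrite normrM ger0_norm ?exprn_ge0 ?rho_ge0 //.
    have := ler_wpM2r (normr_ge0 (h x)) (rho3_le_near (y - x)).
    move=> /le_trans; apply; rewrite mulrDl mul1r lerD2r mulrC.
    by apply: ler_wpM2r => //; exact: near_kernel_ge0.
rewrite ge0_integralD_EFin; last 4 first.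
- by apply: measurable_funM => //; exact: measurable_near_kernel_sub.
- exact: measurableT_comp.
- by move=> x; apply: mulr_ge0 => //; exact: near_kernel_ge0.
- by move=> x.
rewrite ge0_integralZl_EFin_mul //; last 2 first.
- exact: measurable_near_kernel_sub.
- by move=> x; exact: near_kernel_ge0.
rewrite integral_near_kernel_sub lte_add_pinfty //.
  by apply: lte_mul_pinfty => //; exact: integral_near_kernel_lty.
by case/integrableP: ih.
Qed.

(** |a| <= sqrt s and s + e >= s; the case s = 0 forces a = 0.  Applied with a a
    coordinate of x - y and s = |x-y|^2, it bounds the kernels uniformly in e. *)
Lemma coordinate_quotient_le (a s e : R) : 0 <= e -> a ^+ 2 <= s ->
  `|a * (s + e)^-1| <= (Num.sqrt s)^-1.
Proof.
move=> e0 as_; have s0 : 0 <= s by exact: le_trans (sqr_ge0 a) as_.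
have [sE|sn0] := eqVneq s 0.
  have -> : a = 0 by apply/eqP; rewrite -sqrf_eq0 eq_le sqr_ge0 andbT -[leRHS]sE.
  by rewrite mul0r normr0 invr_ge0 sqrtr_ge0.
have sp : 0 < s by rewrite lt_neqAle eq_sym sn0.
have r0 : 0 < Num.sqrt s by rewrite sqrtr_gt0.
have se : 0 < s + e by rewrite ltr_pwDl.
(* It remains to see |a| sqrt s <= s + e. *)
have aas : `|a| <= Num.sqrt s.
  by rewrite -sqrtr_sqr ler_sqrt.
rewrite normrM [X in _ * X]gtr0_norm ?invr_gt0 //.
rewrite ler_pdivrMr // mulrC ler_pdivlMr //.
apply: (@le_trans _ _ (Num.sqrt s * Num.sqrt s)); first exact: (ler_wpM2r (ltW r0) aas).
by rewrite -expr2 sqr_sqrtr // lerDl.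
Qed.

Lemma sqnorm_subC (x y : R * R) : sqnorm (x - y) = sqnorm (y - x).
Proof. by rewrite /sqnorm /= -(opprB x.1 y.1) -(opprB x.2 y.2) !sqrrN. Qed.

Lemma u1_le (e : R) (y x : R * R) : 0 <= e -> `|u1 e y x| <= rho (y - x) ^+ 3.
Proof.
move=> e0; rewrite rho_exp3 -sqnorm_subC; apply: coordinate_quotient_le => //.
by rewrite lerDl sqr_ge0.
Qed.

Lemma u2_le (e : R) (y x : R * R) : 0 <= e -> `|u2 e y x| <= rho (y - x) ^+ 3.
Proof.
move=> e0; rewrite rho_exp3 -sqnorm_subC; apply: coordinate_quotient_le => //.
by rewrite lerDr sqr_ge0.
Qed.

Lemma cvg_u1 (y x : R * R) : u1 (eps n) y x @[n --> \oo] --> u1 0 y x.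
Proof.
have [s0|s0] := eqVneq (sqnorm (x - y)) 0.
  have E e : u1 e y x = 0.
    apply/eqP; rewrite mulf_eq0; apply/orP; left; rewrite -sqrf_eq0 eq_le sqr_ge0 andbT -[leRHS]s0.
    by rewrite lerDl sqr_ge0.
  by rewrite E; under eq_fun do rewrite E; exact: cvg_cst.
apply: cvgM; first exact: cvg_cst.
apply: cvgV; first by rewrite /qreg addr0.
by apply: cvgD; [exact: cvg_cst|exact: cvg_harmonic].
Qed.

Lemma cvg_u2 (y x : R * R) : u2 (eps n) y x @[n --> \oo] --> u2 0 y x.
Proof.
have [s0|s0] := eqVneq (sqnorm (x - y)) 0.
  have E e : u2 e y x = 0.
    apply/eqP; rewrite mulf_eq0; apply/orP; left; rewrite -sqrf_eq0 eq_le sqr_ge0 andbT -[leRHS]s0.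
    by rewrite lerDr sqr_ge0.
  by rewrite E; under eq_fun do rewrite E; exact: cvg_cst.
apply: cvgM; first exact: cvg_cst.
apply: cvgV; first by rewrite /qreg addr0.
by apply: cvgD; [exact: cvg_cst|exact: cvg_harmonic].
Qed.

Lemma measurable_u1 (e : R) (y : R * R) : 0 <= e ->
  measurable_fun (setT : set (plane R)) (u1 e y).
Proof.
move=> e0; apply: measurable_funM.
  by apply: continuous_measurable_plane; exact: continuous_sub1.
have q0 x : 0 <= qreg e y x by rewrite addr_ge0 // sqnorm_ge0.
under eq_fun do rewrite -(powR_inv1 (q0 _)).
apply: (measurableT_comp (measurable_powR (-1))).
by apply: continuous_measurable_plane; exact: continuous_qreg.
Qed.

Lemma measurable_u2 (e : R) (y : R * R) : 0 <= e ->
  measurable_fun (setT : set (plane R)) (u2 e y).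
Proof.
move=> e0; apply: measurable_funM.
  by apply: continuous_measurable_plane; exact: continuous_sub2.
have q0 x : 0 <= qreg e y x by rewrite addr_ge0 // sqnorm_ge0.
under eq_fun do rewrite -(powR_inv1 (q0 _)).
apply: (measurableT_comp (measurable_powR (-1))).
by apply: continuous_measurable_plane; exact: continuous_qreg.
Qed.

(** Dominated convergence; the dominating function is |h(x)| / |x-y|. *)
Lemma cvg_integral_kernel (y : R * R) (u : R -> R * R -> R) (M : R) (h : plane R -> R) :
  (forall e, 0 <= e -> measurable_fun (setT : set (plane R)) (u e)) ->
  (forall e x, 0 <= e -> `|u e x| <= rho (y - x) ^+ 3) ->
  (forall x, u (eps n) x @[n --> \oo] --> u 0 x) ->
  (forall x, `|h x| <= M) -> mu.-integrable setT (EFin \o h) ->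
  \int[mu]_x (u (eps n) x * h x) @[n --> \oo] --> \int[mu]_x (u 0 x * h x).
Proof.
move=> mu_ u_le cvgu hM ih.
have mh : measurable_fun setT h by apply/measurable_EFinP; case/integrableP: ih.
have iabs : mu.-integrable setT (EFin \o (fun x => rho (y - x) ^+ 3 * `|h x|)).
  apply: (@rho3_integrable M) => [x|]; first by rewrite normr_id.
  by have := integrable_abse ih.
have [] := @dominated_convergence _ _ R mu setT measurableT
  (fun n x => (u (eps n) x * h x)%:E) (fun x => (u 0 x * h x)%:E)
  (fun x => (rho (y - x) ^+ 3 * `|h x|)%:E).
- move=> n; apply/measurable_EFinP; apply: measurable_funM => //.
  by apply: mu_; exact: ltW.
- by apply/measurable_EFinP; apply: measurable_funM => //; exact: mu_.
- apply: aeW => x _; apply: cvg_EFin; first by apply: nearW.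
  by apply: cvgM; [exact: cvgu|exact: cvg_cst].
- exact: iabs.
- apply: aeW => x n _; rewrite /= lee_fin normrM.
  by apply: ler_wpM2r => //; apply: u_le; exact: ltW.
move=> i0 _ cv; rewrite /Rintegral; apply: fine_cvg; rewrite fineK //.
exact: integrable_fin_num.
Qed.

Lemma log_laplacian_ge0 (e : R) (y x : R * R) : 0 <= e -> 0 <= log_laplacian e y x.
Proof.
move=> e0; have q0 : 0 <= (qreg e y x)^-1 by rewrite invr_ge0 addr_ge0 // sqnorm_ge0.
exact: (mulr_ge0 (mulr_ge0 _ e0) (mulr_ge0 q0 q0)).
Qed.

Lemma integrable_log_laplacian (e : R) (y : R * R) : 0 < e ->
  mu.-integrable setT (EFin \o log_laplacian e y).
Proof.
move=> e0; apply/integrableP; split.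
  by apply/measurable_EFinP; apply: continuous_measurable_plane; exact: continuous_log_laplacian.
under eq_integral do rewrite gee0_abs ?lee_fin ?log_laplacian_ge0 ?(ltW e0) //.
by rewrite integral_log_laplacian // ltry.
Qed.

(** For s >= d one has (s + e)^(-1) <= (1 + 1/d) (s + 1)^(-1).  Hence the mass away from
    y is at most e times a constant times the full mass for e = 1, and tends to 0 with e
    without a second computation. *)
Lemma log_laplacian_tail_le (e d : R) (y x : R * R) : 0 < e -> 0 < d -> d <= sqnorm (x - y) ->
  log_laplacian e y x <= e * (1 + d^-1) ^+ 2 * log_laplacian 1 y x.
Proof.
move=> e0 d0 ds; rewrite /log_laplacian /qreg; have s0 : 0 < sqnorm (x - y) by exact: lt_le_trans ds.
move: (sqnorm (x - y)) ds s0 => s ds s0.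
have h : (s + e)^-1 <= (1 + d^-1) * (s + 1)^-1.
  rewrite ler_pdivlMr ?addr_gt0 // mulrC ler_pdivrMr ?addr_gt0 //.
  have : 1 <= d^-1 * s by rewrite mulrC ler_pdivlMr // mul1r.
  have d1 : 0 < d^-1 by rewrite invr_gt0.
  nra.
have h0 : 0 <= (s + e)^-1 by rewrite invr_ge0 addr_ge0 // ltW.
have h2 := ler_pM h0 h0 h h.
have e2 : 0 <= 2 * e by rewrite mulr_ge0 // ltW.
apply: (le_trans (ler_wpM2l e2 h2)).
by rewrite le_eqVlt; apply/orP; left; apply/eqP; ring.
Qed.

(** An approximate identity: the kernel is nonnegative of constant mass 2 pi.  Near y
    the oscillation of chi is small by continuity; away from y the kernel has mass O(e). *)
Lemma cvg_integral_log_laplacian (A : R) (chi : R * R -> R) (y : R * R) :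
  continuous chi -> off_box A chi ->
  \int[mu]_x (log_laplacian (eps n) y x * chi x) @[n --> \oo] --> 2 * pi * chi y.
Proof.
move=> cchi chiA; have [M M0 chiM] := continuous_off_box_bounded cchi chiA.
apply/cvgrPdist_le => eta eta0.
pose K : R := 2 * pi; have K0 : 0 < K by rewrite mulr_gt0 // pi_gt0.
have hK0 : 0 < eta / (2 * K) by rewrite divr_gt0 // mulr_gt0.
have /cvgrPdist_le/(_ _ hK0) := cchi y.
move=> /nbhs_ballP[r /= r0 rP].
pose d := r ^+ 2; have d0 : 0 < d by rewrite exprn_gt0.
have near_le x : sqnorm (x - y) < d -> `|chi y - chi x| <= eta / (2 * K).
  move=> xd; apply: rP; have h (a b : R) : a ^+ 2 + b ^+ 2 < d -> `|a| < r.
    move=> abd; rewrite -(@ltr_pXn2r _ 2) ?nnegrE ?(ltW r0) // real_normK ?num_real //.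
    by apply: le_lt_trans abd; rewrite lerDl sqr_ge0.
  split; rewrite /ball /= distrC; first exact: (h _ _ xd).
  by apply: (h _ (x.1 - y.1)); rewrite addrC.
pose C := 2 * M * (1 + d^-1) ^+ 2.
have C0 : 0 <= C by exact: (mulr_ge0 (mulr_ge0 (ler0n _ _) M0) (sqr_ge0 _)).
have ipE e : 0 < e -> \int[mu]_x log_laplacian e y x = K.
  by move=> e0; rewrite /Rintegral integral_log_laplacian.
(* The first term is the contribution of |x-y|^2 < d, the second that of the rest. *)
have est n : `|K * chi y - \int[mu]_x (log_laplacian (eps n) y x * chi x)| <=
    eta / 2 + C * K * eps n.
  have en := eps_gt0 n.
  have ip := integrable_log_laplacian y en.
  have ipc : mu.-integrable setT (EFin \o (fun x => log_laplacian (eps n) y x * chi x)).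
    apply: (@continuous_off_box_integrable _ A); last exact: off_boxM.
    by apply: continuousM_plane => //; exact: continuous_log_laplacian.
  have ipy : mu.-integrable setT (EFin \o (fun x => log_laplacian (eps n) y x * chi y)).
    by have := integrableZr measurableT (chi y) ip.
  rewrite -{1}(ipE _ en) -RintegralZr // -RintegralB //.
  have ipB : mu.-integrable setT
      (EFin \o (fun x => log_laplacian (eps n) y x * chi y - log_laplacian (eps n) y x * chi x)).
    by have := integrableB measurableT ipy ipc.
  apply: (le_trans (le_normr_Rintegral measurableT ipB)).
  have i1 : mu.-integrable setT (EFin \o (fun x => eta / (2 * K) * log_laplacian (eps n) y x)).
    by have := integrableZl measurableT (eta / (2 * K)) ip.
  have i2 : mu.-integrable setT (EFin \o (fun x => C * eps n * log_laplacian 1 y x)).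
    by have := integrableZl measurableT (C * eps n) (integrable_log_laplacian y ltr01).
  apply: (@le_trans _ _ (\int[mu]_x (eta / (2 * K) * log_laplacian (eps n) y x + C * eps n * log_laplacian 1 y x))).
    apply: le_Rintegral => //.
    - by have := integrable_abse ipB.
    - by have := integrableD measurableT i1 i2.
    move=> x _; rewrite -mulrBr normrM ger0_norm ?log_laplacian_ge0 ?(ltW en) //.
    have p1 : 0 <= log_laplacian 1 y x by apply: log_laplacian_ge0.
    have pn : 0 <= log_laplacian (eps n) y x by apply: log_laplacian_ge0; exact: ltW.
    have [xd|xd] := ltP (sqnorm (x - y)) d.
      rewrite mulrC -[leLHS]addr0; apply: lerD; first by apply: ler_wpM2r => //; exact: near_le.
      by rewrite mulr_ge0 // mulr_ge0 // ltW.
    rewrite -[leLHS]add0r; apply: lerD; first by rewrite mulr_ge0 // ltW.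
    have m2 : `|chi y - chi x| <= 2 * M.
      by rewrite (le_trans (ler_normB _ _)) // mulr2n mulrDl mul1r lerD.
    apply: (le_trans (ler_pM pn (normr_ge0 _) (log_laplacian_tail_le en d0 xd) m2)).
    by rewrite le_eqVlt; apply/orP; left; apply/eqP; rewrite /C; ring.
  rewrite (RintegralD measurableT i1 i2) (RintegralZl _ measurableT ip).
  rewrite (RintegralZl _ measurableT (integrable_log_laplacian y ltr01)) !ipE //.
  rewrite le_eqVlt; apply/orP; left; apply/eqP; field.
  by rewrite gt_eqF.
have cv : eta / 2 + C * K * eps n @[n --> \oo] --> eta / 2 + C * K * 0.
  apply: cvgD; first exact: cvg_cst.
  by apply: cvgM; [exact: cvg_cst|exact: cvg_harmonic].
rewrite mulr0 addr0 in cv.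
have lt2 : eta / 2 < eta by rewrite ltr_pdivrMr // mulr2n mulrDr mulr1 ltrDl.
near=> n; apply: (le_trans (est n)); apply: ltW.
by near: n; exact: (cvgr_lt _ cv _ lt2).
Unshelve. all: by end_near.
Qed.

Lemma green_divergence_limit (A : R) (chi d1 d2 : R * R -> R) (y : R * R) :
  C1_off_box A chi d1 d2 ->
  \int[mu]_x (u1 0 y x * d1 x) + \int[mu]_x (u2 0 y x * d2 x) = - (2 * pi * chi y).
Proof.
move=> C1; have [M1 _ h1] := continuous_off_box_bounded (C1_continuous1 C1) (C1_off1 C1).
have [M2 _ h2] := continuous_off_box_bounded (C1_continuous2 C1) (C1_off2 C1).
have i1 := continuous_off_box_integrable (C1_continuous1 C1) (C1_off1 C1).
have i2 := continuous_off_box_integrable (C1_continuous2 C1) (C1_off2 C1).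
have c1 := cvg_integral_kernel (fun e => @measurable_u1 e y) (fun e x => @u1_le e y x) (@cvg_u1 y) h1 i1.
have c2 := cvg_integral_kernel (fun e => @measurable_u2 e y) (fun e x => @u2_le e y x) (@cvg_u2 y) h2 i2.
have c3 := cvgN (cvg_integral_log_laplacian (y := y) (C1_continuous C1) (C1_off C1)).
have c12 := cvgD c1 c2.
rewrite -(cvg_lim (@Rhausdorff R) (c12 _)) -(cvg_lim (@Rhausdorff R) (c3 _)).
congr (lim (_ @ \oo)); apply/funext => n.
exact: (green_divergence C1 y (eps_gt0 n)).
Qed.

Lemma green_curl_limit (A : R) (chi d1 d2 : R * R -> R) (y : R * R) :
  C1_off_box A chi d1 d2 ->
  \int[mu]_x (u2 0 y x * d1 x) = \int[mu]_x (u1 0 y x * d2 x).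
Proof.
move=> C1; have [M1 _ h1] := continuous_off_box_bounded (C1_continuous1 C1) (C1_off1 C1).
have [M2 _ h2] := continuous_off_box_bounded (C1_continuous2 C1) (C1_off2 C1).
have i1 := continuous_off_box_integrable (C1_continuous1 C1) (C1_off1 C1).
have i2 := continuous_off_box_integrable (C1_continuous2 C1) (C1_off2 C1).
have c1 := cvg_integral_kernel (fun e => @measurable_u2 e y) (fun e x => @u2_le e y x) (@cvg_u2 y) h1 i1.
have c2 := cvg_integral_kernel (fun e => @measurable_u1 e y) (fun e x => @u1_le e y x) (@cvg_u1 y) h2 i2.
rewrite -(cvg_lim (@Rhausdorff R) c1) -(cvg_lim (@Rhausdorff R) c2).
congr (lim (_ @ \oo)); apply/funext => n.
exact: (green_curl C1 y (eps_gt0 n)).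
Qed.

End GreenLimit.

(** * Fubini's theorem for the potentials *)

Section Potentials.
Context {R : realType}.
Local Notation mu := (mu2 R).

Lemma EFin_Rintegral (f : plane R -> R) : mu.-integrable setT (EFin \o f) ->
  (\int[mu]_x f x)%:E = (\int[mu]_x (f x)%:E)%E.
Proof. by move=> fi; rewrite fineK //; exact: integrable_fin_num. Qed.

Lemma abs_Rintegral_le (f : plane R -> R) : measurable_fun setT f ->
  (`|\int[mu]_x f x|%:E <= \int[mu]_x `|f x|%:E)%E.
Proof.
move=> mf; have [fi|] := boolP (mu.-integrable setT (EFin \o f)).
  rewrite EFin_normr_Rintegral //; apply: le_abse_integral => //; exact/measurable_EFinP.
move=> nfi; rewrite (_ : (\int[mu]_x `|f x|%:E)%E = +oo%E) ?leey //.
apply/eqP; rewrite -leye_eq leNgt; apply: contra nfi => lty.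
by apply/integrableP; split=> //; exact/measurable_EFinP.
Qed.

(** For a real integral, whose value is 0 by convention when the integrand is not
    integrable, measurability in the parameter comes from the positive and negative parts,
    each of which falls under Tonelli's theorem. *)
Lemma measurable_Rintegral_param (k : plane R * plane R -> R) :
  measurable_fun setT k -> measurable_fun setT (fun x => \int[mu]_y k (x, y)).
Proof.
move=> mk; apply: (measurableT_comp (@fine_measurable R setT measurableT)).
have mp : measurable_fun setT (EFin \o k) by exact/measurable_EFinP.
pose kp (p : plane R * plane R) := Num.max (k p) 0.
pose kn (p : plane R * plane R) := Num.max (- k p) 0.
have mkp : measurable_fun setT kp by exact: measurable_maxr.
have mkn : measurable_fun setT kn.
  by apply: measurable_maxr => //; exact: measurableT_comp.
have E : (fun x => \int[mu]_y (k (x, y))%:E)%E =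
   (fun x => \int[mu]_y (kp (x, y))%:E - \int[mu]_y (kn (x, y))%:E)%E.
  apply/funext => x; rewrite integralE; congr (_ - _)%E; apply: eq_integral => y _.
    by rewrite funeposE /kp EFin_max.
  by rewrite funenegE /kn EFin_max EFinN.
rewrite E; apply: emeasurable_funB.
  by apply: measurable_partial_integral => // p; rewrite le_max lexx orbT.
by apply: measurable_partial_integral => // p; rewrite le_max lexx orbT.
Qed.

Lemma measurable_u1_joint : measurable_fun (setT : set (plane R * plane R)) (fun p => u1 0 p.2 p.1).
Proof.
have q0 (p : plane R * plane R) : 0 <= qreg 0 p.2 p.1 by rewrite addr_ge0 // sqnorm_ge0.
under eq_fun do rewrite /u1 -(powR_inv1 (q0 _)).
apply: measurable_funM.
  exact: (measurableT_comp measurable_fst measurable_sub_plane).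
apply: (measurableT_comp (measurable_powR (-1))); apply: measurable_funD => //.
exact: (measurableT_comp measurable_sqnorm measurable_sub_plane).
Qed.

Lemma measurable_u2_joint : measurable_fun (setT : set (plane R * plane R)) (fun p => u2 0 p.2 p.1).
Proof.
have q0 (p : plane R * plane R) : 0 <= qreg 0 p.2 p.1 by rewrite addr_ge0 // sqnorm_ge0.
under eq_fun do rewrite /u2 -(powR_inv1 (q0 _)).
apply: measurable_funM.
  exact: (measurableT_comp measurable_snd measurable_sub_plane).
apply: (measurableT_comp (measurable_powR (-1))); apply: measurable_funD => //.
exact: (measurableT_comp measurable_sqnorm measurable_sub_plane).
Qed.

(** The densities h for which the potential is a bounded function: boundedness takes
    care of the singularity of the kernel and integrability of infinity. *)
Definition bounded_integrable (h : plane R -> R) : Prop :=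
  (exists M : R, forall x, `|h x| <= M) /\ mu.-integrable setT (EFin \o h).

Lemma bounded_integrable_measurable h : bounded_integrable h -> measurable_fun setT h.
Proof. by case=> _ /integrableP[/measurable_EFinP]. Qed.

(** 1/|z| <= near_kernel z + 1. *)
Lemma riesz_le_bounded_integrable h : bounded_integrable h ->
  exists C : R, forall x, (riesz (fun y => `|h y|%R) x <= C%:E)%E.
Proof.
move=> hb; have mh := bounded_integrable_measurable hb; case: hb => -[M hM] ih.
have M0 : 0 <= M by exact: le_trans (hM (0, 0)).
set N := (\int[mu]_y (near_kernel y)%:E)%E.
have N0 : (0 <= N)%E by apply: integral_ge0 => y _; rewrite lee_fin near_kernel_ge0.
have Nf : N \is a fin_num by rewrite ge0_fin_numE // integral_near_kernel_lty.
set H := (\int[mu]_y `|h y|%:E)%E.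
have H0 : (0 <= H)%E by apply: integral_ge0.
have Hf : H \is a fin_num by rewrite ge0_fin_numE //; case/integrableP: ih.
exists (M * fine N + fine H) => x.
rewrite EFinD EFinM !fineK // /N -(integral_near_kernel_sub x).
have mN := measurable_near_kernel_sub x.
have n0 y : 0 <= near_kernel (x - y) by exact: near_kernel_ge0.
have mah : measurable_fun setT (fun y => `|h y|) by exact: measurableT_comp.
have mMN : measurable_fun (setT : set (plane R)) (fun y => M * near_kernel (x - y)).
  exact: measurable_funM.
rewrite -(ge0_integralZl_EFin_mul _ M0 mN n0) -(ge0_integralD_EFin _ mMN mah) //; last first.
  by move=> y; exact: mulr_ge0.
apply: ge0_le_integral_EFin => [||y|y].
- by apply: measurable_funM => //; exact: measurable_rho_subr.
- exact: measurable_funD.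
- by rewrite mulr_ge0 // exprn_ge0 ?rho_ge0.
- have := ler_wpM2r (normr_ge0 (h y)) (rho3_le_near (x - y)).
  move=> /le_trans; apply; rewrite mulrDl mul1r lerD2r mulrC.
  by apply: ler_wpM2r.
Qed.

Section Kernel.
Variable u : R * R -> R * R -> R.
Hypothesis mu_u : measurable_fun (setT : set (plane R * plane R)) (fun p => u p.2 p.1).
Hypothesis u_le : forall y x, `|u y x| <= rho (y - x) ^+ 3.

Definition potential (h : plane R -> R) (x : plane R) : R := \int[mu]_y (u y x * h y).

Lemma measurable_u_l x : measurable_fun (setT : set (plane R)) (fun y => u y x).
Proof. exact: (measurableT_comp mu_u (measurable_pair1 x)). Qed.

Lemma measurable_u_r y : measurable_fun (setT : set (plane R)) (u y).
Proof. exact: (measurableT_comp mu_u (measurable_pair2 y)). Qed.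

Lemma measurable_potential h : measurable_fun setT h -> measurable_fun setT (potential h).
Proof.
move=> mh; apply: (measurable_Rintegral_param (k := fun p => u p.2 p.1 * h p.2)).
by apply: measurable_funM => //; exact: (measurableT_comp mh).
Qed.

Lemma potential_le h x : measurable_fun setT h ->
  (`|potential h x|%:E <= riesz (fun y => `|h y|%R) x)%E.
Proof.
move=> mh; have mul := measurable_u_l x.
apply: (le_trans (abs_Rintegral_le _)); first exact: measurable_funM.
apply: ge0_le_integral_EFin => [||y|y] //.
- by apply: measurableT_comp => //; exact: measurable_funM.
- apply: measurable_funM; first exact: measurable_rho_subr.
  exact: measurableT_comp.
- by rewrite normrM ler_wpM2r // rhoC.
Qed.

Lemma potential_integrable h x : bounded_integrable h ->
  mu.-integrable setT (EFin \o (fun y => u y x * h y)).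
Proof.
move=> hb; have mh := bounded_integrable_measurable hb.
have [C hC] := riesz_le_bounded_integrable hb.
apply/integrableP; split.
  by apply/measurable_EFinP; apply: measurable_funM => //; exact: measurable_u_l.
apply: (@le_lt_trans _ _ C%:E); last exact: ltry.
apply: le_trans (hC x); apply: ge0_le_integral_EFin => [||y|y] //=.
- by apply: measurableT_comp => //; apply: measurable_funM => //; exact: measurable_u_l.
- apply: measurable_funM; first exact: measurable_rho_subr.
  exact: measurableT_comp.
- by rewrite normrM ler_wpM2r // rhoC.
Qed.

Lemma integrable_potentialM h d : bounded_integrable h -> mu.-integrable setT (EFin \o d) ->
  mu.-integrable setT (EFin \o (fun x => potential h x * d x)).
Proof.
move=> hb id; have mh := bounded_integrable_measurable hb.
have [C hC] := riesz_le_bounded_integrable hb.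
have md : measurable_fun setT d by apply/measurable_EFinP; case/integrableP: id.
apply: (@le_integrable _ _ _ mu setT measurableT _ (EFin \o (fun x => C * d x))).
- by apply/measurable_EFinP; apply: measurable_funM => //; exact: measurable_potential.
- move=> x _; rewrite /= lee_fin !normrM ler_wpM2r //.
  have := le_trans (potential_le x mh) (hC x); rewrite lee_fin => /le_trans; apply.
  exact: ler_norm.
- by have := integrableZl measurableT C id.
Qed.

(** Absolute convergence of the double integral: integrating |u(y,x) h(y)| in y first
    leaves a bounded function times the integrable d. *)
Lemma fubini_potential h d : bounded_integrable h -> bounded_integrable d ->
  \int[mu]_x (potential h x * d x) = \int[mu]_y (h y * \int[mu]_x (u y x * d x)).
Proof.
move=> hb db; have mh := bounded_integrable_measurable hb.
have md := bounded_integrable_measurable db.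
have [C hC] := riesz_le_bounded_integrable hb.
pose F (p : plane R * plane R) := (u p.2 p.1 * h p.2 * d p.1)%:E.
have mF : measurable_fun setT F.
  apply/measurable_EFinP; apply: measurable_funM; last exact: (measurableT_comp md).
  by apply: measurable_funM => //; exact: (measurableT_comp mh).
have iu y : mu.-integrable setT (EFin \o (fun x => u y x * d x)).
  have mud : measurable_fun (setT : set (plane R)) (fun x => u y x * d x).
    by apply: measurable_funM => //; exact: measurable_u_r.
  have [D dD] := riesz_le_bounded_integrable db.
  apply/integrableP; split; first exact/measurable_EFinP.
  apply: (@le_lt_trans _ _ D%:E); last exact: ltry.
  apply: le_trans (dD y); apply: ge0_le_integral_EFin => [||x|x] //=.
  - exact: measurableT_comp.
  - apply: measurable_funM; first exact: measurable_rho_subr.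
    exact: measurableT_comp.
  - by rewrite normrM ler_wpM2r.
have iF : (@area R \x @area R)%E.-integrable setT F.
  apply/(@integrable12ltyP _ _ _ _ R (@area R) (@area R) F mF).
  apply: (@le_lt_trans _ _ (\int[mu]_x (C * `|d x|)%:E)%E).
    apply: ge0_le_integral => //.
    - by move=> x _; apply: integral_ge0.
    - apply: (measurable_partial_integral (f := fun p => `|u p.2 p.1 * h p.2 * d p.1|)) => //.
      by apply: measurableT_comp => //; exact/measurable_EFinP.
    - by apply/measurable_EFinP; apply: measurable_funM => //; exact: measurableT_comp.
    move=> x _; rewrite /F /=.
    have -> : (\int[area]_y `|u y x * h y * d x|%:E =
               `|d x|%:E * \int[mu]_y `|u y x * h y|%:E)%E.
      rewrite -ge0_integralZl_EFin_mul //.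
        by apply: eq_integral => y _; rewrite normrM mulrC.
      apply: measurableT_comp => //; apply: measurable_funM => //; exact: measurable_u_l.
    rewrite muleC EFinM; apply: lee_wpmul2r; first by rewrite lee_fin.
    apply: le_trans (hC x); apply: ge0_le_integral_EFin => [||y|y] //=.
    - by apply: measurableT_comp => //; apply: measurable_funM => //; exact: measurable_u_l.
    - apply: measurable_funM; first exact: measurable_rho_subr.
      exact: measurableT_comp.
    - by rewrite normrM ler_wpM2r // rhoC.
  have C0 : 0 <= C by rewrite -lee_fin; apply: le_trans (hC (0, 0)); exact: riesz_ge0.
  rewrite ge0_integralZl_EFin_mul //; last exact: measurableT_comp.
  apply: lte_mul_pinfty => //.
  by case: db => _ /integrableP[].
have FE := @Fubini _ _ _ _ R (@area R) (@area R) F iF.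
rewrite /Rintegral; congr fine.
transitivity (\int[area]_x \int[area]_y F (x, y))%E.
  apply: eq_integral => x _; rewrite -[in LHS]mulrC.
  rewrite -RintegralZl //; last exact: potential_integrable.
  rewrite EFin_Rintegral.
    by apply: eq_integral => y _; rewrite mulrC.
  by have := integrableZl measurableT (d x) (potential_integrable x hb).
rewrite FE; apply: eq_integral => y _; rewrite -RintegralZl // EFin_Rintegral.
  by apply: eq_integral => x _; rewrite /F /=; congr EFin; ring.
by have := integrableZl measurableT (h y) (iu y).
Qed.

End Kernel.

Lemma C1_bounded_integrable1 A chi d1 d2 : C1_off_box A chi d1 d2 -> bounded_integrable d1.
Proof.
move=> C1; split; last exact: continuous_off_box_integrable (C1_continuous1 C1) (C1_off1 C1).
by have [M _ h] := continuous_off_box_bounded (C1_continuous1 C1) (C1_off1 C1); exists M.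
Qed.

Lemma C1_bounded_integrable2 A chi d1 d2 : C1_off_box A chi d1 d2 -> bounded_integrable d2.
Proof.
move=> C1; split; last exact: continuous_off_box_integrable (C1_continuous2 C1) (C1_off2 C1).
by have [M _ h] := continuous_off_box_bounded (C1_continuous2 C1) (C1_off2 C1); exists M.
Qed.

Lemma u1_le0 (y x : R * R) : `|u1 0 y x| <= rho (y - x) ^+ 3.
Proof. exact: u1_le. Qed.

Lemma u2_le0 (y x : R * R) : `|u2 0 y x| <= rho (y - x) ^+ 3.
Proof. exact: u2_le. Qed.

Lemma integrable_mul_bounded (h k : plane R -> R) : bounded_integrable h ->
  mu.-integrable setT (EFin \o k) -> mu.-integrable setT (EFin \o (fun x => h x * k x)).
Proof.
move=> hb ik; have mh := bounded_integrable_measurable hb; case: hb => -[M hM] ih.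
apply: (@le_integrable _ _ _ mu setT measurableT _ (EFin \o (fun x => M * k x))).
- apply/measurable_EFinP; apply: measurable_funM => //.
  by apply/measurable_EFinP; case/integrableP: ik.
- move=> x _; rewrite /= lee_fin !normrM ler_wpM2r //.
  exact: (le_trans (hM x) (ler_norm M)).
- by have := integrableZl measurableT M ik.
Qed.

(** For an odd kernel the inner integral is, up to sign, the potential of d, hence
    bounded. *)
Lemma integrable_mul_transpose (u : R * R -> R * R -> R) h d :
  measurable_fun (setT : set (plane R * plane R)) (fun p => u p.2 p.1) ->
  (forall y x, `|u y x| <= rho (y - x) ^+ 3) -> (forall y x, u y x = - u x y) ->
  bounded_integrable d -> mu.-integrable setT (EFin \o h) ->
  mu.-integrable setT (EFin \o (fun y => h y * \int[mu]_x (u y x * d x))).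
Proof.
move=> mu_u u_le uN db ih.
have E y : h y * \int[mu]_x (u y x * d x) = -1 * (potential u d y * h y).
  have -> : \int[mu]_x (u y x * d x) = -1 * potential u d y.
    rewrite -RintegralZl //; last exact: potential_integrable.
    by apply: eq_Rintegral => x _; rewrite (uN y) mulN1r mulNr.
  by ring.
under eq_fun do rewrite /= E.
by have := integrableZl measurableT (-1) (integrable_potentialM mu_u u_le db ih).
Qed.

(** Exchange the integrals and apply the Green identity with pole y inside. *)
Lemma potential_divergence A chi d1 d2 h :
  C1_off_box A chi d1 d2 -> bounded_integrable h ->
  \int[mu]_x (potential (u1 0) h x * d1 x) + \int[mu]_x (potential (u2 0) h x * d2 x) =
  - (2 * pi * \int[mu]_x (h x * chi x)).
Proof.
move=> C1 hb; have b1 := C1_bounded_integrable1 C1; have b2 := C1_bounded_integrable2 C1.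
rewrite (fubini_potential measurable_u1_joint u1_le0 hb b1).
rewrite (fubini_potential measurable_u2_joint u2_le0 hb b2).
have ih : mu.-integrable setT (EFin \o h) by case: hb.
have i1 : mu.-integrable setT (EFin \o (fun y => h y * \int[mu]_x (u1 0 y x * d1 x))).
  apply: (integrable_mul_transpose measurable_u1_joint u1_le0) => // y x.
  by rewrite /u1 /qreg sqnorm_subC -opprB mulNr.
have i2 : mu.-integrable setT (EFin \o (fun y => h y * \int[mu]_x (u2 0 y x * d2 x))).
  apply: (integrable_mul_transpose measurable_u2_joint u2_le0) => // y x.
  by rewrite /u2 /qreg sqnorm_subC -opprB mulNr.
rewrite -RintegralD // -mulNr -RintegralZl //; last first.
  apply: integrable_mul_bounded => //.
  exact: continuous_off_box_integrable (C1_continuous C1) (C1_off C1).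
apply: eq_Rintegral => y _; rewrite -mulrDr (green_divergence_limit y C1).
by ring.
Qed.

Lemma potential_curl A chi d1 d2 h :
  C1_off_box A chi d1 d2 -> bounded_integrable h ->
  \int[mu]_x (potential (u2 0) h x * d1 x) = \int[mu]_x (potential (u1 0) h x * d2 x).
Proof.
move=> C1 hb; have b1 := C1_bounded_integrable1 C1; have b2 := C1_bounded_integrable2 C1.
rewrite (fubini_potential measurable_u2_joint u2_le0 hb b1).
rewrite (fubini_potential measurable_u1_joint u1_le0 hb b2).
by apply: eq_Rintegral => y _; rewrite (green_curl_limit y C1).
Qed.

End Potentials.

(** * The Dirac kernel in real components *)

Section ComplexEntries.
Context {R : realType}.
Implicit Types (a b : R[i]).

Lemma ReM a b : complex.Re (a * b) = complex.Re a * complex.Re b - complex.Im a * complex.Im b.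
Proof. by case: a; case: b. Qed.

Lemma ImM a b : complex.Im (a * b) = complex.Re a * complex.Im b + complex.Im a * complex.Re b.
Proof. by case: a; case: b. Qed.

Lemma ReD a b : complex.Re (a + b) = complex.Re a + complex.Re b.
Proof. by case: a; case: b. Qed.

Lemma ImD a b : complex.Im (a + b) = complex.Im a + complex.Im b.
Proof. by case: a; case: b. Qed.

Lemma ReN a : complex.Re (- a) = - complex.Re a.
Proof. by case: a. Qed.

Lemma ImN a : complex.Im (- a) = - complex.Im a.
Proof. by case: a. Qed.

Lemma ord2P (i : 'I_2) : i = ord0 \/ i = ord_max.
Proof. by case: i => [[|[|//]] p]; [left|right]; exact: val_inj. Qed.

Lemma sum_ord2 (V : nmodType) (F : 'I_2 -> V) : \sum_(i < 2) F i = F ord0 + F ord_max.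
Proof.
rewrite big_ord_recl big_ord_recl big_ord0 addr0; congr (_ + F _); exact: val_inj.
Qed.

Lemma real_complexV (r : R) : (r%:C)^-1 = (r^-1)%:C :> R[i].
Proof. by rewrite (fmorphV (real_complex R)). Qed.

Local Notation c := ((2 * pi)^-1 : R).

Lemma G00_kernelE0 x y (w : 'cV[R[i]]_2) : (G00_kernel x y *m w) ord0 0 =
  (c * (u2 0 y x * complex.Re (w ord_max 0) - u1 0 y x * complex.Im (w ord_max 0))) +i*
  (c * (u1 0 y x * complex.Re (w ord_max 0) + u2 0 y x * complex.Im (w ord_max 0))).
Proof.
rewrite mxE sum_ord2 /G00_kernel !mxE !summxE !sum_ord2 !mxE /= real_complexV.
rewrite /u1 /u2 /qreg addr0 invfM /coor /=.
move: (x.1 - y.1) (x.2 - y.2) (sqnorm _)^-1 (2 * pi)^-1 => p q s t.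
case: (w ord0 0) (w ord_max 0) => a b [a' b'] /=.
by apply/eqP; rewrite eq_complex /=; apply/andP; split; apply/eqP; ring.
Qed.

Lemma G00_kernelE1 x y (w : 'cV[R[i]]_2) : (G00_kernel x y *m w) ord_max 0 =
  (c * (- (u2 0 y x * complex.Re (w ord0 0)) - u1 0 y x * complex.Im (w ord0 0))) +i*
  (c * (u1 0 y x * complex.Re (w ord0 0) - u2 0 y x * complex.Im (w ord0 0))).
Proof.
rewrite mxE sum_ord2 /G00_kernel !mxE !summxE !sum_ord2 !mxE /= real_complexV.
rewrite /u1 /u2 /qreg addr0 invfM /coor /=.
move: (x.1 - y.1) (x.2 - y.2) (sqnorm _)^-1 (2 * pi)^-1 => p q s t.
case: (w ord0 0) (w ord_max 0) => a b [a' b'] /=.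
by apply/eqP; rewrite eq_complex /=; apply/andP; split; apply/eqP; ring.
Qed.

Definition l1norm (w : 'cV[R[i]]_2) : R :=
  (`|complex.Re (w ord0 0)| + `|complex.Im (w ord0 0)|) +
  (`|complex.Re (w ord_max 0)| + `|complex.Im (w ord_max 0)|).

Lemma l1norm_ge0 w : 0 <= l1norm w.
Proof. by rewrite /l1norm !addr_ge0. Qed.

Lemma inv_2pi_bounds : 0 <= c <= 1.
Proof.
have p2 : 2 <= pi :> R by exact: pi_ge2.
have p0 : 0 < 2 * pi :> R by lra.
by rewrite invr_ge0 ltW //= invf_le1 //; lra.
Qed.

Lemma kernel_term_le (s t a b r : R) : `|s| <= r -> `|t| <= r ->
  `|c * (s * a + t * b)| <= r * (`|a| + `|b|).
Proof.
move=> sr tr; have /andP[c0 c1] := inv_2pi_bounds.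
have r0 : 0 <= r by exact: le_trans sr.
rewrite normrM (ger0_norm c0) -[leRHS]mul1r; apply: ler_pM => //.
rewrite mulrDr (le_trans (ler_normD _ _)) // !normrM lerD // ler_wpM2r //.
Qed.

(** Every entry of alpha.(x-y) has modulus at most |x-y|, and 1/(2 pi) <= 1. *)
Lemma G00_kernel_le x y (w : 'cV[R[i]]_2) i :
  `|complex.Re ((G00_kernel x y *m w) i 0)| <= rho (x - y) ^+ 3 * l1norm w /\
  `|complex.Im ((G00_kernel x y *m w) i 0)| <= rho (x - y) ^+ 3 * l1norm w.
Proof.
have h1 : `|u1 0 y x| <= rho (x - y) ^+ 3 by rewrite rhoC; exact: u1_le0.
have h2 : `|u2 0 y x| <= rho (x - y) ^+ 3 by rewrite rhoC; exact: u2_le0.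
have h1N : `|- u1 0 y x| <= rho (x - y) ^+ 3 by rewrite normrN.
have h2N : `|- u2 0 y x| <= rho (x - y) ^+ 3 by rewrite normrN.
have r0 : 0 <= rho (x - y) ^+ 3 by exact: le_trans h1.
have l0 : rho (x - y) ^+ 3 * (`|complex.Re (w ord0 0)| + `|complex.Im (w ord0 0)|) <=
    rho (x - y) ^+ 3 * l1norm w by rewrite ler_wpM2l // lerDl addr_ge0.
have l1 : rho (x - y) ^+ 3 * (`|complex.Re (w ord_max 0)| + `|complex.Im (w ord_max 0)|) <=
    rho (x - y) ^+ 3 * l1norm w by rewrite ler_wpM2l // lerDr addr_ge0.
have [->|->] := ord2P i; rewrite ?G00_kernelE0 ?G00_kernelE1 /=; split.
- apply: (le_trans _ l1); rewrite -mulNr; exact: kernel_term_le.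
- by apply: (le_trans _ l1); exact: kernel_term_le.
- by apply: (le_trans _ l0); rewrite -[X in X - _]mulNr -[X in _ + X]mulNr; exact: kernel_term_le.
- by apply: (le_trans _ l0); rewrite -mulNr; exact: kernel_term_le.
Qed.

Section Potential.
Variable f : plane R -> 'cV[R[i]]_2.
Hypothesis mf : mx_measurable f.

Let mRe i : measurable_fun setT (fun y => complex.Re (f y i 0)) := (mf i 0).1.
Let mIm i : measurable_fun setT (fun y => complex.Im (f y i 0)) := (mf i 0).2.

Let mRe2 i : measurable_fun (setT : set (plane R * plane R)) (fun p => complex.Re (f p.2 i 0)).
Proof. exact: (measurableT_comp (mRe i)). Qed.
Let mIm2 i : measurable_fun (setT : set (plane R * plane R)) (fun p => complex.Im (f p.2 i 0)).
Proof. exact: (measurableT_comp (mIm i)). Qed.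

Lemma measurable_l1norm : measurable_fun setT (fun y => l1norm (f y)).
Proof.
by apply: measurable_funD; apply: measurable_funD;
   apply: (measurableT_comp (@normr_measurable R setT)).
Qed.

Lemma measurable_kernel_apply i :
  measurable_fun (setT : set (plane R * plane R))
    (fun p => complex.Re ((G00_kernel p.1 p.2 *m f p.2) i 0)) /\
  measurable_fun (setT : set (plane R * plane R))
    (fun p => complex.Im ((G00_kernel p.1 p.2 *m f p.2) i 0)).
Proof.
have m1 := measurable_u1_joint (R := R); have m2 := measurable_u2_joint (R := R).
have mc : measurable_fun (setT : set (plane R * plane R)) (fun=> c) by exact: measurable_cst.
have mN (g : plane R * plane R -> R) : measurable_fun setT g -> measurable_fun setT (fun p => - g p).
  by move=> mg; exact: (measurableT_comp (@oppr_measurable R setT) mg).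
have [->|->] := ord2P i.
  under eq_fun do rewrite G00_kernelE0 /=.
  under [X in _ /\ measurable_fun _ X]eq_fun do rewrite G00_kernelE0 /=.
  split; apply: measurable_funM => //.
    by apply: measurable_funB; apply: measurable_funM.
  by apply: measurable_funD; apply: measurable_funM.
under eq_fun do rewrite G00_kernelE1 /=.
under [X in _ /\ measurable_fun _ X]eq_fun do rewrite G00_kernelE1 /=.
split; apply: measurable_funM => //.
  by apply: measurable_funB; [apply: mN|]; apply: measurable_funM.
by apply: measurable_funB; apply: measurable_funM.
Qed.

Lemma mx_measurable_G00 : mx_measurable (G00 f).
Proof.
move=> i j; rewrite ord1; have [mr mi] := measurable_kernel_apply i; split.
  under eq_fun do rewrite mxE /Cintegral /=.
  exact: (measurable_Rintegral_param mr).
under eq_fun do rewrite mxE /Cintegral /=.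
exact: (measurable_Rintegral_param mi).
Qed.

Lemma G00_entry_le x i :
  (`|complex.Re (G00 f x i 0)|%:E <= riesz (fun y => l1norm (f y)) x)%E /\
  (`|complex.Im (G00 f x i 0)|%:E <= riesz (fun y => l1norm (f y)) x)%E.
Proof.
have [mr mi] := measurable_kernel_apply i.
have mrx := measurableT_comp mr (measurable_pair1 x).
have mix := measurableT_comp mi (measurable_pair1 x).
have mR : measurable_fun (setT : set (plane R)) (fun y => rho (x - y) ^+ 3 * l1norm (f y)).
  by apply: measurable_funM; [exact: measurable_rho_subr|exact: measurable_l1norm].
have H y := G00_kernel_le x y (f y) i.
rewrite mxE /Cintegral /=; split.
  apply: (le_trans (abs_Rintegral_le mrx)); apply: ge0_le_integral_EFin => //.
    exact: (measurableT_comp (@normr_measurable R setT) mrx).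
  by move=> y; case: (H y).
apply: (le_trans (abs_Rintegral_le mix)); apply: ge0_le_integral_EFin => //.
  exact: (measurableT_comp (@normr_measurable R setT) mix).
by move=> y; case: (H y).
Qed.

Lemma l1norm_G00_le x :
  ((l1norm (G00 f x))%:E <= 4%:E * riesz (fun y => l1norm (f y)) x)%E.
Proof.
have I0 : (0 <= riesz (fun y => l1norm (f y)) x)%E.
  by apply: riesz_ge0 => y; exact: l1norm_ge0.
have [r0 i0] := G00_entry_le x ord0; have [r1 i1] := G00_entry_le x ord_max.
have -> : 4 = (1 + 1) + (1 + 1) :> R by ring.
rewrite /l1norm !EFinD !ge0_muleDl ?adde_ge0 // ?lee_fin // !mul1e.
by apply: leeD; apply: leeD.
Qed.

End Potential.
End ComplexEntries.

(** * The Dirac equation for the potential *)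

Section DiracPairing.
Context {R : realType}.
Local Notation mu := (mu2 R).
Local Notation c := ((2 * pi)^-1 : R).
Local Notation P1 := (potential (u1 0)).
Local Notation P2 := (potential (u2 0)).

Lemma Rintegral_comb2 (s1 s2 : R) (f1 f2 : plane R -> R) :
  mu.-integrable setT (EFin \o f1) -> mu.-integrable setT (EFin \o f2) ->
  mu.-integrable setT (EFin \o (fun x => s1 * f1 x + s2 * f2 x)) /\
  \int[mu]_x (s1 * f1 x + s2 * f2 x) = s1 * \int[mu]_x f1 x + s2 * \int[mu]_x f2 x.
Proof.
move=> i1 i2.
have j1 : mu.-integrable setT (EFin \o (fun x => s1 * f1 x)).
  by have := integrableZl measurableT s1 i1.
have j2 : mu.-integrable setT (EFin \o (fun x => s2 * f2 x)).
  by have := integrableZl measurableT s2 i2.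
split; first by have := integrableD measurableT j1 j2.
by rewrite (RintegralD measurableT j1 j2) !RintegralZl.
Qed.

Lemma Rintegral_comb4 (s1 s2 s3 s4 : R) (f1 f2 f3 f4 : plane R -> R) :
  mu.-integrable setT (EFin \o f1) -> mu.-integrable setT (EFin \o f2) ->
  mu.-integrable setT (EFin \o f3) -> mu.-integrable setT (EFin \o f4) ->
  \int[mu]_x ((s1 * f1 x + s2 * f2 x) + (s3 * f3 x + s4 * f4 x)) =
  (s1 * \int[mu]_x f1 x + s2 * \int[mu]_x f2 x) + (s3 * \int[mu]_x f3 x + s4 * \int[mu]_x f4 x).
Proof.
move=> i1 i2 i3 i4; have [j12 <-] := Rintegral_comb2 s1 s2 i1 i2.
by have [j34 <-] := Rintegral_comb2 s3 s4 i3 i4; rewrite RintegralD.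
Qed.

Lemma test_function_off_box (chi : plane R -> R[i]) : test_function chi ->
  exists A, off_box A (fun x => complex.Re (chi x)) /\ off_box A (fun x => complex.Im (chi x)).
Proof.
case=> _ _ cpt; have [M [_ MP]] := compact_bounded cpt.
have zero (x : R * R) : (M + 1 < `|x.1|) || (M + 1 < `|x.2|) -> chi x = 0.
  move=> xM; apply: contrapT => /eqP chix.
  have /(_ (M + 1) _ x)/= xb := MP; have : `|x| <= M + 1.
    by apply: xb; [rewrite ltrDl|exact: subset_closure].
  rewrite prod_normE ge_max => /andP[x1 x2].
  by move: xM; rewrite !ltNge x1 x2.
by exists (M + 1); split=> x /zero ->.
Qed.

(** The real and imaginary parts of a product, with the coefficients brought outside
    the integrals, so that only integrals of single potentials against single derivatives
    remain. *)
Lemma Cintegral_mul (s1 s2 s3 s4 : R) (p1 p2 p3 p4 g k : plane R -> R) (w d : plane R -> R[i]) :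
  (forall x, w x = (s1 * p1 x + s2 * p2 x) +i* (s3 * p3 x + s4 * p4 x)) ->
  (forall x, d x = g x +i* k x) ->
  mu.-integrable setT (EFin \o (fun x => p1 x * g x)) ->
  mu.-integrable setT (EFin \o (fun x => p2 x * g x)) ->
  mu.-integrable setT (EFin \o (fun x => p3 x * g x)) ->
  mu.-integrable setT (EFin \o (fun x => p4 x * g x)) ->
  mu.-integrable setT (EFin \o (fun x => p1 x * k x)) ->
  mu.-integrable setT (EFin \o (fun x => p2 x * k x)) ->
  mu.-integrable setT (EFin \o (fun x => p3 x * k x)) ->
  mu.-integrable setT (EFin \o (fun x => p4 x * k x)) ->
  Cintegral (fun x => w x * d x) =
  ((s1 * \int[mu]_x (p1 x * g x) + s2 * \int[mu]_x (p2 x * g x)) +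
   (- s3 * \int[mu]_x (p3 x * k x) + - s4 * \int[mu]_x (p4 x * k x))) +i*
  ((s1 * \int[mu]_x (p1 x * k x) + s2 * \int[mu]_x (p2 x * k x)) +
   (s3 * \int[mu]_x (p3 x * g x) + s4 * \int[mu]_x (p4 x * g x))).
Proof.
move=> wE dE g1 g2 g3 g4 k1 k2 k3 k4; rewrite /Cintegral.
rewrite -(Rintegral_comb4 _ _ _ _ g1 g2 k3 k4) -(Rintegral_comb4 _ _ _ _ k1 k2 g3 g4).
congr Complex; apply: eq_Rintegral => x _; rewrite wE dE /=;
  move: (p1 x) (p2 x) (p3 x) (p4 x) (g x) (k x) => *; ring.
Qed.

(** The purely algebraic core of the Dirac pairing, first component.  With
    q = 2 pi and f_0 = a + i b, the numbers a_kl and b_kl are the integrals of the potential of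
    the k-th kernel with density a or b against d_l of the real part of chi, and the second
    index is shifted by 2 for the imaginary part; ar, ai, br, bi are the integrals of a and b
    against the two parts of chi.  The four sums are the divergence identities and the
    four equalities the curl identities. *)
Lemma pairing_identity0 (q a11 a12 a21 a22 b11 b12 b21 b22 a13 a14 a23 a24 b13 b14 b23 b24
    ar ai br bi : R) : q != 0 ->
  a11 + a22 = - (q * ar) -> b11 + b22 = - (q * br) ->
  a13 + a24 = - (q * ai) -> b13 + b24 = - (q * bi) ->
  a21 = a12 -> b21 = b12 -> a23 = a14 -> b23 = b14 ->
  (((q^-1 * a21 + q^-1 * b11) + (- q^-1 * b23 + - - q^-1 * a13)) +
   ((q^-1 * b22 + - q^-1 * a12) + (- - q^-1 * a24 + - - q^-1 * b14)) = - (ai + br)) /\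
  (((q^-1 * a23 + q^-1 * b13) + (q^-1 * b21 + - q^-1 * a11)) +
   ((q^-1 * b24 + - q^-1 * a14) + (- q^-1 * a22 + - q^-1 * b12)) = ar - bi).
Proof.
move=> q0 E1 E2 E3 E4 -> -> -> ->.
have -> : a22 = - (q * ar) - a11 by rewrite -E1; ring.
have -> : b22 = - (q * br) - b11 by rewrite -E2; ring.
have -> : a24 = - (q * ai) - a13 by rewrite -E3; ring.
have -> : b24 = - (q * bi) - b13 by rewrite -E4; ring.
by split; field.
Qed.

(** The same for the second component, where the signs of the kernel entries differ. *)
Lemma pairing_identity1 (q a11 a12 a21 a22 b11 b12 b21 b22 a13 a14 a23 a24 b13 b14 b23 b24
    ar ai br bi : R) : q != 0 ->
  a11 + a22 = - (q * ar) -> b11 + b22 = - (q * br) ->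
  a13 + a24 = - (q * ai) -> b13 + b24 = - (q * bi) ->
  a21 = a12 -> b21 = b12 -> a23 = a14 -> b23 = b14 ->
  (((q^-1 * b11 + - q^-1 * a21) + (- - q^-1 * a13 + - - q^-1 * b23)) +
   ((q^-1 * a12 + q^-1 * b22) + (- q^-1 * b14 + - - q^-1 * a24)) = - (ai + br)) /\
  (((q^-1 * b13 + - q^-1 * a23) + (- q^-1 * a11 + - q^-1 * b21)) +
   ((q^-1 * a14 + q^-1 * b24) + (q^-1 * b12 + - q^-1 * a22)) = ar - bi).
Proof.
move=> q0 E1 E2 E3 E4 -> -> -> ->.
have -> : a22 = - (q * ar) - a11 by rewrite -E1; ring.
have -> : b22 = - (q * br) - b11 by rewrite -E2; ring.
have -> : a24 = - (q * ai) - a13 by rewrite -E3; ring.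
have -> : b24 = - (q * bi) - b13 by rewrite -E4; ring.
by split; field.
Qed.

Lemma muli_complex (u v : R) : 'i * (u +i* v) = (- v) +i* u :> R[i].
Proof. by apply/eqP; rewrite eq_complex /=; apply/andP; split; apply/eqP; ring. Qed.

Lemma mulNi_complex (u v : R) : - 'i * (u +i* v) = v +i* (- u) :> R[i].
Proof. by apply/eqP; rewrite eq_complex /=; apply/andP; split; apply/eqP; ring. Qed.

Lemma mul_i_pairing (X1 Y1 X2 Y2 S1 S2 : R) : X1 + X2 = - S2 -> Y1 + Y2 = S1 ->
  'i * (X1 +i* Y1 + X2 +i* Y2) = - (S1 +i* S2) :> R[i].
Proof.
move=> XE YE; have -> : X1 +i* Y1 + X2 +i* Y2 = (X1 + X2) +i* (Y1 + Y2) by [].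
rewrite XE YE; apply/eqP; rewrite eq_complex /=; apply/andP; split; apply/eqP; ring.
Qed.

Section Pairing.
Variables (f psi : plane R -> 'cV[R[i]]_2) (chi : plane R -> R[i]).
Hypothesis bRe : forall i, bounded_integrable (fun x => complex.Re (f x i 0)).
Hypothesis bIm : forall i, bounded_integrable (fun x => complex.Im (f x i 0)).
Hypothesis psiE : forall x, psi x = - G00 f x.
Hypothesis test_chi : test_function chi.

Let a i x := complex.Re (f x i 0).
Let b i x := complex.Im (f x i 0).

Lemma psi_entry0 x : psi x ord0 0 =
  (c * P1 (b ord_max) x + - c * P2 (a ord_max) x) +i*
  (- c * P1 (a ord_max) x + - c * P2 (b ord_max) x).
Proof.
have i1 h hb := @potential_integrable _ _ measurable_u1_joint u1_le0 h x hb.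
have i2 h hb := @potential_integrable _ _ measurable_u2_joint u2_le0 h x hb.
rewrite psiE !mxE /Cintegral.
under eq_Rintegral do rewrite G00_kernelE0 /=.
under [X in _ +i* X]eq_Rintegral do rewrite G00_kernelE0 /=.
have := Rintegral_comb2 c (- c) (i2 _ (bRe ord_max)) (i1 _ (bIm ord_max)).
have := Rintegral_comb2 c c (i1 _ (bRe ord_max)) (i2 _ (bIm ord_max)).
move=> [_ E1] [_ E2].
apply/eqP; rewrite eq_complex /=; apply/andP; split; apply/eqP.
  transitivity (- \int[mu]_y (c * (u2 0 y x * a ord_max y) + - c * (u1 0 y x * b ord_max y))).
    by congr (- _); apply: eq_Rintegral => y _; rewrite mulrBr mulNr.
  by rewrite E2 /potential /a /b; ring.
transitivity (- \int[mu]_y (c * (u1 0 y x * a ord_max y) + c * (u2 0 y x * b ord_max y))).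
  by congr (- _); apply: eq_Rintegral => y _; rewrite mulrDr.
by rewrite E1 /potential /a /b; ring.
Qed.

Lemma psi_entry1 x : psi x ord_max 0 =
  (c * P2 (a ord0) x + c * P1 (b ord0) x) +i* (c * P2 (b ord0) x + - c * P1 (a ord0) x).
Proof.
have i1 h hb := @potential_integrable _ _ measurable_u1_joint u1_le0 h x hb.
have i2 h hb := @potential_integrable _ _ measurable_u2_joint u2_le0 h x hb.
rewrite psiE !mxE /Cintegral.
under eq_Rintegral do rewrite G00_kernelE1 /=.
under [X in _ +i* X]eq_Rintegral do rewrite G00_kernelE1 /=.
have := Rintegral_comb2 (- c) (- c) (i2 _ (bRe ord0)) (i1 _ (bIm ord0)).
have := Rintegral_comb2 c (- c) (i1 _ (bRe ord0)) (i2 _ (bIm ord0)).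
move=> [_ E1] [_ E2].
apply/eqP; rewrite eq_complex /=; apply/andP; split; apply/eqP.
  transitivity (- \int[mu]_y (- c * (u2 0 y x * a ord0 y) + - c * (u1 0 y x * b ord0 y))).
    by congr (- _); apply: eq_Rintegral => y _; rewrite mulrBr mulrN !mulNr.
  by rewrite E2 /potential /a /b; ring.
transitivity (- \int[mu]_y (c * (u1 0 y x * a ord0 y) + - c * (u2 0 y x * b ord0 y))).
  by congr (- _); apply: eq_Rintegral => y _; rewrite mulrBr mulNr.
by rewrite E1 /potential /a /b; ring.
Qed.

Let A := projT1 (cid (test_function_off_box test_chi)).
Let chir x := complex.Re (chi x).
Let chii x := complex.Im (chi x).
Let C1r : C1_off_box A chir (partial ord0 chir) (partial ord_max chir).
Proof.
rewrite /A; case: cid => A' /= [offr _]; apply: smooth_C1_off_box => //.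
by case: test_chi.
Qed.
Let C1i : C1_off_box A chii (partial ord0 chii) (partial ord_max chii).
Proof.
rewrite /A; case: cid => A' /= [_ offi]; apply: smooth_C1_off_box => //.
by case: test_chi.
Qed.

Let I1 d h : mu.-integrable setT (EFin \o d) -> bounded_integrable h ->
  mu.-integrable setT (EFin \o (fun x => P1 h x * d x)).
Proof. by move=> id hb; apply: (integrable_potentialM measurable_u1_joint u1_le0). Qed.
Let I2 d h : mu.-integrable setT (EFin \o d) -> bounded_integrable h ->
  mu.-integrable setT (EFin \o (fun x => P2 h x * d x)).
Proof. by move=> id hb; apply: (integrable_potentialM measurable_u2_joint u2_le0). Qed.

Let c1 := partial ord0 chir.
Let c2 := partial ord_max chir.
Let e1 := partial ord0 chii.
Let e2 := partial ord_max chii.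
Let ic1 : mu.-integrable setT (EFin \o c1). Proof. by case: (C1_bounded_integrable1 C1r). Qed.
Let ic2 : mu.-integrable setT (EFin \o c2). Proof. by case: (C1_bounded_integrable2 C1r). Qed.
Let ie1 : mu.-integrable setT (EFin \o e1). Proof. by case: (C1_bounded_integrable1 C1i). Qed.
Let ie2 : mu.-integrable setT (EFin \o e2). Proof. by case: (C1_bounded_integrable2 C1i). Qed.

Let dchi1 x : Cpartial ord0 chi x = c1 x +i* e1 x. Proof. by []. Qed.
Let dchi2 x : Cpartial ord_max chi x = c2 x +i* e2 x. Proof. by []. Qed.

Lemma dist_entry i : dist f chi i =
  (\int[mu]_x (a i x * chir x) - \int[mu]_x (b i x * chii x)) +i*
  (\int[mu]_x (a i x * chii x) + \int[mu]_x (b i x * chir x)).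
Proof.
have icr : mu.-integrable setT (EFin \o chir).
  exact: continuous_off_box_integrable (C1_continuous C1r) (C1_off C1r).
have ici : mu.-integrable setT (EFin \o chii).
  exact: continuous_off_box_integrable (C1_continuous C1i) (C1_off C1i).
rewrite /dist /Cintegral; congr Complex.
  rewrite -RintegralB //; [|exact: integrable_mul_bounded (bRe i) icr|
    exact: integrable_mul_bounded (bIm i) ici].
  by apply: eq_Rintegral => x _; rewrite ReM.
rewrite -RintegralD //; [|exact: integrable_mul_bounded (bRe i) ici|
  exact: integrable_mul_bounded (bIm i) icr].
by apply: eq_Rintegral => x _; rewrite ImM.
Qed.

Lemma alpha_mul0 k (w : 'cV[R[i]]_2) : (alpha R k *m w) ord0 0 =
  if k == ord0 then w ord_max 0 else - 'i * w ord_max 0.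
Proof.
rewrite mxE sum_ord2 /alpha; case: ifP => _; rewrite !mxE /=; first by rewrite mul0r add0r mul1r.
by rewrite mul0r add0r.
Qed.

Lemma alpha_mul1 k (w : 'cV[R[i]]_2) : (alpha R k *m w) ord_max 0 =
  if k == ord0 then w ord0 0 else 'i * w ord0 0.
Proof.
rewrite mxE sum_ord2 /alpha; case: ifP => _; rewrite !mxE /=; first by rewrite mul0r addr0 mul1r.
by rewrite mul0r addr0.
Qed.

Lemma D0_dist_G00_0 : D0_dist psi chi ord0 = - dist f chi ord0.
Proof.
rewrite dist_entry /D0_dist sum_ord2.
have ba := bRe ord0; have bb := bIm ord0.
have q0 : 2 * pi != 0 :> R by rewrite mulf_neq0 // gt_eqF // pi_gt0.
have [X Y] := pairing_identity0 q0 (potential_divergence C1r ba) (potential_divergence C1r bb)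
  (potential_divergence C1i ba) (potential_divergence C1i bb)
  (potential_curl C1r ba) (potential_curl C1r bb) (potential_curl C1i ba) (potential_curl C1i bb).
have W1 x : (alpha R ord0 *m psi x) ord0 0 =
    (c * P2 (a ord0) x + c * P1 (b ord0) x) +i* (c * P2 (b ord0) x + - c * P1 (a ord0) x).
  by rewrite alpha_mul0 psi_entry1.
have W2 x : (alpha R ord_max *m psi x) ord0 0 =
    (c * P2 (b ord0) x + - c * P1 (a ord0) x) +i* (- c * P2 (a ord0) x + - c * P1 (b ord0) x).
  by rewrite alpha_mul0 psi_entry1 mulNi_complex opprD -!mulNr.
rewrite (Cintegral_mul W1 dchi1 (I2 ic1 ba) (I1 ic1 bb) (I2 ic1 bb) (I1 ic1 ba)
  (I2 ie1 ba) (I1 ie1 bb) (I2 ie1 bb) (I1 ie1 ba)).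
rewrite (Cintegral_mul W2 dchi2 (I2 ic2 bb) (I1 ic2 ba) (I2 ic2 ba) (I1 ic2 bb)
  (I2 ie2 bb) (I1 ie2 ba) (I2 ie2 ba) (I1 ie2 bb)).
exact: (mul_i_pairing X Y).
Qed.

Lemma D0_dist_G00_1 : D0_dist psi chi ord_max = - dist f chi ord_max.
Proof.
rewrite dist_entry /D0_dist sum_ord2.
have ba := bRe ord_max; have bb := bIm ord_max.
have q0 : 2 * pi != 0 :> R by rewrite mulf_neq0 // gt_eqF // pi_gt0.
have [X Y] := pairing_identity1 q0 (potential_divergence C1r ba) (potential_divergence C1r bb)
  (potential_divergence C1i ba) (potential_divergence C1i bb)
  (potential_curl C1r ba) (potential_curl C1r bb) (potential_curl C1i ba) (potential_curl C1i bb).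
have W1 x : (alpha R ord0 *m psi x) ord_max 0 =
    (c * P1 (b ord_max) x + - c * P2 (a ord_max) x) +i*
    (- c * P1 (a ord_max) x + - c * P2 (b ord_max) x).
  by rewrite alpha_mul1 psi_entry0.
have W2 x : (alpha R ord_max *m psi x) ord_max 0 =
    (c * P1 (a ord_max) x + c * P2 (b ord_max) x) +i*
    (c * P1 (b ord_max) x + - c * P2 (a ord_max) x).
  by rewrite alpha_mul1 psi_entry0 muli_complex opprD !mulNr !opprK.
rewrite (Cintegral_mul W1 dchi1 (I1 ic1 bb) (I2 ic1 ba) (I1 ic1 ba) (I2 ic1 bb)
  (I1 ie1 bb) (I2 ie1 ba) (I1 ie1 ba) (I2 ie1 bb)).
rewrite (Cintegral_mul W2 dchi2 (I1 ic2 ba) (I2 ic2 bb) (I1 ic2 bb) (I2 ic2 ba)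
  (I1 ie2 ba) (I2 ie2 bb) (I1 ie2 bb) (I2 ie2 ba)).
exact: (mul_i_pairing X Y).
Qed.

(** The pairing of psi with D_0 chi is a combination of potentials of the real and
    imaginary parts of f against the derivatives of chi; the divergence identity produces the
    pairing of f with chi and the curl identity cancels everything else. *)
Lemma D0_dist_G00 i : D0_dist psi chi i = - dist f chi i.
Proof. by have [->|->] := ord2P i; [exact: D0_dist_G00_0|exact: D0_dist_G00_1]. Qed.

End Pairing.
End DiracPairing.

(** * The factorisation of the matrix potential *)

Section MatrixBounds.
Context {R : realType}.
Local Notation normc := Normc.normc.
Local Open Scope sesquilinear_scope.

Lemma Re_conj (z : R[i]) : complex.Re (Num.conj z) = complex.Re z.
Proof. by case: z. Qed.

Lemma Im_conj (z : R[i]) : complex.Im (Num.conj z) = - complex.Im z.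
Proof. by case: z. Qed.

Lemma normc_sqr (z : R[i]) : normc z ^+ 2 = complex.Re z ^+ 2 + complex.Im z ^+ 2.
Proof. by case: z => a b /=; rewrite sqr_sqrtr // addr_ge0 ?sqr_ge0. Qed.

Lemma normc_ge0 (z : R[i]) : 0 <= normc z.
Proof. by case: z => a b; exact: sqrtr_ge0. Qed.

Lemma normc_conj (z : R[i]) : normc (Num.conj z) = normc z.
Proof. by case: z => a b /=; rewrite sqrrN. Qed.

Lemma normc_real (r : R) : normc r%:C = `|r|.
Proof. by rewrite /= expr0n /= addr0 sqrtr_sqr. Qed.

Lemma abs_Re_le (z : R[i]) : `|complex.Re z| <= normc z.
Proof. by case: z => a b /=; rewrite -sqrtr_sqr ler_wsqrtr // lerDl sqr_ge0. Qed.

Lemma abs_Im_le (z : R[i]) : `|complex.Im z| <= normc z.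
Proof. by case: z => a b /=; rewrite -sqrtr_sqr ler_wsqrtr // lerDr sqr_ge0. Qed.

Lemma normc_le_ReIm (z : R[i]) : normc z <= `|complex.Re z| + `|complex.Im z|.
Proof.
rewrite -ler_sqr ?nnegrE ?addr_ge0 ?normc_ge0 // normc_sqr sqrrD !real_normK ?num_real //.
by rewrite -addrA lerD2l lerDr mulrn_wge0 // mulr_ge0.
Qed.

Lemma adjE m n (M : 'M[R[i]]_(m, n)) i j : (M ^t*) i j = Num.conj (M j i).
Proof. by rewrite !mxE. Qed.

(** The rows of a unitary matrix are unit vectors. *)
Lemma unitary_entry_le1 (B : 'M[R[i]]_2) i j : B \is unitarymx -> normc (B i j) <= 1.
Proof.
move/unitarymxP/matrixP/(_ i i); rewrite mxE sum_ord2 !adjE mxE eqxx mulr1n.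
move=> /(congr1 (@complex.Re R)); rewrite ReD !ReM !Re_conj !Im_conj /= => E.
have E2 : normc (B i ord0) ^+ 2 + normc (B i ord_max) ^+ 2 = 1.
  by rewrite !normc_sqr -E; ring.
rewrite -(@ler_pXn2r _ 2) ?nnegrE ?normc_ge0 // expr1n -E2.
by have [->|->] := ord2P j; rewrite ?lerDl ?lerDr sqr_ge0.
Qed.

Lemma diagCE (d : 'I_2 -> R) i j : diagC d i j = if i == j then (d i)%:C else 0.
Proof. by rewrite !mxE; case: eqP => [->|]. Qed.

Lemma diagC_mulmx (d : 'I_2 -> R) n (A : 'M[R[i]]_(2, n)) i j :
  (diagC d *m A) i j = (d i)%:C * A i j.
Proof. by rewrite mul_diag_mx !mxE. Qed.

Lemma diagC_of_diagonalization (V B : 'M[R[i]]_2) (d : 'I_2 -> R) : B \is unitarymx ->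
  V = B ^t* *m diagC d *m B -> diagC d = B *m V *m B ^t*.
Proof.
move=> Bu ->; have /unitarymxP BB := Bu.
by rewrite !mulmxA BB mul1mx -mulmxA BB mulmx1.
Qed.

(** The eigenvalue is a diagonal entry of B V B^*, a sum of four products of an entry of
    V with two entries of modulus at most 1. *)
Lemma eigenvalue_le (V B : 'M[R[i]]_2) (d : 'I_2 -> R) (K : R) j : B \is unitarymx ->
  V = B ^t* *m diagC d *m B -> (forall i k, normc (V i k) <= K) -> `|d j| <= 4 * K.
Proof.
move=> Bu VE VK; have DE := diagC_of_diagonalization Bu VE.
have -> : d j = complex.Re ((diagC d) j j) by rewrite diagCE eqxx.
have K0 : 0 <= K by exact: le_trans (normc_ge0 (V ord0 ord0)) (VK _ _).
have b1 i k : normc (B i k) <= 1 by exact: unitary_entry_le1.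
have t i k : normc (B j i * V i k * (B ^t*) k j) <= K.
  rewrite !Normc.normcM adjE normc_conj -[leRHS]mulr1.
  apply: ler_pM => //; rewrite ?mulr_ge0 ?normc_ge0 //.
  by rewrite -[leRHS]mul1r; apply: ler_pM => //; exact: normc_ge0.
have row k : normc ((B *m V) j k * (B ^t*) k j) <= K + K.
  rewrite mxE sum_ord2 mulrDl; apply: (le_trans (le_normcD _ _)); exact: lerD.
have -> : 4 * K = (K + K) + (K + K) by ring.
apply: (le_trans (abs_Re_le _)); rewrite DE mxE sum_ord2.
by apply: (le_trans (le_normcD _ _)); apply: lerD.
Qed.

Lemma vmx_adjE (B : plane R -> 'M[R[i]]_2) (zeta : 'I_2 -> plane R -> R) x i j :
  ((vmx B zeta x) ^t*) i j = Num.conj (B x j i) * (Num.sqrt `|zeta j x|)%:C.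
Proof.
rewrite adjE /vmx diagC_mulmx; move: (Num.sqrt _) (B x j i) => r [p q].
by apply/eqP; rewrite eq_complex /=; apply/andP; split; apply/eqP; ring.
Qed.

Lemma vmx_adj_Umx_vmx (V B : plane R -> 'M[R[i]]_2) (zeta : 'I_2 -> plane R -> R) x :
  diagonalizes V B zeta -> (vmx B zeta x) ^t* *m Umx zeta x *m vmx B zeta x = V x.
Proof.
move=> VB; have [_ ->] := VB x; apply/matrixP => i j.
have sg k : Num.sqrt `|zeta k x| * (sign1 (zeta k x) * Num.sqrt `|zeta k x|) = zeta k x.
  rewrite mulrCA -expr2 sqr_sqrtr // /sign1; case: leP => z0.
    by rewrite ger0_norm // mul1r.
  by rewrite ltr0_norm // mulN1r opprK.
have L k : ((vmx B zeta x) ^t*) i k * (Umx zeta x *m vmx B zeta x) k j =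
    ((B x) ^t*) i k * (diagC (fun j => zeta j x) *m B x) k j.
  rewrite vmx_adjE adjE !diagC_mulmx -[in RHS](sg k).
  by move: (Num.sqrt _) (sign1 _) => r s; rewrite !rmorphM /= -!mulrA.
by rewrite -(mulmxA _ (Umx _ _)) -(mulmxA _ (diagC _)) mxE [RHS]mxE !sum_ord2 !L.
Qed.

Lemma Umx_sqr (zeta : 'I_2 -> plane R -> R) x : Umx zeta x *m Umx zeta x = 1%:M.
Proof.
apply/matrixP => i j; rewrite diagC_mulmx diagCE mxE; case: eqP => [->|_]; last by rewrite mulr0.
by rewrite -rmorphM /sign1; case: ifP => _; rewrite /= ?mulrNN mulr1.
Qed.

Lemma sum_normc_le (w : 'cV[R[i]]_2) : normc (w ord0 0) + normc (w ord_max 0) <= l1norm w.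
Proof. by apply: lerD; exact: normc_le_ReIm. Qed.

Lemma normc_le_vec_norm (w : 'cV[R[i]]_2) j : normc (w j 0) <= vec_norm w.
Proof.
rewrite -[leLHS]ger0_norm ?normc_ge0 // -sqrtr_sqr ler_wsqrtr // sum_ord2.
by have [->|->] := ord2P j; rewrite ?lerDl ?lerDr sqr_ge0.
Qed.

Lemma l1norm_mulmx_le (M : 'M[R[i]]_2) (w : 'cV[R[i]]_2) (K : R) :
  (forall i j, normc (M i j) <= K) ->
  l1norm (M *m w) <= 4 * K * (normc (w ord0 0) + normc (w ord_max 0)).
Proof.
move=> MK; set S := _ + normc _.
have e i : normc ((M *m w) i 0) <= K * S.
  rewrite mxE sum_ord2 mulrDr; apply: (le_trans (le_normcD _ _)).
  by apply: lerD; rewrite Normc.normcM ler_wpM2r ?normc_ge0.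
have -> : 4 * K * S = (K * S + K * S) + (K * S + K * S) by ring.
apply: lerD; apply: lerD; first [exact: le_trans (abs_Re_le _) (e _) | exact: le_trans (abs_Im_le _) (e _)].
Qed.

Lemma vec_norm_le_l1norm (w : 'cV[R[i]]_2) : vec_norm w <= l1norm w.
Proof.
apply: le_trans (sum_normc_le w).
have a0 := normc_ge0 (w ord0 0); have b0 := normc_ge0 (w ord_max 0).
rewrite /vec_norm -[leRHS]ger0_norm ?addr_ge0 // -sqrtr_sqr ler_wsqrtr // sum_ord2 sqrrD.
by rewrite -addrA lerD2l lerDr mulrn_wge0 // mulr_ge0.
Qed.

Lemma l1normN (w : 'cV[R[i]]_2) : l1norm (- w) = l1norm w.
Proof. by rewrite /l1norm !mxE !ReN !ImN !normrN. Qed.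

Lemma abs_entry_le_l1norm (w : 'cV[R[i]]_2) i :
  `|complex.Re (w i 0)| <= l1norm w /\ `|complex.Im (w i 0)| <= l1norm w.
Proof.
have h (a b p q : R) : 0 <= a -> 0 <= b -> 0 <= p -> 0 <= q ->
    [/\ a <= (a + b) + (p + q), b <= (a + b) + (p + q), p <= (a + b) + (p + q) &
        q <= (a + b) + (p + q)] by move=> *; split; lra.
have [h1 h2 h3 h4] := h _ _ _ _ (normr_ge0 (complex.Re (w ord0 0)))
  (normr_ge0 (complex.Im (w ord0 0))) (normr_ge0 (complex.Re (w ord_max 0)))
  (normr_ge0 (complex.Im (w ord_max 0))).
by have [->|->] := ord2P i.
Qed.

End MatrixBounds.

Section MatrixMeasurability.
Context {R : realType}.
Local Open Scope sesquilinear_scope.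

Definition Cmeasurable (f : plane R -> R[i]) : Prop :=
  measurable_fun (setT : set (plane R)) (fun x => complex.Re (f x)) /\
  measurable_fun (setT : set (plane R)) (fun x => complex.Im (f x)).

Lemma CmeasurableM (f g : plane R -> R[i]) :
  Cmeasurable f -> Cmeasurable g -> Cmeasurable (fun x => f x * g x).
Proof.
move=> [fr fi] [gr gi]; split.
  under eq_fun do rewrite ReM.
  by apply: measurable_funB; exact: measurable_funM.
under eq_fun do rewrite ImM.
by apply: measurable_funD; exact: measurable_funM.
Qed.

Lemma CmeasurableD (f g : plane R -> R[i]) :
  Cmeasurable f -> Cmeasurable g -> Cmeasurable (fun x => f x + g x).
Proof.
move=> [fr fi] [gr gi]; split.
  by under eq_fun do rewrite ReD; exact: measurable_funD.
by under eq_fun do rewrite ImD; exact: measurable_funD.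
Qed.

Lemma mx_measurable_mul m n (A : plane R -> 'M[R[i]]_(m, 2)) (B : plane R -> 'M[R[i]]_(2, n)) :
  mx_measurable A -> mx_measurable B -> mx_measurable (fun x => A x *m B x).
Proof.
move=> mA mB i j.
have : Cmeasurable (fun x => A x i ord0 * B x ord0 j + A x i ord_max * B x ord_max j).
  apply: CmeasurableD; apply: CmeasurableM; by [exact: mA|exact: mB].
have e x : (A x *m B x) i j = A x i ord0 * B x ord0 j + A x i ord_max * B x ord_max j.
  by rewrite mxE sum_ord2.
by move=> [h1 h2]; split; under eq_fun do rewrite e.
Qed.

Lemma mx_measurable_adj m n (A : plane R -> 'M[R[i]]_(m, n)) :
  mx_measurable A -> mx_measurable (fun x => (A x) ^t*).
Proof.
move=> mA i j; have [h1 h2] := mA j i; split.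
  by under eq_fun do rewrite adjE Re_conj.
under eq_fun do rewrite adjE Im_conj.
exact: (measurableT_comp (@oppr_measurable R setT) h2).
Qed.

Lemma mx_measurableN m n (A : plane R -> 'M[R[i]]_(m, n)) :
  mx_measurable A -> mx_measurable (fun x => - A x).
Proof.
move=> mA i j; have [h1 h2] := mA i j; split.
  under eq_fun do rewrite mxE ReN.
  exact: (measurableT_comp (@oppr_measurable R setT) h1).
under eq_fun do rewrite mxE ImN.
exact: (measurableT_comp (@oppr_measurable R setT) h2).
Qed.

Lemma mx_measurable_diagC (d : 'I_2 -> plane R -> R) :
  (forall j, measurable_fun setT (d j)) -> mx_measurable (fun x => diagC (fun j => d j x)).
Proof.
move=> md i j; split; under eq_fun do rewrite diagCE.
  by case: eqP => _ /=; [exact: md|exact: measurable_cst].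
by case: eqP => _ /=; exact: measurable_cst.
Qed.

(** B V B^* is diagonal with the eigenvalues as entries. *)
Lemma measurable_eigenvalue (V B : plane R -> 'M[R[i]]_2) (zeta : 'I_2 -> plane R -> R) j :
  mx_measurable V -> mx_measurable B -> diagonalizes V B zeta -> measurable_fun setT (zeta j).
Proof.
move=> mV mB VB.
have := mx_measurable_mul (mx_measurable_mul mB mV) (mx_measurable_adj mB).
move=> /(_ j j)[+ _]; apply: eq_measurable_fun => x _.
by have [Bu VE] := VB x; rewrite -(diagC_of_diagonalization Bu VE) diagCE eqxx.
Qed.

Lemma mx_measurable_vmx (V B : plane R -> 'M[R[i]]_2) (zeta : 'I_2 -> plane R -> R) :
  mx_measurable V -> mx_measurable B -> diagonalizes V B zeta ->
  mx_measurable (vmx B zeta).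
Proof.
move=> mV mB VB; apply: mx_measurable_mul => //.
apply: mx_measurable_diagC => j.
have mz := measurable_eigenvalue j mV mB VB.
have -> : (fun x => Num.sqrt `|zeta j x|) = (fun x => `|zeta j x| `^ 2^-1).
  by apply/funext => x; rewrite powR12_sqrt.
apply: (measurableT_comp (measurable_powR _)).
exact: (measurableT_comp (@normr_measurable R setT) mz).
Qed.

End MatrixMeasurability.

(** * Decay, integrability and the function spaces *)

Section SolutionSpaces.
Context {R : realType}.
Local Notation mu := (mu2 R).
Local Notation normc := Normc.normc.

Lemma measurable_vec_norm (f : plane R -> 'cV[R[i]]_2) : mx_measurable f ->
  measurable_fun setT (fun x => vec_norm (f x)).
Proof.
move=> mf.
have -> : (fun x => vec_norm (f x)) =
    (fun x => (((complex.Re (f x ord0 0) ^+ 2 + complex.Im (f x ord0 0) ^+ 2) +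
     (complex.Re (f x ord_max 0) ^+ 2 + complex.Im (f x ord_max 0) ^+ 2)) `^ 2^-1)).
  apply/funext => x; rewrite /vec_norm sum_ord2 !normc_sqr powR12_sqrt //.
  by rewrite !addr_ge0 ?sqr_ge0.
apply: (measurableT_comp (measurable_powR _)).
by apply: measurable_funD; apply: measurable_funD; apply: measurable_funX;
  by [case: (mf ord0 0)|case: (mf ord_max 0)].
Qed.

Lemma compact_measurable_plane (K : set (R * R)) : compact K -> measurable (K : set (plane R)).
Proof.
move=> cK; have cl : closed K by apply: compact_closed => //; exact: norm_hausdorff.
rewrite -(setCK K); apply: measurableC; apply: open_measurable_plane.
exact: closed_openC.
Qed.

Lemma bounded_locally_integrable (f : plane R -> 'cV[R[i]]_2) (M : R) :
  mx_measurable f -> (forall x, vec_norm (f x) <= M) -> vec_locally_integrable f.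
Proof.
move=> mf fM; split=> // K cK.
have mK := compact_measurable_plane cK.
have M0 : 0 <= M by apply: le_trans (fM 0); exact: sqrtr_ge0.
have [A [_ KA]] := compact_bounded cK.
have KB : K `<=` box (A + 1).
  move=> x Kx; apply/in_box.
  have /(_ (A + 1) _ x Kx)/= xA := KA.
  have : `|x| <= A + 1 by apply: xA; rewrite ltrDl.
  by rewrite prod_normE ge_max => /andP[].
apply: (@le_lt_trans _ _ (\int[mu]_(x in K) (cst M%:E) x)%E).
  apply: ge0_le_integral => //.
  - by move=> x _; rewrite lee_fin sqrtr_ge0.
  - apply/measurable_EFinP; apply: measurable_funTS; exact: measurable_vec_norm.
  - by move=> x _; rewrite lee_fin.
rewrite integral_cst // lte_mul_pinfty // ?ltry //.
apply: le_lt_trans (mu2_box_lty (A + 1)); apply: le_measure => //; rewrite inE //.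
exact: measurable_box.
Qed.

(** The p-th power of 1/<x> is integrable in the plane because p > 2; for p infinite,
    1/<x> <= 1. *)
Lemma in_Lp_of_decay (f : plane R -> 'cV[R[i]]_2) (C : R) (p : \bar R) :
  mx_measurable f -> 0 <= C -> (forall x, vec_norm (f x) <= C / japanese x) ->
  (2%:E < p)%E -> in_Lp p f.
Proof.
move=> mf C0 fC p2; split=> //.
have mN := measurable_vec_norm mf.
have N0 x : 0 <= vec_norm (f x) by exact: sqrtr_ge0.
rewrite inE /=; apply/andP; split; rewrite inE //=.
rewrite /finite_norm unlock; case: p p2 => [r|_|//].
  rewrite lte_fin => r2; apply: poweR_lty.
  apply: (@le_lt_trans _ _ (\int[mu]_x (C `^ r * japanese x `^ (- r))%:E)%E).
    have r0 : 0 <= r by lra.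
    under eq_integral => x _ do rewrite /= ger0_norm //.
    apply: ge0_le_integral_EFin => //.
    - exact: (measurableT_comp (measurable_powR _)).
    - by apply: measurable_funM => //; exact: measurable_japanese_powR.
    - by move=> x; rewrite powR_ge0.
    move=> x; have j0 : 0 < japanese x by exact: lt_le_trans (japanese_ge1 x).
    have -> : C `^ r * japanese x `^ (- r) = (C / japanese x) `^ r.
      by rewrite powRM ?invr_ge0 ?(ltW j0) // -(powR_inv1 (ltW j0)) -powRrM mulN1r.
    apply: ge0_ler_powR => //; rewrite nnegrE // mulr_ge0 // invr_ge0; exact: ltW.
  rewrite ge0_integralZl_EFin_mul ?powR_ge0 //.
  - by apply: lte_mul_pinfty; rewrite ?lee_fin ?powR_ge0 //; exact: integral_japanese_lty.
  - exact: measurable_japanese_powR.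
  - by move=> x; exact: powR_ge0.
case: ifP => // _; apply: (@le_lt_trans _ _ C%:E); last exact: ltry.
apply/ess_sup_inf.ess_supP; apply: aeW => x /=; rewrite lee_fin ger0_norm // (le_trans (fC x)) //.
rewrite ler_pdivrMr; last exact: lt_le_trans (japanese_ge1 x).
by rewrite ler_peMr // japanese_ge1.
Qed.

(** Changing the density on a null set does not change the potential at any point; thus
    psi = - G (V psi) will hold everywhere and not only almost everywhere. *)
Lemma eq_G00 (f g : plane R -> 'cV[R[i]]_2) x : mx_measurable f -> mx_measurable g ->
  {ae mu, forall y, f y = g y} -> G00 f x = G00 g x.
Proof.
move=> mf mg fg; apply/matrixP => i j; rewrite !mxE /Cintegral.
have [fr fi] := measurable_kernel_apply mf i; have [gr gi] := measurable_kernel_apply mg i.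
have p1 := @measurable_pair1 _ _ (plane R) (plane R) x.
congr Complex; congr fine; apply: ae_eq_integral => //.
- by apply/measurable_EFinP; exact: (measurableT_comp fr p1).
- by apply/measurable_EFinP; exact: (measurableT_comp gr p1).
- by apply: filterS fg => y /= -> _.
- by apply/measurable_EFinP; exact: (measurableT_comp fi p1).
- by apply/measurable_EFinP; exact: (measurableT_comp gi p1).
- by apply: filterS fg => y /= -> _.
Qed.

(** Boundedness of the potential, put into the second bound on F, shows that F is at most
    a multiple of the weight, whose potential decays. *)
Lemma riesz_bootstrap (b C1 C2 : R) (F g : plane R -> R) : 2 < b -> 0 <= C1 -> 0 <= C2 ->
  measurable_fun setT F -> measurable_fun setT g ->
  (forall y, 0 <= F y) -> (forall y, 0 <= g y) -> (\int[mu]_y (g y ^+ 2)%:E < +oo)%E ->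
  (forall y, F y <= C1 * (japanese y `^ (- (b / 2)) * g y)) ->
  {ae mu, forall y, ((F y)%:E <= (C2 * japanese y `^ (- b))%:E * riesz F y)%E} ->
  exists2 M : R, 0 <= M & forall x, (riesz F x <= (M / japanese x)%:E)%E.
Proof.
move=> b2 C10 C20 mF mg F0 g0 g2 Fg FJ.
have [M M0 FM] := riesz_bounded b2 C10 C20 mF mg F0 g0 g2 Fg FJ.
have [D D0 JD] := riesz_decay b2.
have K0 : 0 <= C2 * M by exact: mulr_ge0.
exists (C2 * M * D); first exact: mulr_ge0.
pose G (y : plane R) := C2 * M * japanese y `^ (- b).
have mJ := measurable_japanese_powR (R := R) (- b).
have mG : measurable_fun setT G by exact: measurable_funM.
have G0 y : 0 <= G y by apply: mulr_ge0 => //; exact: powR_ge0.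
move=> x; apply: (@le_trans _ _ (riesz G x)).
  apply: le_riesz => //; apply: filterS FJ => y Fy.
  rewrite -lee_fin; apply: (le_trans Fy).
  apply: (@le_trans _ _ ((C2 * japanese y `^ (- b))%:E * M%:E)%E).
    by apply: lee_wpmul2l => //; rewrite lee_fin mulr_ge0 // powR_ge0.
  by rewrite -EFinM lee_fin /G mulrAC.
rewrite /riesz.
have -> : (\int[mu]_y (rho (x - y) ^+ 3 * G y)%:E)%E =
    (\int[mu]_y ((C2 * M) * (rho (x - y) ^+ 3 * japanese y `^ (- b)))%:E)%E.
  by apply: eq_integral => y _; rewrite /G mulrCA.
rewrite ge0_integralZl_EFin_mul //.
- by rewrite -(mulrA (C2 * M)) [X in (_ <= X)%E]EFinM; apply: lee_wpmul2l; rewrite ?lee_fin.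
- by apply: measurable_funM => //; exact: measurable_rho_subr.
- by move=> y; rewrite mulr_ge0 ?powR_ge0 // exprn_ge0 // rho_ge0.
Qed.

Lemma japanese_bounded_integrable (b K : R) (h : plane R -> R) : 2 < b ->
  measurable_fun setT h -> (forall x, `|h x| <= K * japanese x `^ (- b)) ->
  bounded_integrable h.
Proof.
move=> b2 mh hK.
have K0 : 0 <= K.
  have j0 : 0 < japanese (0 : plane R) `^ (- b).
    by rewrite powR_gt0 // (lt_le_trans _ (japanese_ge1 _)).
  by rewrite -(pmulr_lge0 _ j0); exact: le_trans (hK 0).
split.
  exists K => x; apply: (le_trans (hK x)).
  by rewrite ler_piMr // japanese_powR_le1 //; lra.
apply/integrableP; split; first exact/measurable_EFinP.
apply: (@le_lt_trans _ _ (\int[mu]_x (K * japanese x `^ (- b))%:E)%E).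
  apply: ge0_le_integral_EFin => //.
  - exact: measurableT_comp.
  - by apply: measurable_funM => //; exact: measurable_japanese_powR.
rewrite ge0_integralZl_EFin_mul //.
- by apply: lte_mul_pinfty; rewrite ?lee_fin //; exact: integral_japanese_lty.
- exact: measurable_japanese_powR.
- by move=> x; exact: powR_ge0.
Qed.

(** The entries of v^* are square roots of eigenvalues times entries of a unitary
    matrix. *)
Lemma vmx_adj_entry_le (V B : plane R -> 'M[R[i]]_2) (zeta : 'I_2 -> plane R -> R) x (K : R) i j :
  diagonalizes V B zeta -> (forall i j, normc (V x i j) <= K) ->
  normc ((((vmx B zeta x) ^t*)%sesqui) i j) <= Num.sqrt (4 * K).
Proof.
move=> VB VK; have [Bu VE] := VB x.
rewrite vmx_adjE Normc.normcM normc_conj normc_real ger0_norm ?sqrtr_ge0 //.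
rewrite -[leRHS]mul1r; apply: ler_pM; rewrite ?normc_ge0 ?sqrtr_ge0 ?unitary_entry_le1 //.
by rewrite ler_wsqrtr //; exact: eigenvalue_le Bu VE VK.
Qed.

End SolutionSpaces.

(** * The solution attached to an element of the kernel *)

Lemma ae_imply (R : realType) (P Q : plane R -> Prop) : (forall x, P x -> Q x) ->
  {ae mu2 R, forall x, P x} -> {ae mu2 R, forall x, Q x}.
Proof. by move=> PQ; exact: filterS. Qed.

Section KernelSolution.
Context {R : realType} (beta C : R) (V B : plane R -> 'M[R[i]]_2).
Variables (zeta : 'I_2 -> plane R -> R) (phi : plane R -> 'cV[R[i]]_2).
Hypotheses (beta2 : 2 < beta) (mV : mx_measurable V).
Hypothesis VC : forall x i j, Normc.normc (V x i j) <= C * japanese x `^ (- beta).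
Hypotheses (mB : mx_measurable B) (VB : diagonalizes V B zeta) (kerphi : ker_T B zeta phi).
Local Notation mu := (mu2 R).
Local Notation J x := (japanese x `^ (- beta)).

Let C_ge0 : 0 <= C.
Proof.
have j0 : 0 < japanese (0 : plane R) `^ (- beta).
  by rewrite powR_gt0 // (lt_le_trans _ (japanese_ge1 _)).
by rewrite -(pmulr_lge0 _ j0); apply: le_trans (VC 0 ord0 ord0); exact: normc_ge0.
Qed.

Definition charge y := ((vmx B zeta y) ^t*)%sesqui *m phi y.
Definition solution x := - G00 charge x.

Let mx_phi : mx_measurable phi. Proof. by case: kerphi => -[]. Qed.

Lemma mx_measurable_charge : mx_measurable charge.
Proof.
apply: mx_measurable_mul => //; apply: mx_measurable_adj.
exact: mx_measurable_vmx mV mB VB.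
Qed.

Lemma mx_measurable_solution : mx_measurable solution.
Proof. apply: mx_measurableN; apply: mx_measurable_G00; exact: mx_measurable_charge. Qed.

(** T phi = 0 reads U phi = v psi, and U is an involution. *)
Lemma phi_eq_ae : {ae mu, forall x, phi x = Umx zeta x *m vmx B zeta x *m solution x}.
Proof.
case: kerphi => _ Tphi; apply: ae_imply Tphi => x Tx; rewrite /solution -mulmxA mulmxN.
have -> : - (vmx B zeta x *m G00 charge x) = Umx zeta x *m phi x.
  by apply/esym/eqP; rewrite -addr_eq0; apply/eqP; exact: Tx.
by rewrite mulmxA Umx_sqr mul1mx.
Qed.

(** Apply v^* to phi = U v psi and use v^* U v = V. *)
Lemma charge_eq_ae : {ae mu, forall x, charge x = V x *m solution x}.
Proof.
apply: ae_imply phi_eq_ae => x phix.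
by rewrite /charge [in LHS]phix -(vmx_adj_Umx_vmx x VB) -!(mulmxA _ _ (solution x))
  -(mulmxA _ (Umx _ _)).
Qed.

(** The entries of v^* are at most 2 (C <y>^(-beta))^(1/2), which accounts for half of
    the decay of V. *)
Lemma l1norm_charge_le y : l1norm (charge y) <=
  16 * Num.sqrt C * (japanese y `^ (- (beta / 2)) * vec_norm (phi y)).
Proof.
have j0 : 0 < japanese y by exact: lt_le_trans (japanese_ge1 y).
(* The constant 16 is 4 (from the matrix product) times 2 (from this square root) times 2
   (two entries of phi, each at most its norm). *)
have jE : Num.sqrt (4 * (C * J y)) = 2 * Num.sqrt C * japanese y `^ (- (beta / 2)).
  have -> : 4 * (C * J y) = (2 * Num.sqrt C * japanese y `^ (- (beta / 2))) ^+ 2.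
    rewrite !exprMn sqr_sqrtr // -(powR_mulrn _ (powR_ge0 _ _)) -powRrM.
    have -> : - (beta / 2) * 2%:R = - beta by field.
    by move: (J y) => t; ring.
  by rewrite sqrtr_sqr ger0_norm // !mulr_ge0 ?sqrtr_ge0 ?powR_ge0.
have e := @l1norm_mulmx_le R _ (phi y) _
  (fun i j => vmx_adj_entry_le i j VB (VC y)).
apply: (le_trans e); rewrite jE.
have n0 := normc_le_vec_norm (phi y) ord0; have n1 := normc_le_vec_norm (phi y) ord_max.
set k := 4 * _; have k0 : 0 <= k by rewrite /k !mulr_ge0 ?sqrtr_ge0 ?powR_ge0.
apply: (@le_trans _ _ (k * (vec_norm (phi y) + vec_norm (phi y)))).
  by apply: ler_wpM2l => //; exact: lerD.
by rewrite le_eqVlt; apply/orP; left; apply/eqP; rewrite /k;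
  move: (vec_norm _) (_ `^ _) => s t; ring.
Qed.

Lemma l1norm_potential_le (w : 'cV[R[i]]_2) x : l1norm (V x *m w) <= 4 * C * (J x * l1norm w).
Proof.
apply: (le_trans (l1norm_mulmx_le _ (VC x))).
rewrite -!mulrA; apply: ler_wpM2l => //; apply: ler_wpM2l => //.
by apply: ler_wpM2l; [exact: powR_ge0|exact: sum_normc_le].
Qed.

Lemma l1norm_solution_decay : exists2 M : R, 0 <= M &
  forall x, l1norm (solution x) <= M / japanese x.
Proof.
have mc := mx_measurable_charge.
have [||||||||| M M0 FM] := @riesz_bootstrap R beta (16 * Num.sqrt C) (16 * C)
  (fun y => l1norm (charge y)) (fun y => vec_norm (phi y)) beta2.
- by rewrite mulr_ge0 ?sqrtr_ge0.
- by rewrite mulr_ge0.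
- exact: measurable_l1norm.
- exact: measurable_vec_norm.
- by move=> y; exact: l1norm_ge0.
- by move=> y; exact: sqrtr_ge0.
- case: kerphi => -[_ /Lfun2_integrable_sqr/integrableP[m2 i2]] _.
  apply: le_lt_trans i2; apply: ge0_le_integral => //.
  + by move=> x _; rewrite lee_fin sqr_ge0.
  + exact: (measurableT_comp _ m2).
  + by move=> x _; rewrite lee_fin ler_norm.
- exact: l1norm_charge_le.
- apply: ae_imply charge_eq_ae => y cy; rewrite [in X in (X <= _)%E]cy.
  apply: (@le_trans _ _ ((4 * C * J y)%:E * (l1norm (solution y))%:E)%E).
    by rewrite -EFinM lee_fin -(mulrA (4 * C)); exact: l1norm_potential_le.
  (* One factor 4 comes from the product by V, the other from the four real components of G. *)
  have -> : 16 * C * J y = (4 * C * J y) * 4 by move: (J y) => t; ring.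
  rewrite [X in (_ <= X * _)%E]EFinM -muleA; apply: lee_wpmul2l.
    by rewrite lee_fin !mulr_ge0 // powR_ge0.
  by rewrite /solution l1normN; exact: l1norm_G00_le.
exists (4 * M); first by rewrite mulr_ge0.
move=> x; rewrite -lee_fin /solution l1normN; apply: (le_trans (l1norm_G00_le mc x)).
by rewrite -mulrA [X in (_ <= X)%E]EFinM; apply: lee_wpmul2l.
Qed.

Lemma solution_distributional : H_distributional_solution V solution.
Proof.
have [M M0 dec] := l1norm_solution_decay.
have bnd x : l1norm (solution x) <= M.
  apply: (le_trans (dec x)); rewrite ler_pdivrMr.
    by rewrite ler_peMr // japanese_ge1.
  exact: lt_le_trans (japanese_ge1 x).
have ms := mx_measurable_solution; have mVs := mx_measurable_mul mV ms.
have VsJ x : l1norm (V x *m solution x) <= 4 * C * M * J x.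
  apply: (le_trans (l1norm_potential_le _ _)); rewrite -[leRHS]mulrA (mulrC M).
  apply: ler_wpM2l; first exact: mulr_ge0.
  by apply: ler_wpM2l => //; exact: powR_ge0.
split.
- apply: (bounded_locally_integrable (M := M)) => // x.
  exact: le_trans (vec_norm_le_l1norm _) (bnd x).
- apply: (bounded_locally_integrable (M := 4 * C * M)) => // x.
  apply: (le_trans (vec_norm_le_l1norm _)); apply: (le_trans (VsJ x)).
  have b0 : - beta <= 0 by rewrite oppr_le0 ltW // (lt_trans _ beta2).
  have K0 : 0 <= 4 * C * M by rewrite !mulr_ge0.
  by rewrite (ler_piMr K0) // japanese_powR_le1.
have entry i (x : plane R) : `|complex.Re ((V x *m solution x) i 0)| <= 4 * C * M * J x /\
    `|complex.Im ((V x *m solution x) i 0)| <= 4 * C * M * J x.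
  have [h1 h2] := abs_entry_le_l1norm (V x *m solution x) i.
  by split; [exact: le_trans h1 (VsJ x)|exact: le_trans h2 (VsJ x)].
have bRe i : bounded_integrable (fun x => complex.Re ((V x *m solution x) i 0)).
  exact: (japanese_bounded_integrable beta2 (mVs i 0).1 (fun x => (entry i x).1)).
have bIm i : bounded_integrable (fun x => complex.Im ((V x *m solution x) i 0)).
  exact: (japanese_bounded_integrable beta2 (mVs i 0).2 (fun x => (entry i x).2)).
have solE x : solution x = - G00 (fun y => V y *m solution y) x.
  by rewrite {1}/solution (eq_G00 x mx_measurable_charge mVs charge_eq_ae).
move=> chi tchi i; rewrite /H_dist (D0_dist_G00 bRe bIm solE tchi); exact: addNr.
Qed.

Lemma solution_in_Lp p : (2%:E < p)%E -> in_Lp p solution.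
Proof.
have [M M0 dec] := l1norm_solution_decay.
apply: (in_Lp_of_decay (C := M)) => //; first exact: mx_measurable_solution.
by move=> x; exact: le_trans (vec_norm_le_l1norm _) (dec x).
Qed.

End KernelSolution.

Theorem lemma7p1 (R : realType) (beta : R)
    (V B : plane R -> 'M[R[i]]_2) (zeta : 'I_2 -> plane R -> R)
    (phi : plane R -> 'cV[R[i]]_2) :
  2 < beta ->
  mx_measurable V ->
  (forall x, V x \is hermsymmx) ->
  (exists C : R, forall x i j,
     Normc.normc (V x i j) <= C * japanese x `^ (- beta)) ->
  mx_measurable B ->
  diagonalizes V B zeta ->
  ker_T B zeta phi ->
  exists psi : plane R -> 'cV[R[i]]_2,
    [/\ H_distributional_solution V psi,
        forall p : \bar R, (2%:E < p)%E -> in_Lp p psi &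
        {ae mu2 R, forall x, phi x = Umx zeta x *m vmx B zeta x *m psi x}].
Proof.
move=> beta2 mV _ [C VC] mB VB kerphi; exists (solution B zeta phi); split.
- exact: solution_distributional beta2 mV VC mB VB kerphi.
- by move=> p; exact: solution_in_Lp beta2 mV VC mB VB kerphi p.
- exact: phi_eq_ae kerphi.
Qed.
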